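(* Consider fully discrete solutions $(\rho_h^{n},\mu_{\rho,h}^{n},\theta_h^{n},\eta_h^{n},\mu_{\eta,h}^{n})$ (with the scheme of the context, $n=0,\dots,N$, $N\tau=T$, chemical potentials for $n\ge1$). Assume that the initial approximations have uniformly bounded availability, i.e. $\mathscr A_{a,h}^0\le C_0$ with $C_0$ independent of $h$ and $\tau$. Then a constant $C$, independent of $h$, $\tau$, and $n$, satisfies $$\sup_{0\le n\le N}\Big[\|\rho_h^n\|_{H^1}^2+\|\eta_h^n\|_{H^1}^2+\|\rho_h^n\|_{L^4}^4+\|\eta_h^n\|_{L^4}^4+\|\theta_h^n\|_{L^1}+\int_\Omega(\theta_h^n)^{-q}\,dx\Big]$$ $$\quad+\tau\sum_{n=0}^{N-1}\Big[\|\mu_{\rho,h}^{n+1}\|_{H^1}^2+\|\theta_h^{n+1}\|_{H^1}^2+\|\mu_{\eta,h}^{n+1}\|_{L^2}^2\Big]\le C.$$ In addition, $$\sup_n\big(\|e_h^n\|_{L^1(\Omega)}+\|s_{\rm bulk}(z_h^n,\theta_h^n)\|_{L^1(\Omega)}\big)\le C.$$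
   Context: $\Omega=\mathbb T^d$, $1\le d\le3$, flat torus, $T>0$, $z=(\rho,\eta)\in\mathbb R^2$, $(\cdot,\cdot)$ exact $L^2(\Omega)$ pairing. Potential: fix $q>1$ with $q\ge d$, constants $\varepsilon_1,\varepsilon_q,\gamma_\rho,\gamma_\eta>0$, and non-negative polynomials $F_0,F_1$ on $\mathbb R^2$ of degree at most four with $|DF_j(z)|\le C(1+|z|^3)$, $|D^2F_j(z)|\le C(1+|z|^2)$, such that for some $a>0$ (fixed), $c_a,C_a>0$: $aF_1(z)-F_0(z)\ge c_a|z|^4-C_a$. For $\theta>0$, $$\psi(z,\theta)=\ln\theta-\varepsilon_1\theta(\ln\theta-1)-\tfrac{\varepsilon_q}{q-1}\theta^{1-q}-F_0(z)+\theta F_1(z),\quad e=\partial_\theta\psi,\quad s_{\rm bulk}=\theta e-\psi .$$ Splitting: $\psi_{\rm vex}(z,\theta)=\psi(z,\theta)+M(1+\theta)(1+|z|^2)^2$, $\psi_{\rm cav}(z,\theta)=-M(1+\theta)(1+|z|^2)^2$, with a fixed $M>0$ such that for every $\theta>0$ $\psi_{\rm vex}(\cdot,\theta)$ is convex and $\psi_{\rm cav}(\cdot,\theta)$ concave. Mobility: $\mathbf L(z,\theta)\in\mathbb R^{(2d+1)\times(2d+1)}$ is continuous, bounded, symmetric, $\lambda_0|\zeta|^2\le\zeta^\top\mathbf L\zeta\le\lambda_1|\zeta|^2$ with $0<\lambda_0\le\lambda_1$, with blocks $\mathbf L_{11},\mathbf L_{12},\mathbf L_{22}\in\mathbb R^{d\times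 d}$, $\mathbf L_{13},\mathbf L_{23}\in\mathbb R^d$, $\mathbf L_{33}\in\mathbb R$ (rows $(\mathbf L_{11},\mathbf L_{12},\mathbf L_{13})$, $(\mathbf L_{12}^\top,\mathbf L_{22},\mathbf L_{23})$, $(\mathbf L_{13}^\top,\mathbf L_{23}^\top,\mathbf L_{33})$). $V_h$: continuous piecewise affine periodic finite-element space on a mesh from a shape-regular, quasi-uniform family of periodic simplicial meshes of $\Omega$. Put $\delta_\tau v^{n+1}=(v^{n+1}-v^n)/\tau$, $e_h^n=e(z_h^n,\theta_h^n)$, $\mathbf L_h^n=\mathbf L(z_h^n,\theta_h^n)$ (blocks $\mathbf L_{ij,h}^n$), $(G_{\rho,h}^{n+1},G_{\eta,h}^{n+1})=D_z\psi_{\rm vex}(z_h^{n+1},\theta_h^{n+1})+D_z\psi_{\rm cav}(z_h^n,\theta_h^{n+1})$. Fully discrete problem: given $(\rho_h^n,\theta_h^n,\eta_h^n)\in V_h^3$ with $\theta_h^n>0$ on $\overline\Omega$, find $(\rho_h^{n+1},\mu_{\rho,h}^{n+1},\theta_h^{n+1},\eta_h^{n+1},\mu_{\eta,h}^{n+1})\in V_h^5$ with $\theta_h^{n+1}>0$ on $\overline\Omega$ such that for all $(v_h,\zeta_h,\xi_h,w_h,\chi_h)\in V_h^5$ $$(\delta_\tau\rho_h^{n+1},v_h)+(\mathbf L_{11,h}^n\nabla\mu_{\rho,h}^{n+1}-\mathbf L_{12,h}^n\nabla\theta_h^{n+1}+\mathbf L_{13,h}^n\mu_{\eta,h}^{n+1},\nabla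 v_h)=0,$$ $$(\mu_{\rho,h}^{n+1},\zeta_h)=\gamma_\rho(\nabla\rho_h^{n+1},\nabla\zeta_h)+(G_{\rho,h}^{n+1},\zeta_h),$$ $$(\delta_\tau e_h^{n+1},\xi_h)+((\mathbf L_{12,h}^n)^\top\nabla\mu_{\rho,h}^{n+1}-\mathbf L_{22,h}^n\nabla\theta_h^{n+1}+\mathbf L_{23,h}^n\mu_{\eta,h}^{n+1},\nabla\xi_h)=0,$$ $$(\delta_\tau\eta_h^{n+1},w_h)+(\mathbf L_{13,h}^n\cdot\nabla\mu_{\rho,h}^{n+1}-\mathbf L_{23,h}^n\cdot\nabla\theta_h^{n+1}+\mathbf L_{33,h}^n\mu_{\eta,h}^{n+1},w_h)=0,$$ $$(\mu_{\eta,h}^{n+1},\chi_h)=\gamma_\eta(\nabla\eta_h^{n+1},\nabla\chi_h)+(G_{\eta,h}^{n+1},\chi_h).$$ Discrete availability: $\mathscr A_{a,h}^n=a\int_\Omega e_h^n\,dx-\int_\Omega s_{\rm bulk}(z_h^n,\theta_h^n)\,dx+\frac{\gamma_\rho}2\|\nabla\rho_h^n\|_{L^2}^2+\frac{\gamma_\eta}2\|\nabla\eta_h^n\|_{L^2}^2$. *)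

(* Defs.v *)
From HB Require Import structures.
From mathcomp Require Import all_boot all_order all_algebra polyXY.
From mathcomp Require Import all_classical all_reals all_analysis.

Set Implicit Arguments.
Unset Strict Implicit.
Unset Printing Implicit Defensive.

Import Order.TTheory GRing.Theory Num.Theory.
Import numFieldNormedType.Exports.

Local Open Scope classical_set_scope.
Local Open Scope ring_scope.

(* The flat torus is R^d / Z^d: functions on it are Z^d-periodic functions on
   'cV[R]_d, and integrals are taken over the fundamental cell [0,1]^d. *)

Section Euclidean.
Variables (R : realType) (d : nat).
Implicit Types u v x : 'cV[R]_d.

Definition dot u v : R := (u^T *m v) 0 0.

(* The library norm `|u| on matrices is the max norm. *)
Definition enorm u : R := Num.sqrt (dot u u).

Definition lattice (k : 'cV[int]_d) : 'cV[R]_d := map_mx intr k.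

Definition periodic (v : 'cV[R]_d -> R) : Prop :=
  forall x k, v (x + lattice k) = v x.

(* For a continuous piecewise affine v this is the weak gradient: off the mesh skeleton,
   which is a null set, it is the classical one. *)
Definition grad (v : 'cV[R]_d -> R) x : 'cV[R]_d :=
  \col_i 'D_(delta_mx i 0) v x.

Definition diameter (A : set 'cV[R]_d) : R :=
  sup [set s | exists x y, [/\ A x, A y & s = enorm (x - y)]].

Definition inball_diameter (A : set 'cV[R]_d) : R :=
  sup [set s | exists x r,
    [/\ 0 <= r, [set y | enorm (y - x) <= r] `<=` A & s = 2 * r]].

End Euclidean.

Section TorusIntegral.
Variable R : realType.

Local Notation RT := (measurableTypeR R).

Definition consT n (p : RT * n.-tuple RT) : n.+1.-tuple RT :=
  [tuple of p.1 :: p.2].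

Lemma measurable_consT n : measurable_fun [set: RT * n.-tuple RT] (@consT n).
Proof. exact: measurable_cons measurable_fst measurable_snd. Qed.

HB.instance Definition _ n :=
  isMeasurableFun.Build _ _ (RT * n.-tuple RT)%type (n.+1.-tuple RT)
    (@consT n) (@measurable_consT n).

(* Lebesgue measure restricted to [0,1]^d, as a d-fold product; tuples are used
   because the library has no measurable structure on matrices. *)
Fixpoint cube_measure d : probability (d.-tuple RT) R :=
  match d with
  | 0 => dirac [tuple]
  | n.+1 =>
      distribution (uniform_prob (@ltr01 R) \x cube_measure n)%E (@consT n)
  end.

Definition intT d (f : 'cV[R]_d -> R) : R :=
  \int[cube_measure d]_t f (\col_i tnth t i).

End TorusIntegral.

Section FiniteElements.
Variables (R : realType) (d : nat).

Definition barycentric (w : 'I_d.+1 -> R) : Prop :=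
  (forall a, 0 <= w a) /\ \sum_a w a = 1.

(* The face of the simplex with vertices p spanned by the p a with a in S. *)
Definition face (p : 'I_d.+1 -> 'cV[R]_d) (S : set 'I_d.+1) : set 'cV[R]_d :=
  [set x | exists w : 'I_d.+1 -> R,
    [/\ barycentric w, forall a, ~ S a -> w a = 0 & x = \sum_a w a *: p a]].

Definition simplex (p : 'I_d.+1 -> 'cV[R]_d) : set 'cV[R]_d := face p setT.

Definition edge_mx (p : 'I_d.+1 -> 'cV[R]_d) : 'M[R]_d :=
  \matrix_(i, j) (p (lift ord0 j) - p ord0) i 0.

(* A Z^d-invariant conforming triangulation of R^d: its simplices are the
   translates by Z^d of finitely many cells. *)
Record periodic_mesh := PeriodicMesh {
  ncells : nat;
  vtx : 'I_ncells -> 'I_d.+1 -> 'cV[R]_d;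
  mesh_nondegenerate : forall i, edge_mx (vtx i) \in unitmx;
  mesh_cover : forall x, exists i k, simplex (vtx i) (x - lattice R k);
  mesh_conforming : forall i j k,
    simplex (vtx i) `&` simplex (fun b => vtx j b + lattice R k) =
    face (vtx i) [set a | exists b, vtx i a = vtx j b + lattice R k];
  mesh_distinct : forall i j k,
    (forall a, exists b, vtx i a = vtx j b + lattice R k) -> i = j /\ k = 0 }.

Definition cell (K : periodic_mesh) (i : 'I_(ncells K)) : set 'cV[R]_d :=
  simplex (@vtx K i).

Definition mesh_size (K : periodic_mesh) : R :=
  \big[Num.max/0]_(i < ncells K) diameter (cell i).

Definition shape_regular (I : Type) (mesh : I -> periodic_mesh) : Prop :=
  exists sigma : R, forall h (i : 'I_(ncells (mesh h))),
    diameter (cell i) <= sigma * inball_diameter (cell i).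

Definition quasi_uniform (I : Type) (mesh : I -> periodic_mesh) : Prop :=
  exists2 kappa : R, 0 < kappa & forall h (i : 'I_(ncells (mesh h))),
    kappa * mesh_size (mesh h) <= diameter (cell i).

Definition Vh (K : periodic_mesh) : set ('cV[R]_d -> R) :=
  [set v | [/\ continuous v, periodic v & forall i : 'I_(ncells K),
    exists (g : 'cV[R]_d) (c : R), forall x, cell i x -> v x = dot g x + c]].

End FiniteElements.

Section Norms.
Variables (R : realType) (d : nat).
Implicit Type v : 'cV[R]_d -> R.

Definition normL1 v : R := intT (fun x => `|v x|).
Definition normL2sq v : R := intT (fun x => v x ^+ 2).
Definition normL4pow4 v : R := intT (fun x => `|v x| ^+ 4).
Definition gradL2sq v : R := intT (fun x => enorm (grad v x) ^+ 2).
Definition normH1sq v : R := normL2sq v + gradL2sq v.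

End Norms.

Section Potential.
Variable R : realType.
Implicit Types (z : R * R) (t : R) (f : R * R -> R).

Definition d1 f z : R := derive1 (fun r => f (r, z.2)) z.1.
Definition d2 f z : R := derive1 (fun r => f (z.1, r)) z.2.

Definition abs2 z : R := Num.sqrt (z.1 ^+ 2 + z.2 ^+ 2).

Definition grad_abs f z : R := abs2 (d1 f z, d2 f z).
Definition hess_abs f z : R :=
  Num.sqrt (d1 (d1 f) z ^+ 2 + d1 (d2 f) z ^+ 2
            + d2 (d1 f) z ^+ 2 + d2 (d2 f) z ^+ 2).

Record params := Params {
  q : R;
  eps1 : R;
  epsq : R;
  gamma_rho : R;
  gamma_eta : R;
  F0 : {poly {poly R}};
  F1 : {poly {poly R}};
  avail_a : R;
  split_M : R }.

Variable P : params.

Definition ev (F : {poly {poly R}}) z : R := F.[z.1, z.2].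

Definition psi z t : R :=
  ln t - eps1 P * t * (ln t - 1) - epsq P / (q P - 1) * t `^ (1 - q P)
  - ev (F0 P) z + t * ev (F1 P) z.

Definition internal_energy z t : R := derive1 (psi z) t.

Definition s_bulk z t : R := t * internal_energy z t - psi z t.

Definition psi_vex z t : R :=
  psi z t + split_M P * (1 + t) * (1 + abs2 z ^+ 2) ^+ 2.

Definition psi_cav z t : R := - (split_M P * (1 + t) * (1 + abs2 z ^+ 2) ^+ 2).

Definition degree_le4 (F : {poly {poly R}}) : Prop :=
  forall i j, (4 < i + j)%N -> F`_j`_i = 0.

Definition admissible_poly (F : {poly {poly R}}) : Prop :=
  [/\ degree_le4 F, forall z, 0 <= ev F z
    & exists C : R, forall z,
        grad_abs (ev F) z <= C * (1 + abs2 z ^+ 3) /\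
        hess_abs (ev F) z <= C * (1 + abs2 z ^+ 2)].

Definition convex_fun f : Prop :=
  convex_function [set: convex_lmodType (R^o * R^o)%type] f.

Definition admissible_params (d : nat) : Prop :=
  [/\ 1 < q P /\ d%:R <= q P,
      [/\ 0 < eps1 P, 0 < epsq P, 0 < gamma_rho P & 0 < gamma_eta P],
      admissible_poly (F0 P) /\ admissible_poly (F1 P),
      0 < avail_a P /\ (exists ca Ca : R, [/\ 0 < ca, 0 < Ca & forall z,
        ca * abs2 z ^+ 4 - Ca <= avail_a P * ev (F1 P) z - ev (F0 P) z])
    & 0 < split_M P /\ (forall t, 0 < t ->
        convex_fun (psi_vex ^~ t) /\ convex_fun (fun z => - psi_cav z t))].

End Potential.

Section Mobility.
Variables (R : realType) (d : nat).
Implicit Type A : 'M[R]_(d + (d + 1)).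

Definition L11 A : 'M[R]_d := ulsubmx A.
Definition L12 A : 'M[R]_d := lsubmx (ursubmx A).
Definition L13 A : 'cV[R]_d := rsubmx (ursubmx A).
Definition L22 A : 'M[R]_d := ulsubmx (drsubmx A).
Definition L23 A : 'cV[R]_d := ursubmx (drsubmx A).
Definition L33 A : R := (drsubmx (drsubmx A)) 0 0.

(* The state space is (rho, eta) in R^2, theta > 0. *)
Definition admissible_mobility (L : R * R -> R -> 'M[R]_(d + (d + 1))) : Prop :=
  [/\ forall p : (R * R) * R, 0 < p.2 -> {for p, continuous (fun p => L p.1 p.2)},
      exists B : R, forall z t, 0 < t -> `|L z t| <= B,
      forall z t, 0 < t -> (L z t)^T = L z t
    & exists lambda0 lambda1 : R, [/\ 0 < lambda0, lambda0 <= lambda1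
        & forall z t (zeta : 'cV[R]_(d + (d + 1))), 0 < t ->
            lambda0 * enorm zeta ^+ 2 <= dot zeta (L z t *m zeta)
              <= lambda1 * enorm zeta ^+ 2]].

End Mobility.

Section Scheme.
Variables (R : realType) (d : nat) (P : params R).
Variable L : R * R -> R -> 'M[R]_(d + (d + 1)).
Variables (K : periodic_mesh R d) (tau : R).

(* mu_rho 0 and mu_eta 0 are unused. *)
Record discrete := Discrete {
  rho : nat -> 'cV[R]_d -> R;
  mu_rho : nat -> 'cV[R]_d -> R;
  theta : nat -> 'cV[R]_d -> R;
  eta : nat -> 'cV[R]_d -> R;
  mu_eta : nat -> 'cV[R]_d -> R }.

Variable u : discrete.

Definition zh n x : R * R := (rho u n x, eta u n x).
Definition eh n x : R := internal_energy P (zh n x) (theta u n x).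
Definition sh n x : R := s_bulk P (zh n x) (theta u n x).
Definition Lh n x : 'M[R]_(d + (d + 1)) := L (zh n x) (theta u n x).

Definition Grho n x : R :=
  d1 (psi_vex P ^~ (theta u n.+1 x)) (zh n.+1 x)
  + d1 (psi_cav P ^~ (theta u n.+1 x)) (zh n x).
Definition Geta n x : R :=
  d2 (psi_vex P ^~ (theta u n.+1 x)) (zh n.+1 x)
  + d2 (psi_cav P ^~ (theta u n.+1 x)) (zh n x).

Definition delta (v : nat -> 'cV[R]_d -> R) n x : R := (v n.+1 x - v n x) / tau.

Definition ip (f g : 'cV[R]_d -> R) : R := intT (fun x => f x * g x).
Definition ipv (f g : 'cV[R]_d -> 'cV[R]_d) : R := intT (fun x => dot (f x) (g x)).

Definition flux_rho n x : 'cV[R]_d :=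
  L11 (Lh n x) *m grad (mu_rho u n.+1) x
  - L12 (Lh n x) *m grad (theta u n.+1) x
  + mu_eta u n.+1 x *: L13 (Lh n x).

Definition flux_e n x : 'cV[R]_d :=
  (L12 (Lh n x))^T *m grad (mu_rho u n.+1) x
  - L22 (Lh n x) *m grad (theta u n.+1) x
  + mu_eta u n.+1 x *: L23 (Lh n x).

Definition rate_eta n x : R :=
  dot (L13 (Lh n x)) (grad (mu_rho u n.+1) x)
  - dot (L23 (Lh n x)) (grad (theta u n.+1) x)
  + L33 (Lh n x) * mu_eta u n.+1 x.

Definition scheme_step n : Prop :=
  forall v zeta xi w chi, Vh K v -> Vh K zeta -> Vh K xi -> Vh K w -> Vh K chi ->
  [/\ ip (delta (rho u) n) v + ipv (flux_rho n) (grad v) = 0,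
      ip (mu_rho u n.+1) zeta =
        gamma_rho P * ipv (grad (rho u n.+1)) (grad zeta) + ip (Grho n) zeta,
      ip (delta eh n) xi + ipv (flux_e n) (grad xi) = 0,
      ip (delta (eta u) n) w + ip (rate_eta n) w = 0
    & ip (mu_eta u n.+1) chi =
        gamma_eta P * ipv (grad (eta u n.+1)) (grad chi) + ip (Geta n) chi].

Definition discrete_solution N : Prop :=
  [/\ forall n, (n <= N)%N -> [/\ Vh K (rho u n), Vh K (theta u n), Vh K (eta u n)
        & forall x, 0 < theta u n x],
      forall n, (n < N)%N -> Vh K (mu_rho u n.+1) /\ Vh K (mu_eta u n.+1)
    & forall n, (n < N)%N -> scheme_step n].

Definition availability n : R :=
  avail_a P * intT (eh n) - intT (sh n)
  + gamma_rho P / 2 * gradL2sq (rho u n) + gamma_eta P / 2 * gradL2sq (eta u n).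

Definition state_norms n : R :=
  normH1sq (rho u n) + normH1sq (eta u n)
  + normL4pow4 (rho u n) + normL4pow4 (eta u n)
  + normL1 (theta u n) + intT (fun x => theta u n x `^ (- q P)).

Definition dissipation_norms n : R :=
  normH1sq (mu_rho u n.+1) + normH1sq (theta u n.+1) + normL2sq (mu_eta u n.+1).

End Scheme.

(* Main.v *)
(* Testing the balance laws with the chemical potentials and the temperature, and
   the potential relations with the increments of the phase fields, makes the
   availability decay: the convex-concave splitting in [z], the concavity of [psi]
   in [theta] and convexity of the gradient terms turn the increments into
   differences, and ellipticity of [L] controls the gradients of [mu_rho] and
   [theta] and [mu_eta] itself.  The availability is coercive because
   [a e - s] dominates [theta + theta ^ (- q) + |z| ^ 4].

   For the [H1] norms, Poincare's inequality leaves the means.  The mean of [mu_rho]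
   is that of the potential gradient, of size [(1 + theta) (1 + |z| ^ 3)]; by
   Hoelder it is controlled by the [L4] norms of [theta] and [z], hence, by the
   embedding of [H1] into [L4] in dimension at most three, by the dissipation.

   Poincare's inequality and the embedding are proved for finite element functions
   by integrating along coordinate lines, where these functions are piecewise
   affine; all the integrands are bounded and measurable. *)
Require Import Defs.
From mathcomp Require Import all_boot all_order all_algebra polyXY ring lra.
From mathcomp Require Import all_classical all_reals all_analysis measurable_realfun.

Set Implicit Arguments.
Unset Strict Implicit.
Unset Printing Implicit Defensive.

Import Order.TTheory GRing.Theory Num.Theory.
Import numFieldNormedType.Exports.

Local Open Scope classical_set_scope.
Local Open Scope ring_scope.

(** * Bounded measurable functions *)

(** Uniformity in the mesh comes from the inequalities themselves: in [Vh_poincare] and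
    [Vh_ladyzhenskaya] the constants are 1 and 8, because an integral over a coordinate line of the
    unit cell meets the mesh only through the fundamental theorem of calculus. The obstacle is that
    [grad] is a pointwise derivative with a default value at kinks. Its measurability and the
    fundamental theorem are therefore drawn from one-sided slopes: on a line, every point has an
    affine piece on either side, and a supremum argument glues these pieces without listing them.

    The estimate closes by a count of exponents. The dissipation controls only the square of the H1
    norm of [theta], summed in time, so the mean of [mu_rho] may grow at most linearly in that norm.
    Hoelder's inequality with exponents 4 and 4/3 gives exactly this growth, because coercivity has
    already bounded the L4 norm of the phase fields uniformly in time. The total energy is
    conserved, as the constant test function shows, so the weight [avail_a] leaves the decay
    unchanged and can be chosen for coercivity alone. *)

Section BoundedMeasurable.
Context d (T : measurableType d) (R : realType).
Implicit Types (f g : T -> R).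

(** This class is closed under ring operations and integrable against every probability measure, so
    integrability never has to be examined for a particular integrand. *)
Definition bm f := measurable_fun setT f /\ exists M, forall x, `|f x| <= M.

Lemma bm_cst (c : R) : bm (fun _ => c).
Proof. by split; [exact: measurable_cst|exists `|c|]. Qed.

Lemma bmD f g : bm f -> bm g -> bm (fun x => f x + g x).
Proof.
move=> [mf [M fM]] [mg [N gN]]; split; first exact: measurable_funD.
by exists (M + N) => x; rewrite (le_trans (ler_normD _ _))// lerD.
Qed.

Lemma bmM f g : bm f -> bm g -> bm (fun x => f x * g x).
Proof.
move=> [mf [M fM]] [mg [N gN]]; split; first exact: measurable_funM.
by exists (M * N) => x; rewrite normrM ler_pM.
Qed.

Lemma bmN f : bm f -> bm (fun x => - f x).
Proof.
move=> [mf [M fM]]; split; first exact: measurable_funN.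
by exists M => x; rewrite normrN.
Qed.

Lemma bmB f g : bm f -> bm g -> bm (fun x => f x - g x).
Proof. by move=> bf bg; apply: bmD => //; exact: bmN. Qed.

Lemma bmX f n : bm f -> bm (fun x => f x ^+ n).
Proof.
move=> bf; elim: n => [|n IHn]; first exact: bm_cst.
by rewrite (_ : (fun _ => _) = fun x => f x * f x ^+ n);
  [exact: bmM|apply/funext => x; rewrite exprS].
Qed.

Lemma bm_norm f : bm f -> bm (fun x => `|f x|).
Proof.
move=> [mf [M fM]]; split; first exact: measurableT_comp.
by exists M => x; rewrite normr_id.
Qed.

Lemma bm_sum (I : Type) (r : seq I) (p : pred I) (F : I -> T -> R) :
  (forall i, bm (F i)) -> bm (fun x => \sum_(i <- r | p i) F i x).
Proof.
move=> bF; elim: r => [|i r IHr].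
  under eq_fun do rewrite big_nil; exact: bm_cst.
under eq_fun do rewrite big_cons.
by case: (p i) => //; exact: bmD.
Qed.

Lemma bm_between f lo hi : measurable_fun setT f ->
  (forall x, lo <= f x <= hi) -> bm f.
Proof.
move=> mf lh; split => //; exists (Num.max `|lo| `|hi|) => x.
have /andP[l h] := lh x; rewrite ler_norml lerNl; apply/andP; split.
  by rewrite le_max (le_trans (_ : - f x <= - lo)) ?lerN2// -normrN ler_norm.
by rewrite le_max (le_trans h (ler_norm _)) orbT.
Qed.

Section Expectation.
Variable P : probability T R.

Lemma bm_integrable f : bm f -> P.-integrable setT (EFin \o f).
Proof.
move=> [mf [M fM]]; apply: measurable_bounded_integrable => //.
  by apply: (le_lt_trans (probability_le1 P measurableT)); rewrite ltry.
by exists M; split; [exact: num_real|move=> N MN x _; exact: (le_trans (fM x) (ltW MN))].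
Qed.

Lemma E_cst (c : R) : \int[P]_x c = c.
Proof. by rewrite Rintegral_cst// [X in fine X](probability_setT P) mulr1. Qed.

Lemma E_le f g : bm f -> bm g -> (forall x, f x <= g x) ->
  \int[P]_x f x <= \int[P]_x g x.
Proof. by move=> bf bg fg; apply: le_Rintegral => //; exact: bm_integrable. Qed.

Lemma E_ge0 f : (forall x, 0 <= f x) -> 0 <= \int[P]_x f x.
Proof. by move=> f0; exact: Rintegral_ge0. Qed.

Lemma E_D f g : bm f -> bm g ->
  \int[P]_x (f x + g x) = \int[P]_x f x + \int[P]_x g x.
Proof. by move=> bf bg; rewrite RintegralD//; exact: bm_integrable. Qed.

Lemma E_B f g : bm f -> bm g ->
  \int[P]_x (f x - g x) = \int[P]_x f x - \int[P]_x g x.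
Proof. by move=> bf bg; rewrite RintegralB//; exact: bm_integrable. Qed.

Lemma E_Z (c : R) f : bm f -> \int[P]_x (c * f x) = c * \int[P]_x f x.
Proof. by move=> bf; rewrite RintegralZl//; exact: bm_integrable. Qed.

Lemma E_ext f g : f =1 g -> \int[P]_x f x = \int[P]_x g x.
Proof. by move=> fg; apply: eq_Rintegral => x _. Qed.

Lemma E_bnd f (M : R) : (forall x, `|f x| <= M) -> measurable_fun setT f ->
  `|\int[P]_x f x| <= M.
Proof.
move=> fM mf; have bf : bm f by split => //; exists M.
rewrite (le_trans (le_normr_Rintegral _ (bm_integrable bf)))//.
by rewrite -[leRHS]E_cst; apply: E_le => //; [exact: bm_norm|exact: bm_cst].
Qed.

(** The quadratic form [pos] in [(s, t)] is nonnegative. At [(- B, A)] it equals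
    [A * (A * C - B ^+ 2)]; if [A = 0], the choice [(- (C + 1), B)] forces [B = 0]. *)
Lemma E_cauchy_schwarz f g : bm f -> bm g ->
  (\int[P]_x (f x * g x)) ^+ 2 <=
  (\int[P]_x (f x ^+ 2)) * \int[P]_x (g x ^+ 2).
Proof.
move=> bf bg.
set A := \int[P]_x (f x ^+ 2); set B := \int[P]_x (f x * g x).
set C := \int[P]_x (g x ^+ 2).
have bff := bmX 2 bf; have bgg := bmX 2 bg; have bfg := bmM bf bg.
have pos s t : 0 <= s ^+ 2 * A + (2 * s * t * B + t ^+ 2 * C).
  have := E_ge0 (fun x => sqr_ge0 (s * f x + t * g x)).
  rewrite (E_ext (g := fun x => s ^+ 2 * f x ^+ 2 +
    (2 * s * t * (f x * g x) + t ^+ 2 * g x ^+ 2))); last by move=> x; ring.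
  rewrite E_D ?E_D ?E_Z//.
    by apply: bmM => //; exact: bm_cst.
    by apply: bmM => //; exact: bm_cst.
    by apply: bmM => //; exact: bm_cst.
  by apply: bmD; apply: bmM => //; exact: bm_cst.
have A0 : 0 <= A by apply: E_ge0 => x; exact: sqr_ge0.
have C0 : 0 <= C by apply: E_ge0 => x; exact: sqr_ge0.
have [A_eq0|A_neq0] := eqVneq A 0.
  by have := pos (- (C + 1)) B; rewrite A_eq0; have := sqr_ge0 B; nra.
have A_gt0 : 0 < A by rewrite lt_neqAle eq_sym A_neq0.
have := pos (- B) A; have := sqr_ge0 B; nra.
Qed.

End Expectation.
End BoundedMeasurable.

Lemma bm_comp d1 d2 (T1 : measurableType d1) (T2 : measurableType d2)
    (R : realType) (h : T1 -> T2) (f : T2 -> R) :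
  measurable_fun setT h -> bm f -> bm (f \o h).
Proof.
move=> mh [mf [M fM]]; split; first exact: measurableT_comp.
by exists M => x; exact: fM.
Qed.

(** * Partial integrals and Fubini's theorem for bounded measurable functions *)

Section Product.
Context d1 d2 (X : measurableType d1) (Y : measurableType d2) (R : realType).
Variables (P : probability X R) (Q : probability Y R).

Lemma bm_slice1 (f : X * Y -> R) y : bm f -> bm (fun x => f (x, y)).
Proof. by apply: (bm_comp (h := fun x => (x, y))); exact: measurable_pair2. Qed.

Lemma bm_slice2 (f : X * Y -> R) x : bm f -> bm (fun y => f (x, y)).
Proof. by apply: (bm_comp (h := fun y => (x, y))); exact: measurable_pair1. Qed.

Lemma EFin_E (f : X * Y -> R) x : bm f ->
  (\int[Q]_y f (x, y))%:E = (\int[Q]_y (f (x, y))%:E)%E.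
Proof.
move=> bf; rewrite /Rintegral fineK//.
by apply: integrable_fin_num => //; apply: (bm_integrable Q (bm_slice2 x bf)).
Qed.

Lemma bm_int2 (f : X * Y -> R) : bm f -> bm (fun x => \int[Q]_y f (x, y)).
Proof.
move=> bf; have [mf [M fM]] := bf; split.
  apply/measurable_EFinP.
  rewrite (_ : _ \o _ = fun x => (\int[Q]_y (f (x, y))%:E)%E); last first.
    by apply/funext => x /=; exact: EFin_E.
  by have := measurable_fubini_F (bm_integrable (P \x Q)%E bf).
by exists M => x; apply: E_bnd => //; have [] := bm_slice2 x bf.
Qed.

End Product.

Section Fubini.
Context d1 d2 (X : measurableType d1) (Y : measurableType d2) (R : realType).
Variables (P : probability X R) (Q : probability Y R).

Lemma EFin_E1 (f : X * Y -> R) y : bm f ->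
  (\int[P]_x f (x, y))%:E = (\int[P]_x (f (x, y))%:E)%E.
Proof.
move=> bf; rewrite /Rintegral fineK//.
by apply: integrable_fin_num => //; apply: (bm_integrable P (bm_slice1 y bf)).
Qed.

Lemma E_prod (f : X * Y -> R) : bm f ->
  \int[(P \x Q)%E]_z f z = \int[P]_x \int[Q]_y f (x, y).
Proof.
move=> bf; rewrite [LHS]/Rintegral.
have := integral12_prod_meas1 (bm_integrable (P \x Q)%E bf).
move=> /= <-; congr fine.
by apply: eq_integral => x _; rewrite EFin_E.
Qed.

Lemma E_swap (f : X * Y -> R) : bm f ->
  \int[P]_x \int[Q]_y f (x, y) = \int[Q]_y \int[P]_x f (x, y).
Proof.
move=> bf; rewrite -E_prod// [LHS]/Rintegral.
have := integral21_prod_meas1 (bm_integrable (P \x Q)%E bf).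
move=> /= <-; congr fine.
by apply: eq_integral => x _; rewrite EFin_E1.
Qed.

End Fubini.

(** * Poincare and Ladyzhenskaya inequalities in three variables *)

Section OneVariable.
Context d (T : measurableType d) (R : realType) (P : probability T R).
Implicit Types (v w : T -> R).

(** What the fundamental theorem of calculus yields for [v] and for its square when [w] is the
    derivative of [v]; integrating over the whole line makes the bounds uniform in both points. The
    first clause leads to Poincare's inequality, the second to Ladyzhenskaya's. *)
Definition variation_bound v w := forall x x',
  `|v x - v x'| <= \int[P]_r `|w r| /\
  v x ^+ 2 <= v x' ^+ 2 + \int[P]_r (2 * `|v r| * `|w r|).

(** Integrating the hypothesis in both variables gives twice the variance on the left. *)
Lemma E_oscillation v k : bm v -> (forall x x', (v x - v x') ^+ 2 <= k) ->
  \int[P]_x (v x ^+ 2) <= (\int[P]_x v x) ^+ 2 + k.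
Proof.
move=> bv vk; set m := \int[P]_x v x; set Q := \int[P]_x (v x ^+ 2).
have bv2 := bmX 2 bv.
have h y : Q - 2 * v y * m + v y ^+ 2 <= k.
  have : \int[P]_x (v x - v y) ^+ 2 <= \int[P]_x k.
    by apply: E_le => //; [apply/bmX/bmB => //|]; exact: bm_cst.
  rewrite E_cst (E_ext P (g := fun x => v x ^+ 2 - 2 * v y * v x + v y ^+ 2));
    last by move=> x; ring.
  have b2 : bm (fun x => 2 * v y * v x) by apply: bmM => //; exact: bm_cst.
  by rewrite E_D ?E_B ?E_cst ?E_Z//; [exact: bmB|exact: bm_cst].
have : \int[P]_y (Q + 2 * m * (- v y) + v y ^+ 2) <= \int[P]_y k.
  apply: E_le; last by move=> y; have := h y; lra.
  - apply: bmD => //; apply: bmD; first exact: bm_cst.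
    by apply: bmM; [exact: bm_cst|exact: bmN].
  - exact: bm_cst.
have bN : bm (fun y => 2 * m * - v y).
  by apply: bmM; [exact: bm_cst|exact: bmN].
have bQ := @bm_cst _ T R Q.
rewrite E_cst E_D//; last exact: bmD.
rewrite E_D// E_cst E_Z; last exact: bmN.
rewrite (E_ext P (g := fun y => -1 * v y)); last by move=> y; ring.
rewrite E_Z// -/m -/Q; have := sqr_ge0 m => m2 h3.
(* The double integral bounds the variance by [k / 2]; since [k] is nonnegative, [k] is also a
   bound. *)
have : (v point - v point) ^+ 2 <= k by exact: vk.
rewrite subrr expr0n/= => k0; nra.
Qed.

Lemma variation_sqr v w : bm v -> bm w -> variation_bound v w ->
  forall x x', (v x - v x') ^+ 2 <= \int[P]_r (w r ^+ 2).
Proof.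
move=> bv bw vw x x'; have [h _] := vw x x'.
rewrite -real_normK ?num_real//.
have := E_cauchy_schwarz P (bm_norm bw) (@bm_cst _ T R 1).
under eq_Rintegral do rewrite mulr1.
rewrite expr1n E_cst mulr1.
under [X in _ <= X -> _]eq_Rintegral do rewrite real_normK ?num_real//.
apply: le_trans; rewrite lerXn2r// nnegrE//; exact: E_ge0.
Qed.

(** Averages the second clause over the free point [x']: a pointwise bound by a line integral, as in
    Agmon's inequality. *)
Lemma variation_sup v w : bm v -> bm w -> variation_bound v w ->
  forall x, v x ^+ 2 <= \int[P]_r (v r ^+ 2 + 2 * `|v r| * `|w r|).
Proof.
move=> bv bw vw x.
have b2 : bm (fun r => 2 * `|v r| * `|w r|).
  by apply: bmM; [apply: bmM; [exact: bm_cst|exact: bm_norm]|exact: bm_norm].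
have bv2 := bmX 2 bv.
rewrite E_D// -[leLHS](E_cst P).
rewrite -[X in _ <= _ + X](E_cst P) -E_D//; last exact: bm_cst.
apply: E_le; [exact: bm_cst| |by move=> x'; have [_] := vw x x'].
by apply: bmD => //; exact: bm_cst.
Qed.

End OneVariable.

Section TwoVariables.
Context d1 d2 (X : measurableType d1) (Y : measurableType d2) (R : realType).
Variables (P : probability X R) (Q : probability Y R).

(* Tensorisation: the mean over [y] inherits the oscillation bound in [x]. *)
Lemma E_poincare_prod (f : X * Y -> R) (D : X -> R) (k : Y -> R) :
  bm f -> bm D -> bm k ->
  (forall x, \int[Q]_y (f (x, y) ^+ 2) <= (\int[Q]_y f (x, y)) ^+ 2 + D x) ->
  (forall x x' y, (f (x, y) - f (x', y)) ^+ 2 <= k y) ->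
  \int[P]_x \int[Q]_y (f (x, y) ^+ 2) <=
  (\int[P]_x \int[Q]_y f (x, y)) ^+ 2 + \int[P]_x D x + \int[Q]_y k y.
Proof.
move=> bf bD bk hD hk.
have bm' := bm_int2 P Q bf.
apply: (@le_trans _ _ (\int[P]_x ((\int[Q]_y f (x, y)) ^+ 2 + D x))).
  apply: E_le => //; first exact: (bm_int2 P Q (bmX 2 bf)).
  by apply: bmD => //; exact: bmX.
rewrite E_D//; last exact: bmX.
rewrite -addrA [X in _ <= _ + X]addrC addrA lerD2r.
apply: E_oscillation => // x x'.
have bs x1 := bm_slice2 x1 bf.
rewrite -E_B//.
have := E_cauchy_schwarz Q (bmB (bs x) (bs x')) (@bm_cst _ Y R 1).
under eq_Rintegral do rewrite mulr1.
rewrite expr1n E_cst mulr1 => /le_trans; apply.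
by apply: E_le => //; exact/bmX/bmB.
Qed.

End TwoVariables.

Lemma addr_rev4 (V : zmodType) (x a b c : V) : x + (a + b + c) = x + (c + b) + a.
Proof. by rewrite -[RHS]addrA; congr (_ + _); rewrite -addrA addrC [b + c]addrC. Qed.

Lemma agmon_le (R : realType) (a b : R) :
  a ^+ 2 + 2 * a * b <= 2 * a ^+ 2 + b ^+ 2.
Proof. by have := sqr_ge0 (a - b); lra. Qed.

Lemma agmon_sqr_le (R : realType) (a b : R) :
  (a + 2 * b) ^+ 2 <= 2 * a ^+ 2 + 8 * b ^+ 2.
Proof. by have := sqr_ge0 (a - 2 * b); lra. Qed.

Lemma product_le_of_sqr (R : realType) (H a b c s t : R) :
  0 <= H -> 0 <= s -> 0 <= t -> a <= 2 * H ->
  b ^+ 2 <= a * s -> c ^+ 2 <= a * t -> b * c <= H * (s + t).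
Proof.
move=> H0 s0 t0 aH h1 h2; have := sqr_ge0 (b - c) => h3.
have : a * (s + t) <= 2 * H * (s + t) by rewrite ler_wpM2r// addr_ge0.
lra.
Qed.

Section ThreeVariables.
Context d (T : measurableType d) (R : realType) (P : probability T R).
Implicit Types f u : T -> T -> T -> R.

Let PP : probability (T * T)%type R := (P \x P)%E.
Let PPP : probability (T * (T * T))%type R := (P \x PP)%E.

Definition bm3 f := bm (fun p : T * (T * T) => f p.1 p.2.1 p.2.2).

Definition E3 f := \int[P]_x \int[P]_y \int[P]_z f x y z.

Lemma bm3_comp d' (S : measurableType d') f (a b c : S -> T) :
  bm3 f -> measurable_fun setT a -> measurable_fun setT b ->
  measurable_fun setT c -> bm (fun s => f (a s) (b s) (c s)).
Proof.
move=> bf ma mb mc.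
apply: (bm_comp (h := fun s => (a s, (b s, c s))) _ bf).
by apply: measurable_fun_pair => //; exact: measurable_fun_pair.
Qed.

(** The integrated variable survives as a dummy argument, so partial integrals remain functions of
    three variables and can later be sliced at [point]. *)
Lemma bm3_int1 f : bm3 f -> bm3 (fun _ y z => \int[P]_r f r y z).
Proof.
move=> bf; apply: (bm_int2 PPP P (f := fun q : (T * (T * T)) * T =>
  f q.2 q.1.2.1 q.1.2.2)).
by apply: bm3_comp => //; do ?apply: measurableT_comp => //.
Qed.

Lemma bm3_int2 f : bm3 f -> bm3 (fun x _ z => \int[P]_r f x r z).
Proof.
move=> bf; apply: (bm_int2 PPP P (f := fun q : (T * (T * T)) * T =>
  f q.1.1 q.2 q.1.2.2)).
by apply: bm3_comp => //; do ?apply: measurableT_comp => //.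
Qed.

Lemma bm3_int3 f : bm3 f -> bm3 (fun x y _ => \int[P]_r f x y r).
Proof.
move=> bf; apply: (bm_int2 PPP P (f := fun q : (T * (T * T)) * T =>
  f q.1.1 q.1.2.1 q.2)).
by apply: bm3_comp => //; do ?apply: measurableT_comp => //.
Qed.

Lemma bm3_slice f x : bm3 f -> bm (fun p : T * T => f x p.1 p.2).
Proof. by move=> bf; exact: bm3_comp. Qed.

Lemma E3_prod f : bm3 f ->
  E3 f = \int[P]_x \int[PP]_p f x p.1 p.2.
Proof.
move=> bf; apply: E_ext => x.
by rewrite (E_prod P P (bm3_slice x bf)).
Qed.

Lemma E3_prod3 f : bm3 f ->
  E3 f = \int[PPP]_p f p.1 p.2.1 p.2.2.
Proof. by move=> bf; rewrite E3_prod// (E_prod P PP bf). Qed.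

Variables u g1 g2 g3 : T -> T -> T -> R.
Hypotheses (bu : bm3 u) (b1 : bm3 g1) (b2 : bm3 g2) (b3 : bm3 g3).
Hypothesis v1 : forall y z, variation_bound P (fun x => u x y z) (fun x => g1 x y z).
Hypothesis v2 : forall x z, variation_bound P (fun y => u x y z) (fun y => g2 x y z).
Hypothesis v3 : forall x y, variation_bound P (fun z => u x y z) (fun z => g3 x y z).

Let D := E3 (fun x y z => g1 x y z ^+ 2) + E3 (fun x y z => g2 x y z ^+ 2)
  + E3 (fun x y z => g3 x y z ^+ 2).

Let sx f y z : bm3 f -> bm (fun x => f x y z).
Proof. by move=> bf; apply: bm3_comp => //; exact: measurable_cst. Qed.
Let sy f x z : bm3 f -> bm (fun y => f x y z).
Proof. by move=> bf; apply: bm3_comp => //; exact: measurable_cst. Qed.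
Let sz f x y : bm3 f -> bm (fun z => f x y z).
Proof. by move=> bf; apply: bm3_comp => //; exact: measurable_cst. Qed.
Let sxy f x : bm3 f -> bm (fun p : T * T => f x p.1 p.2).
Proof. by move=> bf; apply: bm3_comp. Qed.

Lemma E3_swap1 f : bm3 f -> E3 f =
  \int[PP]_p \int[P]_x f x p.1 p.2.
Proof. by move=> bf; rewrite E3_prod// (E_swap P PP bf). Qed.

(** Two tensorisations: [hz] on the [z] lines is lifted to the [(y, z)] planes by [hyz], and then
    [x] is paired with the plane. The oscillation terms simply add, so the constant stays 1. *)
Lemma poincare3 : E3 (fun x y z => u x y z ^+ 2) <= E3 u ^+ 2 + D.
Proof.
have bu2 : bm3 (fun x y z => u x y z ^+ 2) by exact: bmX.
have b12 : bm3 (fun x y z => g1 x y z ^+ 2) by exact: bmX.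
have b22 : bm3 (fun x y z => g2 x y z ^+ 2) by exact: bmX.
have b32 : bm3 (fun x y z => g3 x y z ^+ 2) by exact: bmX.
have hz x y : \int[P]_z (u x y z ^+ 2) <=
    (\int[P]_z u x y z) ^+ 2 + \int[P]_z (g3 x y z ^+ 2).
  by apply: E_oscillation; [exact: sz|apply: variation_sqr => //; exact: sz].
have hyz x := @E_poincare_prod _ _ T T R P P (fun p => u x p.1 p.2)
  (fun y => \int[P]_z (g3 x y z ^+ 2)) (fun z => \int[P]_y (g2 x y z ^+ 2))
  (sxy x bu) (bm_int2 P P (sxy x b32)) (sz x point (bm3_int2 b22)) (hz x).
have hpp x : \int[PP]_p (u x p.1 p.2 ^+ 2) <= (\int[PP]_p u x p.1 p.2) ^+ 2
    + (\int[PP]_p (g3 x p.1 p.2 ^+ 2) + \int[PP]_p (g2 x p.1 p.2 ^+ 2)).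
  rewrite (E_prod P P (sxy x bu2)) (E_prod P P (sxy x bu)).
  rewrite (E_prod P P (sxy x b32)) (E_prod P P (sxy x b22)).
  rewrite (E_swap P P (sxy x b22)) addrA; apply: hyz => y y' z.
  exact: (variation_sqr (sy x z bu) (sy x z b2) (v2 x z)).
have bx f : bm3 f -> bm (fun x => \int[PP]_p (f x p.1 p.2)).
  by move=> bf; exact: (@bm_int2 _ _ T (T * T)%type R P PP (fun q => f q.1 q.2.1 q.2.2)).
have := @E_poincare_prod _ _ T (T * T)%type R P PP (fun p => u p.1 p.2.1 p.2.2)
  (fun x => \int[PP]_p (g3 x p.1 p.2 ^+ 2) + \int[PP]_p (g2 x p.1 p.2 ^+ 2))
  (fun p => \int[P]_x (g1 x p.1 p.2 ^+ 2)).
rewrite (E_D P (bx _ b32) (bx _ b22)).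
rewrite E3_prod// E3_prod// /D E3_swap1// !E3_prod// => h.
rewrite addr_rev4; apply: h => //.
- by apply: bmD; [exact: (bx _ b32)|exact: (bx _ b22)].
- exact: (bm3_slice point (bm3_int1 b12)).
- move=> x x' p.
  exact: (variation_sqr (sx p.1 p.2 bu) (sx p.1 p.2 b1) (v1 p.1 p.2)).
Qed.

Let H := E3 (fun x y z => u x y z ^+ 2) + D.

(** By [variation_sup], the integral of this function over a line dominates [f ^ 2] at each point of
    the line when [g] is the derivative of [f] along it. *)
Let agmon (f g : T -> T -> T -> R) x y z :=
  f x y z ^+ 2 + 2 * `|f x y z| * `|g x y z|.

Let bagmon f g : bm3 f -> bm3 g -> bm3 (agmon f g).
Proof.
move=> bf bg; apply: bmD; first exact: bmX.
apply: bmM; last exact: bm_norm.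
by apply: bmM; [exact: bm_cst|exact: bm_norm].
Qed.

(* Slicing at fixed [x]: on the [(y, z)] section, [u^4] is dominated by a product
   of a function of [z] and a function of [y], whose integrals are bounded by
   Cauchy-Schwarz, while the section norm of [u] is bounded uniformly in [x]. *)
Lemma ladyzhenskaya3 : E3 (fun x y z => u x y z ^+ 4) <= 8 * H ^+ 2.
Proof.
have bu2 : bm3 (fun x y z => u x y z ^+ 2) by exact: bmX.
have bu4 : bm3 (fun x y z => u x y z ^+ 4) by exact: bmX.
have b12 : bm3 (fun x y z => g1 x y z ^+ 2) by exact: bmX.
have b22 : bm3 (fun x y z => g2 x y z ^+ 2) by exact: bmX.
have b32 : bm3 (fun x y z => g3 x y z ^+ 2) by exact: bmX.
have bx f : bm3 f -> bm (fun x => \int[PP]_p (f x p.1 p.2)).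
  by move=> bf; exact: (@bm_int2 _ _ T (T * T)%type R P PP (fun q => f q.1 q.2.1 q.2.2)).
have E3_ge0 f : (forall x y z, 0 <= f x y z) -> 0 <= E3 f.
  by move=> f0; do 3 apply: E_ge0 => ?.
have D1_ge0 : 0 <= E3 (fun x y z => g1 x y z ^+ 2).
  by apply: E3_ge0 => *; exact: sqr_ge0.
have D2_ge0 : 0 <= E3 (fun x y z => g2 x y z ^+ 2).
  by apply: E3_ge0 => *; exact: sqr_ge0.
have D3_ge0 : 0 <= E3 (fun x y z => g3 x y z ^+ 2).
  by apply: E3_ge0 => *; exact: sqr_ge0.
have Q_ge0 : 0 <= E3 (fun x y z => u x y z ^+ 2).
  by apply: E3_ge0 => *; exact: sqr_ge0.
pose U x := \int[PP]_p (u x p.1 p.2 ^+ 2).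
have bU : bm U by exact: (bx _ bu2).
have U_ge0 x : 0 <= U x by apply: E_ge0 => p; exact: sqr_ge0.
(* The sections are bounded uniformly in [x] by applying [variation_sup] along the [x] lines and
   then integrating over the section. *)
have U_le x : U x <= 2 * H.
  apply: (@le_trans _ _ (\int[PP]_p \int[P]_r agmon u g1 r p.1 p.2)).
    apply: E_le; first exact: (sxy x bu2).
      exact: (bm3_slice point (bm3_int1 (bagmon bu b1))).
    move=> p.
    exact: (variation_sup (sx p.1 p.2 bu) (sx p.1 p.2 b1) (v1 p.1 p.2)).
  rewrite -E3_swap1; last exact: bagmon.
  apply: (@le_trans _ _ (E3 (fun x y z => 2 * u x y z ^+ 2 + g1 x y z ^+ 2))).
    rewrite !E3_prod3; last exact: bagmon.
      apply: E_le; first exact: bagmon.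
        by apply: bmD => //; apply: bmM => //; exact: bm_cst.
      move=> p; rewrite /agmon.
      rewrite -(real_normK (num_real (u p.1 p.2.1 p.2.2))).
      rewrite -(real_normK (num_real (g1 p.1 p.2.1 p.2.2))).
      exact: agmon_le.
    by apply: bmD => //; apply: bmM => //; exact: bm_cst.
  rewrite !E3_prod3; last by apply: bmD => //; apply: bmM => //; exact: bm_cst.
  rewrite E_D//; last by apply: bmM => //; exact: bm_cst.
  rewrite E_Z// -(E3_prod3 bu2) -(E3_prod3 b12).
  rewrite /H /D mulrDr lerD2l; move: D1_ge0 D2_ge0 D3_ge0.
  move: (E3 (fun x y z => g1 x y z ^+ 2)) (E3 (fun x y z => g2 x y z ^+ 2)).
  by move: (E3 (fun x y z => g3 x y z ^+ 2)) => a b c *; lra.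
(* [agmon u g] factors as the product of the absolute value of [u] with a sum whose square is at
   most [2 * u ^ 2 + 8 * g ^ 2] by [agmon_sqr_le]; [S] integrates this bound over the section. *)
pose S g x := 2 * U x + 8 * \int[PP]_p (g x p.1 p.2 ^+ 2).
have bS g : bm3 g -> bm (S g).
  move=> bg; have bg2 : bm3 (fun x y z => g x y z ^+ 2) by exact: bmX.
  have c2 := @bm_cst _ T R 2; have c8 := @bm_cst _ T R 8.
  exact: (bmD (bmM c2 bU) (bmM c8 (bx _ bg2))).
have cs g x : bm3 g -> (\int[PP]_p agmon u g x p.1 p.2) ^+ 2 <= U x * S g x.
  move=> bg.
  have bu' := sxy x bu; have bg' := sxy x bg.
  have bs : bm (fun p : T * T => `|u x p.1 p.2| + 2 * `|g x p.1 p.2|).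
    apply: bmD; first exact: bm_norm.
    by apply: bmM; [exact: bm_cst|exact: bm_norm].
  have := E_cauchy_schwarz PP (bm_norm bu') bs.
  rewrite (E_ext PP (g := fun p => agmon u g x p.1 p.2)); last first.
    by move=> p; rewrite /agmon -(real_normK (num_real (u x p.1 p.2))); ring.
  move=> /le_trans; apply.
  rewrite (E_ext PP (g := fun p => u x p.1 p.2 ^+ 2)); last first.
    by move=> p; rewrite real_normK ?num_real.
  apply: ler_wpM2l; first exact: U_ge0.
  have b2g : bm (fun p : T * T => 8 * g x p.1 p.2 ^+ 2).
    by apply: bmM; [exact: bm_cst|exact: bmX].
  have b2u : bm (fun p : T * T => 2 * u x p.1 p.2 ^+ 2).
    by apply: bmM; [exact: bm_cst|exact: bmX].
  apply: (@le_trans _ _ (\int[PP]_p (2 * u x p.1 p.2 ^+ 2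
      + 8 * g x p.1 p.2 ^+ 2))).
    apply: E_le; [exact: bmX|exact: bmD|] => p.
    rewrite -(real_normK (num_real (u x p.1 p.2))).
    rewrite -(real_normK (num_real (g x p.1 p.2))).
    exact: agmon_sqr_le.
  rewrite E_D// E_Z; last exact: bmX.
  by rewrite E_Z//; exact: bmX.
have S_ge0 g x : 0 <= S g x.
  by rewrite addr_ge0// mulr_ge0//; apply: E_ge0 => p; exact: sqr_ge0.
have H_ge0 : 0 <= H by rewrite /H /D !addr_ge0.
have slice x : \int[PP]_p (u x p.1 p.2 ^+ 4) <= H * (S g2 x + S g3 x).
  pose A z := \int[P]_y agmon u g2 x y z.
  pose B y := \int[P]_z agmon u g3 x y z.
  have bA : bm A by exact: (sz x point (bm3_int2 (bagmon bu b2))).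
  have bB : bm B by exact: (sy x point (bm3_int3 (bagmon bu b3))).
  have hA y z : u x y z ^+ 2 <= A z.
    exact: (variation_sup (sy x z bu) (sy x z b2) (v2 x z)).
  have hB y z : u x y z ^+ 2 <= B y.
    exact: (variation_sup (sz x y bu) (sz x y b3) (v3 x y)).
  have bAB : bm (fun p : T * T => B p.1 * A p.2).
    by apply: bmM; [exact: (bm_comp (h := fst))|exact: (bm_comp (h := snd))].
  apply: (@le_trans _ _ (\int[PP]_p (B p.1 * A p.2))).
    apply: E_le => //; first exact: (sxy x bu4).
    move=> p; rewrite (exprM _ 2 2) expr2 ler_pM ?sqr_ge0//.
  rewrite (E_prod P P bAB) /=.
  under eq_Rintegral do rewrite E_Z//.
  under eq_Rintegral do rewrite mulrC.
  rewrite E_Z//.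
  have eA : \int[P]_y A y = \int[PP]_p agmon u g2 x p.1 p.2.
    have b := sxy x (bagmon bu b2).
    by rewrite (E_prod P P b) (E_swap P P b).
  have eB : \int[P]_y B y = \int[PP]_p agmon u g3 x p.1 p.2.
    by rewrite (E_prod P P (sxy x (bagmon bu b3))).
  apply: (product_le_of_sqr H_ge0 (S_ge0 g2 x) (S_ge0 g3 x) (U_le x)).
    by rewrite eA; exact: cs.
  by rewrite eB; exact: cs.
rewrite E3_prod//.
apply: (@le_trans _ _ (\int[P]_x (H * (S g2 x + S g3 x)))).
  apply: E_le => //; first exact: (bx _ bu4).
  by apply: bmM; [exact: bm_cst|apply: bmD; exact: bS].
rewrite E_Z; last by apply: bmD; exact: bS.
have ES g : bm3 g -> \int[P]_x S g x = 2 * E3 (fun x y z => u x y z ^+ 2) +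
    8 * E3 (fun x y z => g x y z ^+ 2).
  move=> bg; have bg2 : bm3 (fun x y z => g x y z ^+ 2) by exact: bmX.
  rewrite E_D; [|by apply: bmM => //; exact: bm_cst|]; last first.
    by apply: bmM; [exact: bm_cst|exact: (bx _ bg2)].
  by rewrite E_Z// E_Z ?E3_prod//; exact: (bx _ bg2).
rewrite E_D; [|exact: bS|exact: bS].
rewrite !ES// expr2 [leRHS]mulrCA; apply: ler_wpM2l => //.
(* The origin of the constant 8: the integral of [S g2 + S g3] is four times that of [u ^ 2] plus
   eight times those of [g2 ^ 2] and [g3 ^ 2]. *)
rewrite /H /D; move: D1_ge0 D2_ge0 D3_ge0 Q_ge0.
move: (E3 (fun x y z => g1 x y z ^+ 2)) (E3 (fun x y z => g2 x y z ^+ 2)).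
move: (E3 (fun x y z => g3 x y z ^+ 2)) (E3 (fun x y z => u x y z ^+ 2)).
by move=> a b c e *; lra.
Qed.

End ThreeVariables.

(** * Integrals over the cube *)

Section MatrixNorm.
Variables (R : realType) (m n : nat).

Lemma mx_norm_coord (A : 'M[R]_(m, n)) i j : `|A i j| <= `|A|.
Proof. by rewrite [leRHS]mx_normrE (le_bigmax _ (fun ij => `|A ij.1 ij.2|) (i, j)). Qed.

Lemma mx_norm_le (A : 'M[R]_(m, n)) e :
  0 <= e -> (forall i j, `|A i j| <= e) -> `|A| <= e.
Proof. by move=> e0 Ae; rewrite [leLHS]mx_normrE; apply: bigmax_le. Qed.

End MatrixNorm.

Section Cube.
Variable R : realType.
Local Notation RT := (measurableTypeR R).

Definition of_tuple d (t : d.-tuple RT) : 'cV[R]_d := \col_i tnth t i.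

(* [f] is the pointwise limit of its values at points rounded down to
   [(n + 1)^-1 * Z^d], which are countably many. *)
Lemma continuous_of_tuple_measurable d (f : 'cV[R]_d -> R) : continuous f ->
  measurable_fun setT (fun t : d.-tuple RT => f (of_tuple t)).
Proof.
move=> cf.
pose fl k (t : d.-tuple RT) : 'cV[int]_d :=
  \col_i Num.floor (k.+1%:R * (tnth t i : R)).
pose step k (c : 'cV[int]_d) : 'cV[R]_d := k.+1%:R^-1 *: map_mx intr c.
apply: (@measurable_fun_cvg _ _ _ setT (fun k t => f (step k (fl k t)))).
- move=> k _ B mB; rewrite setTI.
  rewrite (_ : _ @^-1` B = \bigcup_(c : 'cV[int]_d)
      (if `[< B (f (step k c)) >] then [set t | fl k t = c] else set0)); last first.
    apply/seteqP; split => [t /= Bt|t [c _]].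
      by exists (fl k t) => //=; case: asboolP.
    by case: asboolP => //= Bc ->.
  apply: countable_bigcupT_measurable => [|c]; first exact: countableP.
  case: ifP => _ //.
  rewrite (_ : [set t | _] = \bigcap_(i : 'I_d)
      [set t | Num.floor (k.+1%:R * (tnth t i : R)) = c i 0]); last first.
    apply/seteqP; split => [t /= <- i _|t /= tc]; first by rewrite /= mxE.
    by apply/matrixP => i j; rewrite (ord1 j) mxE; exact: tc.
  apply: fin_bigcap_measurable => // i _.
  have mi : measurable_fun setT (fun t : d.-tuple RT => k.+1%:R * (tnth t i : R)).
    by apply: measurable_funM; [exact: measurable_cst|exact: measurable_tnth].
  rewrite (_ : [set t | _] = setT `&` (fun t : d.-tuple RT =>
    k.+1%:R * (tnth t i : R)) @^-1` `[(c i 0)%:~R, (c i 0 + 1)%:~R[%classic).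
    by apply: mi => //; exact: measurable_itv.
  rewrite setTI; apply/seteqP; split => t /=; rewrite in_itv/=.
    by move=> /eqP; rewrite floor_eq.
  by move=> h; apply/eqP; rewrite floor_eq.
- move=> t _; apply: (@continuous_cvg _ _ _ \oo _ (fun k => step k (fl k t)) f).
    exact: cf.
  apply/cvgrPdist_le => e e0; near=> k.
  apply: mx_norm_le => [|i j]; first exact: ltW.
  rewrite !mxE.
  have k0 : (0 : R) < k.+1%:R by [].
  have /andP[h1 h2] := floor_itv (k.+1%:R * (tnth t i : R)).
  set z := Num.floor _ in h1 h2 *.
  have -> : tnth t i - k.+1%:R^-1 * z%:~R = k.+1%:R^-1 * (k.+1%:R * tnth t i - z%:~R).
    by rewrite mulrBr mulKf// gt_eqF.
  rewrite ger0_norm; last by rewrite mulr_ge0 ?invr_ge0// subr_ge0.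
  apply: (@le_trans _ _ k.+1%:R^-1).
    rewrite ler_piMr ?invr_ge0//.
    by move: h2; rewrite intrD => h2; rewrite lerBlDl ltW.
  rewrite invf_ple ?posrE//.
  near: k; exists (Num.truncn e^-1).+1 => // n /= hn.
  rewrite (le_trans (ltW (truncnS_gt _)))// ler_nat; exact: leqW.
Unshelve. all: by end_near. Qed.

(* A function of [d <= 3] variables is read as one of three variables that does not
   depend on the superfluous ones. *)
Definition pad d (x y z : RT) : 'cV[R]_d := \col_i nth 0 [:: x; y; z] i.

Lemma bm_pad d (f : 'cV[R]_d -> R) : (d <= 3)%N ->
  bm (fun t : d.-tuple RT => f (of_tuple t)) -> bm3 (fun x y z => f (pad d x y z)).
Proof.
move=> d3 bf.
pose h (p : RT * (RT * RT)) : d.-tuple RT :=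
  [tuple nth 0 [:: p.1; p.2.1; p.2.2] i | i < d].
rewrite (_ : (fun x y z => f (pad d x y z)) =
    fun x y z => f (of_tuple (h (x, (y, z))))); last first.
  apply/funext => x; apply/funext => y; apply/funext => z; congr f.
  by apply/matrixP => i j; rewrite !mxE tnth_mktuple.
rewrite /bm3 (_ : (fun p => _) = (fun t => f (of_tuple t)) \o h); last first.
  by apply/funext => -[x [y z]].
apply: bm_comp => //; apply/measurable_fun_tnthP => i.
rewrite (_ : _ \o _ = fun p : RT * (RT * RT) =>
    nth 0 [:: p.1; p.2.1; p.2.2] i); last first.
  by apply/funext => p /=; rewrite tnth_mktuple.
case: i => -[|[|[|i]]] hi /=.
- exact: measurable_fst.
- by apply: measurableT_comp => //; exact: measurable_fst.
- by apply: measurableT_comp => //; exact: measurable_snd.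
- by have := leq_trans hi d3.
Qed.

Local Notation U := (uniform_prob (@ltr01 R)).

Lemma E_cubeS n (g : n.+1.-tuple RT -> R) : bm g ->
  \int[cube_measure R n.+1]_t g t =
  \int[U]_x \int[cube_measure R n]_t g (consT (x, t)).
Proof.
move=> bg; have bgc : bm (g \o @consT R n).
  by apply: bm_comp => //; exact: measurable_consT.
rewrite -(E_prod U (cube_measure R n) (f := g \o @consT R n))//.
rewrite /Rintegral /=; congr fine.
rewrite integral_distribution//=.
  by apply/measurable_EFinP; have [] := bg.
exact: (bm_integrable (U \x cube_measure R n)%E bgc).
Qed.

Lemma E_cube0 (g : 0.-tuple RT -> R) : bm g ->
  \int[cube_measure R 0]_t g t = g [tuple].
Proof.
move=> [mg _]; rewrite /Rintegral /= integral_dirac//; last exact/measurable_EFinP.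
by rewrite diracE mem_set// mul1e.
Qed.

Lemma bm_consT n (g : n.+1.-tuple RT -> R) x : bm g ->
  bm (fun t => g (consT (x, t))).
Proof.
move=> bg; apply: (bm_slice2 x (f := g \o @consT R n)).
by apply: bm_comp => //; exact: measurable_consT.
Qed.

Lemma intT_pad d (f : 'cV[R]_d -> R) : (1 <= d <= 3)%N ->
  bm (fun t : d.-tuple RT => f (of_tuple t)) ->
  intT f = E3 U (fun x y z => f (pad d x y z)).
Proof.
move=> hd bf; rewrite /intT /E3.
case: d hd f bf => [|[|[|[|d]]]]// _ f bf; (rewrite E_cubeS//; apply: E_ext => x).
- rewrite E_cube0; last exact: (bm_consT x bf).
  rewrite -[LHS](E_cst U); apply: E_ext => y; rewrite -[LHS](E_cst U).
  apply: E_ext => z; congr f; apply/matrixP => i j; rewrite !mxE (ord1 i).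
  by rewrite (tnth_nth 0).
- have b1 := bm_consT x bf; rewrite (E_cubeS b1); apply: E_ext => y.
  rewrite E_cube0; last exact: (bm_consT y b1).
  rewrite -[LHS](E_cst U); apply: E_ext => z; congr f.
  by apply/matrixP => i j; rewrite !mxE (tnth_nth 0); case: i => -[|[]].
- have b1 := bm_consT x bf; rewrite (E_cubeS b1); apply: E_ext => y.
  have b2 := bm_consT y b1; rewrite (E_cubeS b2); apply: E_ext => z.
  rewrite E_cube0; last exact: (bm_consT z b2).
  congr f.
  by apply/matrixP => i j; rewrite !mxE (tnth_nth 0); case: i => -[|[|[]]].
Qed.

End Cube.

(** * Finite element functions along lines *)

Section Dot.
Variables (R : realType) (d : nat).
Implicit Types (u v w : 'cV[R]_d).

Lemma dotDr u v w : dot u (v + w) = dot u v + dot u w.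
Proof. by rewrite /dot mulmxDr mxE. Qed.

Lemma dotZr u (a : R) v : dot u (a *: v) = a * dot u v.
Proof. by rewrite /dot -scalemxAr mxE. Qed.

Lemma dot_sumr u (I : Type) (r : seq I) (p : pred I) (F : I -> 'cV[R]_d) :
  dot u (\sum_(i <- r | p i) F i) = \sum_(i <- r | p i) dot u (F i).
Proof. by rewrite /dot mulmx_sumr summxE. Qed.

Lemma dotE u v : dot u v = \sum_i u i 0 * v i 0.
Proof. by rewrite /dot mxE; apply: eq_bigr => i _; rewrite mxE. Qed.

End Dot.

Lemma pigeonhole_infinite (F : finType) (f : nat -> F) :
  exists c, forall N, exists2 n, (N <= n)%N & f n = c.
Proof.
apply: contrapT => /forallNP h.
have {}h c : exists N, forall n, (N <= n)%N -> f n <> c.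
  have /existsNP[N hN] := h c; exists N => n Nn fn; apply: hN; exists n => //.
have [N hN] := choice h.
apply: (hN (f (\max_c N c)) (\max_c N c)) => //.
exact: leq_bigmax.
Qed.

Section VhFunctions.
Variables (R : realType) (d : nat) (K : periodic_mesh R d).
Implicit Types (v : 'cV[R]_d -> R) (x y e : 'cV[R]_d).

(** Affinity on the cells and periodicity reduce every pointwise bound on [v] to finitely many
    vertex values. *)
Lemma Vh_vertex_average v : Vh K v -> forall x, exists i w,
  barycentric w /\ v x = \sum_a w a * v (@vtx _ _ K i a).
Proof.
move=> [_ pv av] x; have [i [k [w [bw _ xE]]]] := mesh_cover K x.
exists i, w; split => //.
have [g [c gc]] := av i.
have vtx_cell a : cell i (vtx i a).
  exists (fun b => (b == a)%:R); split; last first.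
  - rewrite (bigD1 a)//= eqxx scale1r big1 ?addr0// => b /negbTE ->.
    by rewrite scale0r.
  - by move=> b; case.
  - split; first by move=> b; exact: ler0n.
    by rewrite (bigD1 a)//= eqxx big1 ?addr0// => b /negbTE ->.
rewrite -(subrK (lattice R k) x) pv gc; last by exists w; split=> // a; case.
under [RHS]eq_bigr do rewrite gc// mulrDr.
rewrite big_split/= -mulr_suml bw.2 mul1r xE dot_sumr; congr (_ + _).
by apply: eq_bigr => a _; rewrite dotZr.
Qed.

Lemma Vh_bounded v : Vh K v -> exists M, forall x, `|v x| <= M.
Proof.
move=> Kv; exists (\sum_i \sum_a `|v (@vtx _ _ K i a)|) => x.
have [i [w [[w0 w1] ->]]] := Vh_vertex_average Kv x.
rewrite (le_trans (ler_norm_sum _ _ _))//.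
rewrite (bigD1 i)//= -[leLHS]addr0 lerD//; last first.
  by apply: sumr_ge0 => j _; exact: sumr_ge0.
apply: ler_sum => a _; rewrite normrM ger0_norm// ler_piMl//.
by rewrite -w1 (bigD1 a)//= lerDl sumr_ge0.
Qed.

(** Uniform positivity is what keeps logarithms and negative powers of the temperature bounded. The
    default value 1 of the minimum is itself positive. *)
Lemma Vh_lower_bound v : Vh K v -> (forall x, 0 < v x) ->
  exists2 m, 0 < m & forall x, m <= v x.
Proof.
move=> Kv v0.
pose m := \big[Num.min/1]_i \big[Num.min/1]_a v (@vtx _ _ K i a).
exists m.
  by apply: lt_bigmin => // i _; apply: lt_bigmin.
move=> x; have [i [w [[w0 w1] ->]]] := Vh_vertex_average Kv x.
rewrite -[m]mul1r -w1 mulr_suml; apply: ler_sum => a _.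
rewrite ler_wpM2l//.
by apply: (@bigmin_inf _ _ _ _ i) => //; apply: (@bigmin_inf _ _ _ _ a).
Qed.

Lemma cell_convex (i : 'I_(ncells K)) x y (t : R) : 0 <= t <= 1 ->
  cell i x -> cell i y -> cell i (t *: x + (1 - t) *: y).
Proof.
move=> /andP[t0 t1] [w [[w0 w1] _ ->]] [w' [[w0' w1'] _ ->]].
exists (fun a => t * w a + (1 - t) * w' a); split; [|by move=> a; case|].
  split=> [a|]; first by rewrite addr_ge0// mulr_ge0// subr_ge0.
  by rewrite big_split/= -!mulr_sumr w1 w1' !mulr1 addrC subrK.
rewrite !scaler_sumr -big_split; apply: eq_bigr => a _.
by rewrite [RHS]scalerDl -!scalerA.
Qed.

Lemma cell_norm : exists B : nat, forall i x, @cell _ _ K i x -> `|x| <= B%:R.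
Proof.
pose s : R := \sum_i \sum_a `|@vtx _ _ K i a|.
exists (Num.truncn s).+1 => i x [w [[w0 w1] _ ->]].
rewrite (le_trans _ (ltW (truncnS_gt _)))//.
rewrite (le_trans (ler_norm_sum _ _ _))// /s.
rewrite (bigD1 i)//= -[leLHS]addr0 lerD//; last first.
  by apply: sumr_ge0 => j _; exact: sumr_ge0.
apply: ler_sum => a _; rewrite normrZ ger0_norm// ler_piMl//.
by rewrite -w1 (bigD1 a)//= lerDl sumr_ge0.
Qed.

(* Infinitely many of the points [y + e / (n + 1)] lie in one translated cell,
   hence by convexity so does an initial piece of the open ray. *)
Lemma ray_initial_cell y e : exists i k, exists2 eps : R, 0 < eps &
  forall s, 0 < s <= eps -> @cell _ _ K i (y + s *: e - lattice R k).
Proof.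
have [B hB] := cell_norm.
pose p n := y + n.+1%:R^-1 *: e.
have cov n : exists ik : 'I_(ncells K) * 'cV[int]_d,
    cell ik.1 (p n - lattice R ik.2).
  by have [i [k ik]] := mesh_cover K (p n); exists (i, k).
have [f hf] := choice cov.
pose C := (Num.truncn (`|y| + `|e|)).+1.
have fk n j : `|(f n).2 j 0| <= (B + C)%:Z.
  rewrite -(ler_int R) intr_norm.
  have -> : ((f n).2 j 0)%:~R = lattice R (f n).2 j 0 by rewrite mxE.
  rewrite (le_trans (mx_norm_coord _ _ _))//.
  rewrite -(subKr (p n) (lattice R _)) (le_trans (ler_normB _ _))//.
  rewrite -pmulrn natrD addrC lerD//; first exact: hB.
  rewrite (le_trans (ler_normD _ _))// (le_trans _ (ltW (truncnS_gt _)))//.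
  by rewrite lerD2l normrZ ler_piMl// ger0_norm ?invr_ge0// invf_le1// ler1n.
(* The translations that occur have coordinates of absolute value at most [B + C]. Shifting them
   into an initial segment of the naturals gives a code in a finite type, which by [codeE]
   determines the translated cell. *)
pose code n : 'I_(ncells K) * 'cV['I_(2 * (B + C)).+1]_d :=
  ((f n).1, \col_j inord (absz ((f n).2 j 0 + (B + C)%:Z))).
have [[i0 k0] hc] := pigeonhole_infinite code.
have codeE n m : code n = code m -> f n = f m.
  move=> [e1 /matrixP e2]; rewrite [f n]surjective_pairing [f m]surjective_pairing e1.
  congr (_, _); apply/matrixP => j l; rewrite (ord1 l).
  have := e2 j 0; rewrite !mxE => /(congr1 val) /=.
  have nn q : 0 <= (f q).2 j 0 + (B + C)%:Z <= (2 * (B + C))%:Z.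
    have := fk q j; rewrite ler_norml => /andP[h1 h2].
    by rewrite PoszM; move: (Posz (B + C)) h1 h2 => b h1 h2; apply/andP; split; lra.
  have lt q : (absz ((f q).2 j 0%R + (B + C)%:Z)%R < (2 * (B + C)).+1)%N.
    have /andP[h1 h2] := nn q.
    by rewrite ltnS -lez_nat gez0_abs.
  rewrite !inordK// => /(congr1 Posz).
  have /andP[h1 _] := nn n; have /andP[h2 _] := nn m.
  by rewrite !gez0_abs// => /addIr.
have [n0 _ hn0] := hc 0.
exists (f n0).1, (f n0).2, n0.+1%:R^-1; first by rewrite invr_gt0.
move=> s /andP[s0 s1].
(* An index with the same code and with [n.+1%:R^-1 < s]: now [s] lies between two parameters whose
   points belong to one convex cell. *)
have [n nN hn] := hc (Num.truncn s^-1).+1.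
have fn : f n = f n0 by apply: codeE; rewrite hn hn0.
have ns : n.+1%:R^-1 < s.
  rewrite invf_plt ?posrE// (lt_le_trans (truncnS_gt _))// ler_nat.
  exact: leqW.
have c1 := hf n0; have c2 := hf n; rewrite fn in c2.
pose a := n0.+1%:R^-1 : R; pose b := n.+1%:R^-1 : R.
have ab : 0 < a - b by rewrite subr_gt0 (lt_le_trans ns).
pose t := (s - b) / (a - b).
have t01 : 0 <= t <= 1.
  apply/andP; split; first by rewrite divr_ge0// ?(ltW ab)// subr_ge0 ltW.
  by rewrite ler_pdivrMr// mul1r lerB.
have := cell_convex t01 c1 c2; congr (cell _ _).
rewrite /p -/a -/b; move: (lattice _ _) => l.
have st : s = t * a + (1 - t) * b.
  by rewrite /t; field; rewrite gt_eqF.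
by rewrite st; apply/matrixP => j m; rewrite !mxE; ring.
Qed.

(** The slope is that of one of finitely many affine pieces, hence the bound [G] common to all base
    points. *)
Lemma Vh_ray v e : Vh K v -> exists2 G, 0 <= G & forall y, exists eps a,
  [/\ 0 < eps, `|a| <= G & forall s, 0 <= s <= eps -> v (y + s *: e) = v y + s * a].
Proof.
move=> [cv pv av].
have av' i : exists gc : 'cV[R]_d * R, forall x, @cell _ _ K i x -> v x = dot gc.1 x + gc.2.
  by have [g [c h]] := av i; exists (g, c).
have [g hg] := choice av'.
exists (\sum_i `|dot (g i).1 e|); first exact: sumr_ge0.
move=> y; have [i [k [eps eps0 hc]]] := ray_initial_cell y e.
exists eps, (dot (g i).1 e); split => //.
  by rewrite (bigD1 i)//= lerDl sumr_ge0.
pose A := dot (g i).1 (y - lattice R k) + (g i).2.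
have pos s : 0 < s <= eps -> v (y + s *: e) = A + s * dot (g i).1 e.
  move=> hs; rewrite -(subrK (lattice R k) (y + s *: e)) pv (hg i); last exact: hc.
  by rewrite [y + _ - _]addrAC dotDr dotZr addrAC.
(* The cell is known to contain only the ray without its origin; the value at [y] follows from
   continuity, by comparing two limits from the right. *)
suff vA : v y = A.
  move=> s /andP[]; rewrite le_eqVlt => /predU1P[<- _|s0 s1].
    by rewrite scale0r addr0 mul0r addr0.
  by rewrite vA pos// s0.
have cl : (fun s => v (y + s *: e)) @ (0 : R)^'+ --> v y.
  apply: cvg_at_right_filter.
  rewrite -[in v y](addr0 y) -[in v (y + 0)](scale0r e).
  apply: (@continuous_comp _ _ _ (fun s : R => y + s *: e) v); last exact: cv.
  by apply: cvgD; [exact: cvg_cst|apply: cvgZl; exact: cvg_id].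
have cr : (fun s => v (y + s *: e)) @ (0 : R)^'+ --> A.
  have : (fun s => A + s * dot (g i).1 e) @ (0 : R)^'+ --> A.
    apply: cvg_at_right_filter; rewrite -[X in _ --> X]addr0.
    apply: cvgD; first exact: cvg_cst.
    rewrite -[X in _ --> X](mul0r (dot (g i).1 e)).
    by apply: cvgM; [exact: cvg_id|exact: cvg_cst].
  apply: cvg_trans; apply: near_eq_cvg; near=> s; rewrite pos//.
  by apply/andP; split; near: s; [exact: nbhs_right_gt|exact: nbhs_right_le].
exact: (cvg_unique _ cl cr).
Unshelve. all: by end_near. Qed.

End VhFunctions.

Section RaySlopes.
Variables (R : realType) (d : nat).
Implicit Types (v : 'cV[R]_d -> R) (y e : 'cV[R]_d).

Definition affine_on_ray v y e eps a :=
  forall s, 0 <= s <= eps -> v (y + s *: e) = v y + s * a.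

(* [point] is the junk value of the derivative at a kink. *)
Lemma derive_right_left v y e eps a b : 0 < eps ->
  affine_on_ray v y e eps a -> affine_on_ray v y (- e) eps b ->
  'D_e v y = if a == - b then a else point.
Proof.
move=> eps0 hr hl; rewrite /derive.
set DQ := (fun h : R => _).
have DQr h : 0 < h <= eps -> DQ h = a.
  move=> /andP[h0 h1]; rewrite /DQ /= [h *: e + y]addrC hr ?(ltW h0)//.
  by rewrite addrAC subrr add0r /GRing.scale/= mulKf// gt_eqF.
have DQl h : - eps <= h < 0 -> DQ h = - b.
  move=> /andP[h1 h0].
  rewrite /DQ /= [h *: e + y]addrC -[h *: e]opprK -scaleNr -scalerN hl; last first.
    by rewrite oppr_ge0 ltW//= lerNl.
  by rewrite addrAC subrr add0r /GRing.scale/= mulNr mulrN mulKf// lt_eqF.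
have cr : DQ @ 0^'+ --> a.
  apply: cvg_near_cst; near=> h; apply: DQr; apply/andP; split.
    by near: h; exact: nbhs_right_gt.
  by near: h; exact: nbhs_right_le.
have cl : DQ @ 0^'- --> - b.
  apply: cvg_near_cst; near=> h; apply: DQl; apply/andP; split.
    by near: h; apply: nbhs_left_ge; rewrite oppr_lt0.
  by near: h; exact: nbhs_left_lt.
case: eqP => [ab|nab].
  apply: lim_near_cst => //; near=> h.
  have h1 : `|h| <= eps by near: h; exact: dnbhs0_le.
  have h2 : h != 0 by near: h; exact: nbhs_dnbhs_neq.
  have [h0|h0|h0] := ltgtP h 0; last by rewrite h0 eqxx in h2.
    by rewrite DQl// h0 andbT; move: h1; rewrite ler_norml => /andP[].
  by rewrite DQr// h0; move: h1; rewrite ler_norml => /andP[].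
(* A limit would agree with both one-sided slopes, which differ here; so none exists and [lim]
   returns its default. *)
apply: getPN => l cDQ.
have e1 := cvg_unique _ cr (cvg_dnbhs_at_right cDQ).
have e2 := cvg_unique _ cl (cvg_dnbhs_at_left cDQ).
apply: nab; rewrite e1 ?e2//; exact: Rhausdorff.
Unshelve. all: by end_near. Qed.

(* As a limit of continuous functions the one-sided slope is measurable, and
   [derive_right_left] expresses the derivative through two such slopes. *)
Definition ray_slope v e y : R :=
  limn (fun n => n.+1%:R * (v (y + n.+1%:R^-1 *: e) - v y)).

Lemma ray_slope_cvg v y e eps a : 0 < eps -> affine_on_ray v y e eps a ->
  (fun n => n.+1%:R * (v (y + n.+1%:R^-1 *: e) - v y)) @ \oo --> a.
Proof.
move=> eps0 h; apply: cvg_near_cst.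
exists (Num.truncn eps^-1).+1 => // n /= hn.
rewrite h; last first.
  rewrite invr_ge0 ler0n/= invf_ple ?posrE//.
  by rewrite (le_trans (ltW (truncnS_gt _)))// ler_nat; exact: leqW.
by rewrite addrAC subrr add0r mulVKf.
Qed.

Lemma ray_slopeE v y e eps a : 0 < eps -> affine_on_ray v y e eps a ->
  ray_slope v e y = a.
Proof. by move=> eps0 h; apply: cvg_lim => //; exact: ray_slope_cvg h. Qed.

Variable K : periodic_mesh R d.

Lemma Vh_rays v e : Vh K v -> exists2 G, 0 <= G & forall y, exists eps a b,
  [/\ 0 < eps, `|a| <= G, affine_on_ray v y e eps a & affine_on_ray v y (- e) eps b].
Proof.
move=> Kv; have [G G0 hG] := Vh_ray e Kv; have [G' _ hG'] := Vh_ray (- e) Kv.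
exists G => // y; have [e1 [a [e10 aG h1]]] := hG y.
have [e2 [b [e20 _ h2]]] := hG' y.
exists (Num.min e1 e2), a, b; split => //; first by rewrite lt_min e10.
  by move=> s /andP[s0 s1]; apply: h1; rewrite s0 (le_trans s1)// ge_min lexx.
move=> s /andP[s0 s1]; apply: h2.
by rewrite s0 (le_trans s1)// ge_min lexx orbT.
Qed.

Lemma Vh_deriveE v e y : Vh K v -> 'D_e v y =
  if ray_slope v e y == - ray_slope v (- e) y then ray_slope v e y else point.
Proof.
move=> Kv; have [_ _ /(_ y) [eps [a [b [eps0 _ h1 h2]]]]] := Vh_rays e Kv.
by rewrite (derive_right_left eps0 h1 h2) (ray_slopeE eps0 h1) (ray_slopeE eps0 h2).
Qed.

Lemma Vh_continuous_shift v y : Vh K v -> continuous (fun x : 'cV[R]_d => v (x + y)).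
Proof.
move=> [cv _ _].
have cs : continuous (fun z : 'cV[R]_d => z + y).
  move=> z; apply: continuousD; [exact: cvg_id|]. exact: cst_continuous.
by move=> x; apply: continuous_comp; [exact: cs|exact: cv].
Qed.

Lemma ray_slope_measurable v e : Vh K v ->
  measurable_fun setT (fun t : d.-tuple (measurableTypeR R) =>
    ray_slope v e (of_tuple t)).
Proof.
move=> Kv; have [cv _ _] := Kv.
apply: (@measurable_fun_cvg _ _ _ setT (fun n t =>
  n.+1%:R * (v (of_tuple t + n.+1%:R^-1 *: e) - v (of_tuple t)))).
  move=> n; have c1 := Vh_continuous_shift Kv (y := n.+1%:R^-1 *: e).
  have m1 := continuous_of_tuple_measurable c1.
  have m2 := continuous_of_tuple_measurable cv.
  by apply: measurable_funM; [exact: measurable_cst|exact: measurable_funB m1 m2].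
move=> t _; have [_ _ /(_ (of_tuple t)) [eps [a [b [eps0 _ h1 _]]]]] := Vh_rays e Kv.
by rewrite (ray_slopeE eps0 h1); exact: ray_slope_cvg h1.
Qed.

Lemma Vh_derive_bounded v e : Vh K v -> exists M, forall y, `|'D_e v y| <= M.
Proof.
move=> Kv; have [G G0 hG] := Vh_rays e Kv.
exists (G + `|point : R|) => y; have [eps [a [b [eps0 aG h1 h2]]]] := hG y.
rewrite (derive_right_left eps0 h1 h2); case: ifP => _.
  by rewrite (le_trans aG)// lerDl.
by rewrite lerDr.
Qed.

Lemma Vh_bm v : Vh K v -> bm (fun t => v (of_tuple t)).
Proof.
move=> Kv; have [cv _ _] := Kv; split.
  exact: continuous_of_tuple_measurable.
by have [M hM] := Vh_bounded Kv; exists M => t.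
Qed.

Lemma Vh_derive_bm v e : Vh K v -> bm (fun t => 'D_e v (of_tuple t)).
Proof.
move=> Kv; split; last by have [M hM] := Vh_derive_bounded e Kv; exists M => t.
under eq_fun do rewrite Vh_deriveE//.
apply: measurable_fun_ifT.
- apply: measurable_fun_eqr; first exact: ray_slope_measurable.
  by apply: measurable_funN; exact: ray_slope_measurable.
- exact: ray_slope_measurable.
- exact: measurable_cst.
Qed.

End RaySlopes.

(** Real induction: at the supremum of the endpoints reached from [a], the left estimate gives the
    bound, and the right estimate would pass beyond it if it were less than [b]. No subdivision of
    the segment into affine pieces has to be produced. *)
Lemma variation_local_to_global (R : realType) (F : R -> R) (J : R -> R -> R) :
  (forall a b c, a <= b -> b <= c -> J a b + J b c = J a c) ->
  (forall t, exists2 eps, 0 < eps &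
    forall s, t <= s <= t + eps -> `|F s - F t| <= J t s) ->
  (forall t, exists2 eps, 0 < eps &
    forall s, t - eps <= s <= t -> `|F t - F s| <= J s t) ->
  forall a b, a <= b -> `|F b - F a| <= J a b.
Proof.
move=> JD Jr Jl a b ab.
pose S := [set t | a <= t <= b /\ `|F t - F a| <= J a t].
have Sa : S a.
  split; first by rewrite lexx.
  by have [eps eps0 /(_ a)] := Jr a; apply; rewrite lexx lerDl ltW.
have ubS : ubound S b by move=> t [/andP[]].
have supS : has_sup S by split; [exists a|exists b].
pose c := sup S.
have ubS' : has_ubound S by exists b.
have ac : a <= c by exact: ub_le_sup.
have cb : c <= b by apply: ge_sup => //; exists a.
have Sc : S c.
  split; first by rewrite ac.
  have [eps eps0 h] := Jl c.
  have [t [/andP[t1 t2] ht] tc] := sup_adherent eps0 supS.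
  have tlc : t <= c by apply: ub_le_sup => //; split => //; rewrite t1.
  rewrite -(JD a t c)//.
  have -> : F c - F a = (F t - F a) + (F c - F t) by ring.
  by rewrite (le_trans (ler_normD _ _))// lerD// h// tlc andbT ltW.
have [<-|nbc] := eqVneq c b; first by case: Sc.
have cltb : c < b by rewrite lt_neqAle nbc.
have [eps eps0 h] := Jr c.
pose t := Num.min b (c + eps).
have ct : c < t by rewrite lt_min cltb ltrDl.
have tb : t <= b by rewrite ge_min lexx.
have St : S t.
  split; first by rewrite (le_trans ac (ltW ct)).
  rewrite -(JD a c t)//; last exact: ltW.
  have -> : F t - F a = (F c - F a) + (F t - F c) by ring.
  rewrite (le_trans (ler_normD _ _))// lerD//; first by case: Sc.
  by rewrite h// (ltW ct) ge_min lexx orbT.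
by have := ub_le_sup ubS' St; rewrite leNgt ct.
Qed.

(** * The fundamental theorem of calculus along lines *)

Section LineIntegral.
Variables (R : realType).
Local Notation mu := (@lebesgue_measure R).
Local Notation RT := (measurableTypeR R).

Lemma bm_integrable_itv (w : RT -> R) (a b : R) : bm w ->
  mu.-integrable `[a, b] (EFin \o w).
Proof.
move=> [mw [M wM]]; apply: measurable_bounded_integrable => //.
- rewrite /= lebesgue_measure_itv/=; case: ifP => // _.
  by rewrite -EFinD ltry.
- exact: measurable_funTS.
- exists M; split; first exact: num_real.
  by move=> N MN x _; exact: (le_trans (wM x) (ltW MN)).
Qed.

Lemma Rintegral_itv_chasles (w : RT -> R) (a b c : R) : bm w ->
  a <= b -> b <= c ->
  \int[mu]_(x in `[a, b]) w x + \int[mu]_(x in `[b, c]) w x =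
  \int[mu]_(x in `[a, c]) w x.
Proof.
move=> bw ab bc; apply/eqP; rewrite eq_sym addrC -subr_eq; apply/eqP.
rewrite Rintegral_itvB ?bnd_simp//; last exact: bm_integrable_itv.
rewrite Rintegral_itv_obnd_cbnd//.
by apply: integrableS (bm_integrable_itv b c bw) => //; exact: subset_itv_oc_cc.
Qed.

(** The fundamental theorem of calculus for [Phi] composed with an affine map. The formula for [w]
    is required only inside the segment, as the derivative may take its default value at the ends;
    [oo] discards these null sets. Later [Phi] is ['X] or ['X^2], one for each clause of
    [variation_bound]. *)
Lemma affine_piece_variation (Phi : {poly R}) (w : RT -> R) (a b p al : R) :
  bm w -> a <= b ->
  (forall s, a < s < b -> w s = `|Phi^`().[p + (s - a) * al]| * `|al|) ->
  `|Phi.[p + (b - a) * al] - Phi.[p]| <= \int[mu]_(x in `[a, b]) w x.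
Proof.
move=> bw; rewrite le_eqVlt => /predU1P[->|ab] hw.
  by rewrite subrr mul0r addr0 subrr normr0 set_itv1 Rintegral_set1.
pose G := Phi \Po (al *: ('X - a%:P) + p%:P).
have GE s : G.[s] = Phi.[p + (s - a) * al].
  by rewrite /G horner_comp !hornerE [al * (s - a)]mulrC [_ + p]addrC.
have G'E s : G^`().[s] = Phi^`().[p + (s - a) * al] * al.
  rewrite /G deriv_comp hornerM horner_comp derivD derivZ derivB derivX !derivC.
  rewrite subr0 addr0 [(al *: 1).[s]]hornerZ -[1]/(1%:P) hornerC mulr1.
  by rewrite hornerD hornerC hornerZ hornerXsubC addrC [al * (s - a)]mulrC.
have cG (Q : {poly R}) : {within `[a, b], continuous (horner Q)}.
  exact/continuous_subspaceT/continuous_horner.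
have ftc : \int[mu]_(x in `[a, b]) G^`().[x] = G.[b] - G.[a].
  rewrite /Rintegral (@continuous_FTC2 _ _ (horner G) _ _ ab (cG _)) //.
    split; first by move=> x _; exact: derivable_horner.
    - by apply: cvg_at_right_filter; exact: continuous_horner.
    - by apply: cvg_at_left_filter; exact: continuous_horner.
  by move=> x _; rewrite -derivE.
have iG : mu.-integrable `[a, b] (EFin \o horner G^`()).
  by apply: continuous_compact_integrable; [exact: segment_compact|exact: cG].
rewrite -[p in X in _ - X]addr0 -[in X in _ - X](mul0r al) -(subrr a) -!GE -ftc.
apply: (le_trans (le_normr_Rintegral _ iG)) => //.
have oc : `]a, b[%classic `<=` `[a, b]%classic by exact: subset_itv_oo_cc.
have iw := bm_integrable_itv a b bw.
have iG1 : mu.-integrable `[a, b] (EFin \o (fun x => `|G^`().[x]|)).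
  by have := integrable_norm iG.
have oo f : mu.-integrable `[a, b] (EFin \o f) ->
    \int[mu]_(x in `[a, b]) f x = \int[mu]_(x in `]a, b[) f x.
  move=> fi; rewrite -Rintegral_itv_obnd_cbnd; last first.
    by apply: integrableS fi => //; exact: subset_itv_oc_cc.
  rewrite -Rintegral_itv_bndo_bndc//.
  by apply: integrableS fi.
rewrite !oo//.
by rewrite (@eq_Rintegral _ _ _ _ _ w)// => x; rewrite inE/= in_itv/= => /hw ->; rewrite G'E normrM.
Qed.

End LineIntegral.

Section LineVariation.
Variables (R : realType) (d : nat) (K : periodic_mesh R d).
Local Notation RT := (measurableTypeR R).
Local Notation mu := (@lebesgue_measure R).
Implicit Types (v : 'cV[R]_d -> R) (x y e : 'cV[R]_d).

Lemma derive_affine_segment v x e a b p al :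
  (forall s, a <= s <= b -> v (x + s *: e) = p + (s - a) * al) ->
  forall s, a < s < b -> 'D_e v (x + s *: e) = al.
Proof.
move=> h s /andP[sa sb].
have sab : a <= s <= b by rewrite !ltW.
have eps0 : 0 < Num.min (s - a) (b - s) by rewrite lt_min !subr_gt0 sa.
rewrite (@derive_right_left _ _ _ _ _ _ al (- al) eps0) ?opprK ?eqxx//.
- move=> r /andP[r0]; rewrite le_min => /andP[_ r2].
  rewrite -addrA -scalerDl !h//; first by ring.
  by apply/andP; split; lra.
- move=> r /andP[r0]; rewrite le_min => /andP[r1 _].
  rewrite scalerN -scaleNr -addrA -scalerDl !h//; first by ring.
  by apply/andP; split; lra.
Qed.

Lemma line_measurable x e : measurable_fun setT (fun s : RT =>
  [tuple (x + s *: e) i 0 | i < d] : d.-tuple RT).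
Proof.
apply/measurable_fun_tnthP => i.
rewrite (_ : _ \o _ = fun s : RT => x i 0 + s * e i 0 : RT).
  by apply: measurable_funD => //; apply: measurable_funM.
by apply/funext => s /=; rewrite tnth_mktuple !mxE.
Qed.

Lemma bm_line (f : 'cV[R]_d -> R) x e : bm (fun t => f (of_tuple t)) ->
  bm (fun s : RT => f (x + s *: e)).
Proof.
move=> bf; have := bm_comp (line_measurable x e) bf.
congr bm; apply/funext => s /=; congr f; apply/matrixP => i j.
by rewrite !mxE tnth_mktuple !mxE (ord1 j).
Qed.

Lemma bm_poly (Phi : {poly R}) d' (T : measurableType d') (f : T -> R) :
  bm f -> bm (fun t => Phi.[f t]).
Proof.
move=> bf; elim/poly_ind: Phi => [|P c IH].
  by under eq_fun do rewrite horner0; exact: bm_cst.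
under eq_fun do rewrite !hornerE.
by apply: bmD; [exact: bmM|exact: bm_cst].
Qed.

Lemma line_variation_interval v x e (Phi : {poly R}) a b : Vh K v -> a <= b ->
  `|Phi.[v (x + b *: e)] - Phi.[v (x + a *: e)]| <=
  \int[mu]_(s in `[a, b])
    (`|Phi^`().[v (x + s *: e)]| * `|'D_e v (x + s *: e)|).
Proof.
move=> Kv; move: a b; set w := (fun s : R => _ * _).
have bw : bm (w : RT -> R).
  have b1 := bm_line x e (Vh_bm Kv).
  have b2 := bm_line (f := fun y => 'D_e v y) x e (Vh_derive_bm e Kv).
  exact: (bmM (bm_norm (bm_poly Phi^`() b1)) (bm_norm b2)).
apply: (variation_local_to_global (F := fun s => Phi.[v (x + s *: e)])
  (J := fun a b => \int[mu]_(s in `[a, b]) w s)).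
- by move=> a b c; exact: Rintegral_itv_chasles.
- move=> t; have [G _ hG] := Vh_rays e Kv.
  have [eps [al [_ [eps0 _ h _]]]] := hG (x + t *: e).
  exists eps => // s /andP[ts se].
  have aff r : t <= r <= s -> v (x + r *: e) = v (x + t *: e) + (r - t) * al.
    move=> /andP[tr rs]; rewrite -h; last by apply/andP; split; lra.
    by rewrite -addrA -scalerDl; congr (v (_ + _ *: _)); ring.
  rewrite (aff s) ?ts ?lexx//; apply: affine_piece_variation => // r rts.
  rewrite /w (derive_affine_segment aff rts) (aff r)//.
  by case/andP: rts => r1 r2; apply/andP; split; exact: ltW.
- move=> t; have [G _ hG] := Vh_rays e Kv.
  have [eps [_ [be [eps0 _ _ h]]]] := hG (x + t *: e).
  exists eps => // s /andP[se st].
  have affN r : t - eps <= r <= t -> v (x + r *: e) = v (x + t *: e) + (t - r) * be.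
    move=> /andP[tr rs]; rewrite -h; last by apply/andP; split; lra.
    by rewrite scalerN -scaleNr -addrA -scalerDl; congr (v (_ + _ *: _)); ring.
  (* The left ray is traversed forwards, which reverses the sign of its slope. *)
  have aff r : s <= r <= t -> v (x + r *: e) = v (x + s *: e) + (r - s) * - be.
    move=> /andP[sr rt].
    have rI : t - eps <= r <= t by apply/andP; split; lra.
    have sI : t - eps <= s <= t by apply/andP; split; lra.
    by rewrite (affN r rI) (affN s sI); ring.
  rewrite (aff t) ?st ?lexx//; apply: affine_piece_variation => // r rts.
  rewrite /w (derive_affine_segment aff rts) (aff r)//.
  by case/andP: rts => r1 r2; apply/andP; split; exact: ltW.
Qed.

Local Notation U := (uniform_prob (@ltr01 R)).

Lemma E_uniform (w : RT -> R) : bm w -> (forall s, 0 <= w s) ->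
  \int[U]_s w s = \int[mu]_(s in `[0, 1]) w s.
Proof.
move=> [mw _] w0; rewrite /Rintegral integral_uniform//.
- by rewrite subr0 invr1 mul1e.
- exact/measurable_EFinP.
Qed.

Lemma line_variation_unit v x e (Phi : {poly R}) a b : Vh K v ->
  0 <= a <= 1 -> 0 <= b <= 1 ->
  `|Phi.[v (x + b *: e)] - Phi.[v (x + a *: e)]| <=
  \int[U]_s (`|Phi^`().[v (x + s *: e)]| * `|'D_e v (x + s *: e)|).
Proof.
move=> Kv; wlog ab : a b / a <= b => [hw ha hb|].
  by have [|/ltW] := leP a b => h; [exact: hw|rewrite distrC; exact: hw].
move=> /andP[a0 a1] /andP[b0 b1].
set w := (fun s : R => _ * _).
have bw : bm (w : RT -> R).
  have c1 := bm_line x e (Vh_bm Kv).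
  have c2 := bm_line (f := fun y => 'D_e v y) x e (Vh_derive_bm e Kv).
  exact: (bmM (bm_norm (bm_poly Phi^`() c1)) (bm_norm c2)).
have w0 s : 0 <= w s by rewrite mulr_ge0.
rewrite E_uniform//; apply: (le_trans (line_variation_interval x e Phi Kv ab)).
rewrite -(Rintegral_itv_chasles bw a0 a1) -(Rintegral_itv_chasles bw ab b1).
rewrite -/w addrCA lerDl addr_ge0//; exact: Rintegral_ge0.
Qed.

Lemma line_periodic v x (i : 'I_d) (s : R) : Defs.periodic v ->
  exists2 r, 0 <= r <= 1 & v (x + s *: delta_mx i 0) = v (x + r *: delta_mx i 0).
Proof.
move=> pv; exists (s - (Num.floor s)%:~R).
  have /andP[h1 h2] := floor_itv s; rewrite intrD in h2.
  by apply/andP; split; lra.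
rewrite -[RHS](pv _ (Num.floor s *: delta_mx i 0)); congr v.
have -> : lattice R (Num.floor s *: delta_mx i 0) = (Num.floor s)%:~R *: delta_mx i 0.
  apply/matrixP => j k; rewrite !mxE.
  by case: (_ && _); rewrite ?mulr1 ?mulr0.
by rewrite -addrA -scalerDl subrK.
Qed.

(** Periodicity brings both points into the unit interval, where enlarging the domain of integration
    to the whole interval only increases the bound. *)
Lemma Vh_variation v x (i : 'I_d) : Vh K v ->
  variation_bound U (fun s => v (x + s *: delta_mx i 0))
    (fun s => 'D_(delta_mx i 0) v (x + s *: delta_mx i 0)).
Proof.
move=> Kv s t; have [_ pv _] := Kv.
have [r r01 ->] := line_periodic x i s pv.
have [q q01 ->] := line_periodic x i t pv; split.
  have := line_variation_unit x (delta_mx i 0) 'X Kv q01 r01.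
  rewrite !hornerX; congr (_ <= _); apply: E_ext => y.
  by rewrite derivX hornerC normr1 mul1r.
have h := line_variation_unit x (delta_mx i 0) 'X^2 Kv q01 r01.
rewrite !hornerXn in h.
rewrite -lerBlDl; apply: (le_trans (ler_norm _)); apply: (le_trans h).
rewrite le_eqVlt; apply/orP; left; apply/eqP; apply: E_ext => y.
by rewrite derivXn hornerMn hornerXn expr1 -mulr_natl normrM ger0_norm.
Qed.

End LineVariation.

Lemma sum_sqr_coord (R : realType) d (F : 'I_d -> R) : (1 <= d <= 3)%N ->
  \sum_i F i ^+ 2 = (\sum_(i < d | i == 0%N :> nat) F i) ^+ 2
    + (\sum_(i < d | i == 1%N :> nat) F i) ^+ 2
    + (\sum_(i < d | i == 2%N :> nat) F i) ^+ 2.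
Proof.
move=> hd; rewrite (big_mkcond (fun i : 'I_d => i == 0%N :> nat)).
rewrite (big_mkcond (fun i : 'I_d => i == 1%N :> nat)).
rewrite (big_mkcond (fun i : 'I_d => i == 2%N :> nat)).
by case: d hd F => [|[|[|[|n]]]]// _ F;
  rewrite !big_ord_recl !big_ord0 /=; ring.
Qed.

(** * Poincare and Ladyzhenskaya inequalities for finite element functions *)

Section Sobolev.
Variables (R : realType) (d : nat) (K : periodic_mesh R d).
Hypothesis d_range : (1 <= d <= 3)%N.
Local Notation RT := (measurableTypeR R).
Local Notation U := (uniform_prob (@ltr01 R)).
Implicit Types (v : 'cV[R]_d -> R).

Lemma enorm_sqr n (u : 'cV[R]_n) : enorm u ^+ 2 = \sum_i u i 0 ^+ 2.
Proof.
have e : dot u u = \sum_i u i 0 ^+ 2.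
  by rewrite dotE; apply: eq_bigr => i _; rewrite expr2.
by rewrite /enorm sqr_sqrtr e// sumr_ge0// => i _; exact: sqr_ge0.
Qed.

Definition axis_derive v (k : nat) (x : 'cV[R]_d) : R :=
  \sum_(i < d | i == k :> nat) 'D_(delta_mx i 0) v x.

Lemma axis_derive_variation v k (b : 'cV[R]_d) : Vh K v ->
  variation_bound U (fun s => v (b + s *: \col_i (i == k :> nat)%:R))
    (fun s => axis_derive v k (b + s *: \col_i (i == k :> nat)%:R)).
Proof.
move=> Kv; have [kd|dk] := ltnP k d.
  pose i := Ordinal kd.
  have -> : \col_(j < d) (j == k :> nat)%:R = delta_mx i 0 :> 'cV[R]_d.
    by apply/matrixP => j l; rewrite !mxE (ord1 l) eqxx andbT.
  rewrite (_ : (fun s => axis_derive _ _ _) =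
    fun s => 'D_(delta_mx i 0) v (b + s *: delta_mx i 0)).
    exact: (Vh_variation b i Kv).
  by apply/funext => s; rewrite /axis_derive (big_pred1 i).
have -> : \col_(j < d) (j == k :> nat)%:R = 0 :> 'cV[R]_d.
  by apply/matrixP => j l; rewrite !mxE ltn_eqF// (leq_trans (ltn_ord j)).
move=> s t; rewrite !scaler0 subrr normr0; split.
  by apply: Rintegral_ge0 => r _.
by rewrite lerDl; apply: Rintegral_ge0 => r _; rewrite !mulr_ge0.
Qed.

Lemma axis_derive_bm v k : Vh K v -> bm (fun t => axis_derive v k (of_tuple t)).
Proof. by move=> Kv; apply: bm_sum => i; exact: (Vh_derive_bm _ Kv). Qed.

Lemma pad1 x y z : pad d x y z = pad d 0 y z + (x : R) *: \col_i (i == 0%N :> nat)%:R.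
Proof.
apply/matrixP => i j; rewrite !mxE.
by case: i => -[|[|[|i]]] hi /=; rewrite ?mulr0 ?mulr1 ?add0r ?addr0.
Qed.

Lemma pad2 x y z : pad d x y z = pad d x 0 z + (y : R) *: \col_i (i == 1%N :> nat)%:R.
Proof.
apply/matrixP => i j; rewrite !mxE.
by case: i => -[|[|[|i]]] hi /=; rewrite ?mulr0 ?mulr1 ?add0r ?addr0.
Qed.

Lemma pad3 x y z : pad d x y z = pad d x y 0 + (z : R) *: \col_i (i == 2%N :> nat)%:R.
Proof.
apply/matrixP => i j; rewrite !mxE.
by case: i => -[|[|[|i]]] hi /=; rewrite ?mulr0 ?mulr1 ?add0r ?addr0.
Qed.

Lemma grad_sqr v x : enorm (grad v x) ^+ 2 =
  axis_derive v 0 x ^+ 2 + axis_derive v 1 x ^+ 2 + axis_derive v 2 x ^+ 2.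
Proof.
rewrite enorm_sqr /axis_derive; under eq_bigr do rewrite mxE.
exact: sum_sqr_coord.
Qed.

Let u v : RT -> RT -> RT -> R := fun x y z => v (pad d x y z).
Let g v k : RT -> RT -> RT -> R := fun x y z => axis_derive v k (pad d x y z).

Let d3 : (d <= 3)%N. Proof. by case/andP: d_range. Qed.

Let bu v : Vh K v -> bm3 (u v).
Proof. by move=> Kv; exact: bm_pad (Vh_bm Kv). Qed.

Let bg v k : Vh K v -> bm3 (g v k).
Proof. by move=> Kv; exact: bm_pad (axis_derive_bm k Kv). Qed.

Let v1 v y z : Vh K v ->
  variation_bound U (fun x => u v x y z) (fun x => g v 0 x y z).
Proof.
move=> Kv; have := axis_derive_variation 0 (pad d 0 y z) Kv.
by congr (variation_bound _ _ _); apply/funext => s; rewrite -pad1.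
Qed.

Let v2 v x z : Vh K v ->
  variation_bound U (fun y => u v x y z) (fun y => g v 1 x y z).
Proof.
move=> Kv; have := axis_derive_variation 1 (pad d x 0 z) Kv.
by congr (variation_bound _ _ _); apply/funext => s; rewrite -pad2.
Qed.

Let v3 v x y : Vh K v ->
  variation_bound U (fun z => u v x y z) (fun z => g v 2 x y z).
Proof.
move=> Kv; have := axis_derive_variation 2 (pad d x y 0) Kv.
by congr (variation_bound _ _ _); apply/funext => s; rewrite -pad3.
Qed.

Lemma gradL2sqE v : Vh K v -> gradL2sq v =
  E3 U (fun x y z => g v 0 x y z ^+ 2) + E3 U (fun x y z => g v 1 x y z ^+ 2)
  + E3 U (fun x y z => g v 2 x y z ^+ 2).
Proof.
move=> Kv; rewrite /gradL2sq.
have b k := bmX 2 (axis_derive_bm k Kv).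
have -> : (fun x => enorm (grad v x) ^+ 2) = fun x =>
    axis_derive v 0 x ^+ 2 + axis_derive v 1 x ^+ 2 + axis_derive v 2 x ^+ 2.
  by apply/funext => x; exact: grad_sqr.
have b3 k : bm3 (fun x y z => g v k x y z ^+ 2).
  exact: (bm_pad (f := fun x => axis_derive v k x ^+ 2) d3 (b k)).
rewrite intT_pad//; last exact: (bmD (bmD (b 0) (b 1)) (b 2)).
rewrite !E3_prod3//; last exact: (bmD (bmD (b3 0) (b3 1)) (b3 2)).
rewrite (E_D _ (bmD (b3 0) (b3 1)) (b3 2)).
by rewrite (E_D _ (b3 0) (b3 1)).
Qed.

Lemma Vh_poincare v : Vh K v -> normL2sq v <= intT v ^+ 2 + gradL2sq v.
Proof.
move=> Kv; rewrite gradL2sqE// /normL2sq.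
rewrite (intT_pad d_range (Vh_bm Kv)).
rewrite (intT_pad (f := fun x => v x ^+ 2) d_range (bmX 2 (Vh_bm Kv))).
apply: (poincare3 (bu Kv) (bg 0 Kv) (bg 1 Kv) (bg 2 Kv)) => *.
- exact: v1.
- exact: v2.
- exact: v3.
Qed.

Lemma Vh_ladyzhenskaya v : Vh K v -> intT (fun x => v x ^+ 4) <= 8 * normH1sq v ^+ 2.
Proof.
move=> Kv; rewrite /normH1sq gradL2sqE// /normL2sq.
rewrite (intT_pad (f := fun x => v x ^+ 4) d_range (bmX 4 (Vh_bm Kv))).
rewrite (intT_pad (f := fun x => v x ^+ 2) d_range (bmX 2 (Vh_bm Kv))).
apply: (ladyzhenskaya3 (bu Kv) (bg 0 Kv) (bg 1 Kv) (bg 2 Kv)) => *.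
- exact: v1.
- exact: v2.
- exact: v3.
Qed.

End Sobolev.

(** * The potential *)

Section LogPower.
Variable R : realType.
Implicit Types (t s d p : R).

Lemma ln_le_subr1 t : 0 < t -> ln t <= t - 1.
Proof.
move=> t0; have /le_ln1Dx : -1 < t - 1 by rewrite ltrBrDr addNr.
by rewrite addrC subrK.
Qed.

Lemma ln_le_linear t d : 0 < t -> 0 < d -> ln t <= d * t - 1 - ln d.
Proof.
move=> t0 d0; have := ln_le_subr1 (mulr_gt0 d0 t0).
by rewrite lnM ?posrE//; lra.
Qed.

(** The tangent bound [ln_le_linear] is applied to [t] and to [t ^ (- p)], whose logarithm is
    [- p * ln t]. The slope [d] is free, so that the logarithm can be absorbed. *)
Lemma abs_ln_le p d : 0 < p -> 0 < d -> exists K, forall t, 0 < t ->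
  `|ln t| <= d * (t + t `^ (- p)) + K.
Proof.
move=> p0 d0.
exists (Num.max (- 1 - ln d) ((- 1 - ln (p * d)) / p)) => t t0.
have tp0 : 0 < t `^ (- p) by exact: powR_gt0.
have h1 := ln_le_linear t0 d0.
have h2 := ln_le_linear tp0 (mulr_gt0 p0 d0).
rewrite ln_powR in h2.
set M := Num.max _ _.
have m1 : - 1 - ln d <= M by rewrite le_max lexx.
have m2 : (- 1 - ln (p * d)) / p <= M by rewrite le_max lexx orbT.
rewrite ler_pdivrMr// in m2.
have dt : 0 < d * t by exact: mulr_gt0.
have dtp : 0 < d * t `^ (- p) by exact: mulr_gt0.
rewrite ler_norml; apply/andP; split; last lra.
rewrite -(ler_pM2l p0).
have e1 : p * - (d * (t + t `^ (- p)) + M) =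
  - (p * (d * t)) - p * d * t `^ (- p) - M * p by ring.
rewrite e1; have := mulr_gt0 p0 dt; lra.
Qed.

(** For [t <= d] one factor [t] is replaced by [d]; for larger [t] the decreasing power is at most
    its value at [d]. *)
Lemma powR_onem_le p d t : 1 < p -> 0 < d -> 0 < t ->
  t `^ (1 - p) <= d * t `^ (- p) + d `^ (1 - p).
Proof.
move=> p1 d0 t0; have [td|dt] := leP t d.
  rewrite powRD; last by rewrite (gt_eqF t0) implybT.
  rewrite powRr1 ?(ltW t0)// -[leLHS]addr0 lerD//; last exact: powR_ge0.
  by rewrite ler_wpM2r// powR_ge0.
rewrite -[leLHS]add0r lerD//; first by rewrite mulr_ge0 ?powR_ge0 ?(ltW d0).
have -> : 1 - p = - (p - 1) by ring.
rewrite !powRN lef_pV2 ?posrE ?powR_gt0//.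
by apply: ge0_ler_powR; rewrite ?nnegrE ?subr_ge0 ?ltW.
Qed.

Lemma inv_le_powR p t : 1 < p -> 0 < t -> t^-1 <= 1 + t `^ (- p).
Proof.
move=> p1 t0; have [t1|t1] := leP 1 t.
  by rewrite -[leLHS]addr0 lerD ?powR_ge0// invf_le1.
rewrite -[leLHS]add0r lerD// -powR_inv1 ?(ltW t0)//.
by apply: ger_powR; [rewrite t0/= ltW|rewrite lerN2 ltW].
Qed.

(** The tangent inequality for a convex power. With [x = s / t], the exponential lies above
    [1 + (1 - p) * ln x], and [ln x <= x - 1] is multiplied by the negative number [1 - p]. *)
Lemma powR_bernoulli p t s : 1 < p -> 0 < t -> 0 < s ->
  (1 - p) * t `^ (- p) * (s - t) <= s `^ (1 - p) - t `^ (1 - p).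
Proof.
move=> p1 t0 s0; pose x := s / t.
have x0 : 0 < x by exact: divr_gt0.
have sE : s = x * t by rewrite /x divfK// gt_eqF.
have hx : 1 + (1 - p) * (x - 1) <= x `^ (1 - p).
  rewrite /powR gt_eqF//; apply: le_trans (expR_ge1Dx _).
  rewrite lerD2l; have := ln_le_subr1 x0; nra.
rewrite sE powRM ?(ltW x0) ?(ltW t0)//.
have tp : t `^ (1 - p) = t * t `^ (- p).
  rewrite powRD; last by rewrite (gt_eqF t0) implybT.
  by rewrite powRr1 ?(ltW t0).
have tpos : 0 < t `^ (1 - p) by exact: powR_gt0.
have -> : (1 - p) * t `^ (- p) * (x * t - t) = (1 - p) * (x - 1) * t `^ (1 - p).
  by rewrite tp; ring.
have := ler_wpM2r (ltW tpos) hx; lra.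
Qed.

End LogPower.

Section Potential.
Variables (R : realType) (P : params R).
Implicit Types (z : R * R) (t s : R).
Hypothesis q1 : 1 < q P.

Lemma is_derive_psi z t : 0 < t -> is_derive t 1 (psi P z)
  (t^-1 - eps1 P * ln t + epsq P * t `^ (- q P) + ev (F1 P) z).
Proof.
move=> t0; rewrite /psi.
have dln := is_derive1_ln t0.
have dpw := @is_derive1_powR _ (1 - q P) t t0.
apply: is_derive_eq.
rewrite /GRing.scale/= !mulr1 ?mulr0.
have -> : 1 - q P - 1 = - q P by ring.
by field; rewrite (gt_eqF t0) /= subr_eq0 gt_eqF.
Qed.

Lemma internal_energyE z t : 0 < t -> internal_energy P z t =
  t^-1 - eps1 P * ln t + epsq P * t `^ (- q P) + ev (F1 P) z.
Proof.
by move=> t0; rewrite /internal_energy derive1E; case: (is_derive_psi z t0).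
Qed.

Lemma s_bulkE z t : 0 < t -> s_bulk P z t =
  1 - ln t - eps1 P * t + epsq P * (q P / (q P - 1)) * t `^ (1 - q P) + ev (F0 P) z.
Proof.
move=> t0; rewrite /s_bulk internal_energyE// /psi.
have -> : t `^ (1 - q P) = t * t `^ (- q P).
  rewrite powRD; last by rewrite (gt_eqF t0) implybT.
  by rewrite powRr1 ?(ltW t0).
by field; rewrite (gt_eqF t0) /= subr_eq0 gt_eqF.
Qed.

(** Tangent inequalities are added term by term: [h1] for the logarithm, [h5] for the entropic term,
    [h4] for the power; the terms in [F0] and [F1] are affine in the temperature. *)
Lemma psi_concave_theta z t s : 0 < eps1 P -> 0 < epsq P -> 0 < t -> 0 < s ->
  psi P z s - psi P z t <= internal_energy P z t * (s - t).
Proof.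
move=> e1 eq0 t0 s0; rewrite internal_energyE// /psi.
have t0' : t != 0 by rewrite gt_eqF.
have h1 : ln s - ln t <= t^-1 * (s - t).
  rewrite -ln_div ?posrE//.
  have := ln_le_subr1 (divr_gt0 s0 t0); congr (_ <= _).
  by rewrite mulrBr mulVf// mulrC.
have h2 : s - t <= s * (ln s - ln t).
  have := ln_le_subr1 (divr_gt0 t0 s0); rewrite ln_div ?posrE// => h.
  have : s * (ln t - ln s) <= s * (t / s - 1) by rewrite ler_pM2l.
  by rewrite [s * (t / s - 1)]mulrBr mulrCA divff ?gt_eqF//; lra.
have h3 := powR_bernoulli q1 t0 s0.
have qp : 0 < q P - 1 by rewrite subr_gt0.
have h4 : - (epsq P / (q P - 1)) * (s `^ (1 - q P) - t `^ (1 - q P)) <=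
    epsq P * t `^ (- q P) * (s - t).
  have -> : epsq P * t `^ (- q P) * (s - t) = - (epsq P / (q P - 1)) *
      ((1 - q P) * t `^ (- q P) * (s - t)).
    by field; rewrite gt_eqF.
  by rewrite ler_nM2l// oppr_lt0 divr_gt0.
have h5 : eps1 P * (s - t) <= eps1 P * (s * (ln s - ln t)) by rewrite ler_pM2l.
lra.
Qed.

Lemma avail_coercive ca Ca : 0 < eps1 P -> 0 < epsq P -> 0 < avail_a P ->
  0 < ca -> 0 < Ca ->
  (forall z, ca * abs2 z ^+ 4 - Ca <= avail_a P * ev (F1 P) z - ev (F0 P) z) ->
  exists2 c, 0 < c & exists C, forall z t, 0 < t ->
    c * (t + t `^ (- q P) + abs2 z ^+ 4) - C <=
    avail_a P * internal_energy P z t - s_bulk P z t.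
Proof.
move=> e10 eq0 a0 ca0 Ca0 hF.
(* [b] is the coercivity available for [t + t ^ (- q)]. The logarithm, with coefficient bounded by
   [m], and the power, with coefficient [k], consume a quarter of it each, which leaves [b / 2]. The
   summand 1 in [m] permits division. *)
pose a := avail_a P; pose b := Num.min (eps1 P) (a * epsq P).
have b0 : 0 < b by rewrite lt_min e10 mulr_gt0.
pose m := `|1 - a * eps1 P| + 1.
have m0 : 0 < m by rewrite ltr_pwDr.
pose k := epsq P * (q P / (q P - 1)).
have k0 : 0 < k.
  by rewrite mulr_gt0// divr_gt0 ?subr_gt0// (lt_trans ltr01).
have dm : 0 < b / (4 * m) by rewrite divr_gt0// mulr_gt0.
have dk : 0 < b / (4 * k) by rewrite divr_gt0// mulr_gt0.
have [K hK] := abs_ln_le (lt_trans ltr01 q1) dm.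
pose c := Num.min (b / 2) ca.
exists c; first by rewrite lt_min ca0 andbT divr_gt0.
exists (m * `|K| + k * (b / (4 * k)) `^ (1 - q P) + Ca + 1) => z t t0.
rewrite internal_energyE// s_bulkE// -/a -/k.
have hz := hF z; rewrite -/a in hz.
have hl := hK t t0.
have hp := powR_onem_le q1 dk t0.
move: hl hp; set p := t `^ (- q P); set r := t `^ (1 - q P).
set r' := (b / (4 * k)) `^ (1 - q P); move=> hl hp.
have p0 : 0 < p by exact: powR_gt0.
have hl1 : - (m * (b / (4 * m) * (t + p) + `|K|)) <= (1 - a * eps1 P) * ln t.
  rewrite lerNl; apply: (le_trans (ler_norm _)).
  rewrite normrN normrM ler_pM//; first by rewrite lerDl.
  by rewrite (le_trans hl)// lerD2l ler_norm.
have -> : a * (t^-1 - eps1 P * ln t + epsq P * p + ev (F1 P) z) -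
  (1 - ln t - eps1 P * t + k * r + ev (F0 P) z) =
  a * t^-1 + (1 - a * eps1 P) * ln t + a * epsq P * p - 1 + eps1 P * t - k * r
  + (a * ev (F1 P) z - ev (F0 P) z) by ring.
have hl2 : - (b / 4 * (t + p)) - m * `|K| <= (1 - a * eps1 P) * ln t.
  apply: le_trans hl1; rewrite le_eqVlt; apply/orP; left; apply/eqP.
  by field; rewrite gt_eqF.
have hp2 : k * r <= b / 4 * p + k * r'.
  have : k * r <= k * (b / (4 * k) * p + r') by rewrite ler_pM2l.
  by congr (_ <= _); field; rewrite gt_eqF.
have ha : 0 <= a * t^-1 by rewrite mulr_ge0 ?invr_ge0 ?ltW.
have b1 : b * t <= eps1 P * t by rewrite ler_pM2r// ge_min lexx.
have b2 : b * p <= a * epsq P * p by rewrite ler_pM2r// ge_min lexx orbT.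
have bt : 0 < b * t by exact: mulr_gt0.
have bp : 0 < b * p by exact: mulr_gt0.
have c1 : c * (t + p) <= b / 2 * (t + p).
  by rewrite ler_wpM2r ?ge_min ?lexx// addr_ge0 ?(ltW t0) ?(ltW p0).
have z0 : 0 <= abs2 z ^+ 4 by rewrite exprn_ge0// sqrtr_ge0.
have c2 : c * abs2 z ^+ 4 <= ca * abs2 z ^+ 4.
  by rewrite ler_wpM2r// ge_min lexx orbT.
rewrite [c * _]mulrDr; lra.
Qed.

End Potential.

(** * Derivatives and tangent inequalities of bivariate polynomials *)

Section BivariatePoly.
Variable R : realType.
Implicit Types (F G H : {poly {poly R}}) (z w : R * R).

Lemma ev0 z : ev (0 : {poly {poly R}}) z = 0.
Proof. by rewrite /ev !horner0. Qed.

Lemma ev_MXaddC F (c : {poly R}) z : ev (F * 'X + c%:P) z = ev F z * z.1 + c.[z.2].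
Proof. by rewrite /ev !hornerE. Qed.

Lemma evD F G z : ev (F + G) z = ev F z + ev G z.
Proof. by rewrite /ev !hornerD. Qed.

Lemma evN F z : ev (- F) z = - ev F z.
Proof. by rewrite /ev !hornerN. Qed.

Lemma evM F G z : ev (F * G) z = ev F z * ev G z.
Proof. by rewrite /ev !hornerM. Qed.

Lemma evC (c : R) z : ev c%:P%:P z = c.
Proof. by rewrite /ev !hornerC. Qed.

Lemma evX F n z : ev (F ^+ n) z = ev F z ^+ n.
Proof. by rewrite /ev !horner_exp. Qed.

Lemma ev_X1 z : ev 'X z = z.1.
Proof. by rewrite /ev hornerX hornerC. Qed.

Lemma ev_X2 z : ev ('X%:P) z = z.2.
Proof. by rewrite /ev hornerC hornerX. Qed.

(** Derivatives along arbitrary lines provide [d1], [d2] and the slope along a segment by a single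
    induction. That the partial derivatives are again polynomials makes them bounded and measurable
    along discrete solutions. *)
Lemma ev_partials F : exists GH : {poly {poly R}} * {poly {poly R}},
  forall x y a b r : R, is_derive r 1 (fun r => ev F (x + r * a, y + r * b))
    (a * ev GH.1 (x + r * a, y + r * b) + b * ev GH.2 (x + r * a, y + r * b)).
Proof.
have lin (x a r : R) : is_derive r 1 (fun r : R => x + r * a) a.
  by apply: is_derive_eq; rewrite /GRing.scale/=; ring.
elim/poly_ind: F => [|F c [[G H] IH]].
  exists (0, 0) => x y a b r; rewrite !ev0 !mulr0 addr0.
  by under eq_fun do rewrite ev0; exact: is_derive_cst.
exists (G * 'X + F, H * 'X + c^`()%:P) => x y a b r.
under eq_fun do rewrite ev_MXaddC /=.
rewrite evD evM ev_X1 ev_MXaddC /=.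
have dF := IH x y a b r.
have dx := lin x a r.
have dc : is_derive r 1 (fun r : R => c.[y + r * b]) (c^`().[y + r * b] * b).
  exact: (is_derive1_comp (f := horner c) (g := fun r : R => y + r * b)).
apply: is_derive_eq; rewrite /GRing.scale/=; ring.
Qed.

Definition partials F := projT1 (cid (ev_partials F)).

Lemma is_derive_ev F (x y a b r : R) :
  is_derive r 1 (fun r => ev F (x + r * a, y + r * b))
    (a * ev (partials F).1 (x + r * a, y + r * b) +
     b * ev (partials F).2 (x + r * a, y + r * b)).
Proof. by rewrite /partials; case: cid => GH /=; exact. Qed.

Lemma d1_ev F z : d1 (ev F) z = ev (partials F).1 z.
Proof.
case: z => x y; have := is_derive_ev F 0 y 1 0 x.
rewrite mul1r mul0r addr0 add0r mulr1 mulr0 addr0.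
rewrite (_ : (fun r => _) = (fun r => ev F (r, y))); last first.
  by apply/funext => r; rewrite add0r mulr1 mulr0 addr0.
by move=> -[_ <-]; rewrite /d1 derive1E.
Qed.

Lemma d2_ev F z : d2 (ev F) z = ev (partials F).2 z.
Proof.
case: z => x y; have := is_derive_ev F x 0 0 1 y.
rewrite mul1r mul0r add0r mulr1 mulr0 addr0 add0r.
rewrite (_ : (fun r => _) = (fun r => ev F (x, r))); last first.
  by apply/funext => r; rewrite add0r mulr1 mulr0 addr0.
by move=> -[_ <-]; rewrite /d2 derive1E.
Qed.

(** Directions [(1, 0)] and [(0, 1)] identify the chosen partial derivatives, so a gradient can be
    computed from any convenient formula for the function. *)
Lemma ev_partialsE F (g1 g2 x y : R) :
  (forall a b, is_derive (0 : R) 1 (fun r => ev F (x + r * a, y + r * b))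
     (a * g1 + b * g2)) ->
  ev (partials F).1 (x, y) = g1 /\ ev (partials F).2 (x, y) = g2.
Proof.
move=> h.
have e a b : a * g1 + b * g2 =
    a * ev (partials F).1 (x, y) + b * ev (partials F).2 (x, y).
  have [_ <-] := h a b; have [_ ->] := is_derive_ev F x y a b 0.
  by rewrite !mul0r !addr0.
by split; [have := e 1 0|have := e 0 1];
  rewrite !mul1r !mul0r ?addr0 ?add0r => ->.
Qed.

(** The chord inequality divided by the parameter [h], in the limit from the right at 0. *)
Lemma convex_tangent F z w : convex_fun (ev F) ->
  d1 (ev F) z * (w.1 - z.1) + d2 (ev F) z * (w.2 - z.2) <= ev F w - ev F z.
Proof.
move=> cF; rewrite d1_ev d2_ev.
pose a := w.1 - z.1; pose b := w.2 - z.2.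
have := is_derive_ev F z.1 z.2 a b 0.
rewrite !mul0r !addr0 -surjective_pairing.
rewrite [a * _]mulrC [b * _]mulrC => -[dF dE].
rewrite -dE; have {}dF := cvg_dnbhs_at_right dF.
apply: (cvgr_to_le dF); near=> h.
have h0 : 0 < h by near: h; exact: nbhs_right_gt.
have h1 : h <= 1 by near: h; exact: nbhs_right_le.
rewrite /GRing.scale/= addr0 mulr1 !mul0r !addr0 -surjective_pairing.
rewrite mulrC ler_pdivrMr//.
have cvx : ev F (h * w.1 + (1 - h) * z.1, h * w.2 + (1 - h) * z.2) <=
    h * ev F w + (1 - h) * ev F z.
  by apply: (cF (Itv01 (ltW h0) h1)); rewrite inE.
have -> : (z.1 + h * a, z.2 + h * b) =
    (h * w.1 + (1 - h) * z.1, h * w.2 + (1 - h) * z.2).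
  by rewrite /a /b; congr (_, _); ring.
lra.
Unshelve. all: by end_near. Qed.

End BivariatePoly.

Lemma abs2_sqr (R : realType) (z : R * R) : abs2 z ^+ 2 = z.1 ^+ 2 + z.2 ^+ 2.
Proof. by rewrite sqr_sqrtr// addr_ge0// sqr_ge0. Qed.

Lemma abs2_ge0 (R : realType) (z : R * R) : 0 <= abs2 z.
Proof. exact: sqrtr_ge0. Qed.

Lemma norm1_le_abs2 (R : realType) (z : R * R) : `|z.1| <= abs2 z.
Proof.
rewrite -(@ler_pXn2r _ 2)// ?nnegrE ?abs2_ge0// abs2_sqr real_normK ?num_real//.
by rewrite lerDl sqr_ge0.
Qed.

Lemma norm2_le_abs2 (R : realType) (z : R * R) : `|z.2| <= abs2 z.
Proof.
rewrite -(@ler_pXn2r _ 2)// ?nnegrE ?abs2_ge0// abs2_sqr real_normK ?num_real//.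
by rewrite lerDr sqr_ge0.
Qed.

(** Replaces [abs2] under integrals: built from absolute values and a sum, it stays in the class of
    bounded measurable functions. *)
Definition norm_sum (R : realType) (z : R * R) : R := `|z.1| + `|z.2|.

Lemma norm_sum_ge0 (R : realType) (z : R * R) : 0 <= norm_sum z.
Proof. exact: addr_ge0. Qed.

Lemma abs2_le_norm_sum (R : realType) (z : R * R) : abs2 z <= norm_sum z.
Proof.
rewrite -(@ler_pXn2r _ 2)// ?nnegrE ?abs2_ge0 ?norm_sum_ge0// abs2_sqr /norm_sum.
rewrite sqrrD !real_normK ?num_real// addrAC lerDl mulrn_wge0// mulr_ge0//.
Qed.

Lemma quartic_le_abs2 (R : realType) (z : R * R) :
  z.1 ^+ 4 + z.2 ^+ 4 <= abs2 z ^+ 4.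
Proof.
rewrite (exprM (abs2 z) 2 2) abs2_sqr sqrrD -!exprM addrAC lerDl mulrn_wge0//.
by rewrite mulr_ge0// sqr_ge0.
Qed.

Lemma norm_sum_quartic (R : realType) (z : R * R) :
  norm_sum z ^+ 4 <= 8 * (z.1 ^+ 4 + z.2 ^+ 4).
Proof.
have h (a b : R) : (a + b) ^+ 2 <= 2 * (a ^+ 2 + b ^+ 2).
  by have := sqr_ge0 (a - b); lra.
have h1 := h `|z.1| `|z.2|; rewrite !real_normK ?num_real// in h1.
have h2 := h (z.1 ^+ 2) (z.2 ^+ 2); rewrite -!exprM in h2.
rewrite (exprM (norm_sum z) 2 2).
apply: (@le_trans _ _ ((2 * (z.1 ^+ 2 + z.2 ^+ 2)) ^+ 2)).
  by rewrite lerXn2r// nnegrE ?sqr_ge0// mulr_ge0// addr_ge0// sqr_ge0.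
by rewrite exprMn; lra.
Qed.

Lemma monomial_le (R : realType) (x y : R) (i j : nat) : (i + j <= 4)%N ->
  `|x| ^+ j * `|y| ^+ i <= 1 + (x ^+ 4 + y ^+ 4).
Proof.
move=> ij; pose M := Num.max `|x| `|y|.
have xM : `|x| <= M by rewrite le_max lexx.
have yM : `|y| <= M by rewrite le_max lexx orbT.
have M0 : 0 <= M by rewrite (le_trans _ xM).
have e4 (r : R) : `|r| ^+ 4 = r ^+ 4.
  by rewrite (exprM _ 2 2) real_normK ?num_real// -exprM.
have p4 (r : R) : 0 <= r ^+ 4 by rewrite (exprM _ 2 2) sqr_ge0.
apply: (@le_trans _ _ (M ^+ (j + i))).
  by rewrite exprD ler_pM ?exprn_ge0// lerXn2r// nnegrE.
apply: (@le_trans _ _ (1 + M ^+ 4)).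
  have [M1|/ltW M1] := leP M 1.
    by rewrite (le_trans (exprn_ile1 _ M0 M1))// lerDl exprn_ge0.
  have ji : (j + i <= 4)%N by rewrite addnC.
  by rewrite (le_trans (ler_weXn2l M1 ji))// lerDr.
rewrite lerD2l -(e4 x) -(e4 y) /M.
by case: (leP `|x| `|y|) => _; rewrite ?lerDl ?lerDr exprn_ge0.
Qed.

Lemma degree_le4_bound (R : realType) (F : {poly {poly R}}) : degree_le4 F ->
  exists2 C, 0 <= C & forall z, `|ev F z| <= C * (1 + (z.1 ^+ 4 + z.2 ^+ 4)).
Proof.
move=> dF; exists (\sum_(j < size F) \sum_(i < size F`_j) `|F`_j`_i|).
  by apply: sumr_ge0 => j _; apply: sumr_ge0.
move=> z; rewrite /ev (horner_coef F) horner_sum.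
rewrite (le_trans (ler_norm_sum _ _ _))// mulr_suml; apply: ler_sum => j _.
rewrite hornerM horner_exp hornerC horner_coef mulr_suml.
rewrite (le_trans (ler_norm_sum _ _ _))// mulr_suml; apply: ler_sum => i _.
rewrite !normrM -mulrA ![`|_ ^+ _|]normrX [_ ^+ i * _]mulrC.
have [ij|ij] := leqP (i + j) 4; first by rewrite ler_wpM2l// monomial_le.
by rewrite dF// normr0 !mul0r.
Qed.

(** * Convex-concave splitting and pointwise bounds on the potential *)

Section Splitting.
Variables (R : realType) (P : params R) (d : nat).
Hypothesis P_adm : admissible_params P d.
Implicit Types (z w : R * R) (t s : R).

Let q1 : 1 < q P. Proof. by case: P_adm => -[]. Qed.
Let e1 : 0 < eps1 P. Proof. by case: P_adm => _ []. Qed.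
Let eq0 : 0 < epsq P. Proof. by case: P_adm => _ []. Qed.
Let a0 : 0 < avail_a P. Proof. by case: P_adm => _ _ _ []. Qed.
Let M0 : 0 < split_M P. Proof. by case: P_adm => _ _ _ _ []. Qed.

(** At fixed temperature both parts of the splitting are polynomials in the phase fields; ['X]
    stands for [z.1] and ['X%:P] for [z.2]. *)
Definition cav_poly t : {poly {poly R}} :=
  - ((split_M P * (1 + t))%:P%:P * (1 + ('X ^+ 2 + 'X%:P ^+ 2)) ^+ 2).

Definition vex_poly t : {poly {poly R}} :=
  (ln t - eps1 P * t * (ln t - 1) - epsq P / (q P - 1) * t `^ (1 - q P))%:P%:P
  - F0 P + t%:P%:P * F1 P - cav_poly t.

Lemma psi_cavE t : psi_cav P ^~ t = ev (cav_poly t).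
Proof.
apply/funext => z; rewrite /psi_cav /cav_poly evN evM evX !evD !evX.
by rewrite ev_X1 ev_X2 evC abs2_sqr [ev 1 z](evC 1).
Qed.

Lemma psi_vexE t : psi_vex P ^~ t = ev (vex_poly t).
Proof.
apply/funext => z; have c : ev (cav_poly t) z = psi_cav P z t by rewrite -psi_cavE.
rewrite /vex_poly evD (evN (cav_poly t)) c !evD (evN (F0 P)) evC evM evC.
by rewrite /psi_vex /psi /psi_cav opprK.
Qed.

Lemma cav_partials t z :
  ev (partials (cav_poly t)).1 z = - (4 * split_M P * (1 + t) * (1 + abs2 z ^+ 2) * z.1) /\
  ev (partials (cav_poly t)).2 z = - (4 * split_M P * (1 + t) * (1 + abs2 z ^+ 2) * z.2).
Proof.
case: z => x y; apply: ev_partialsE => a b.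
rewrite -psi_cavE /psi_cav abs2_sqr /=.
under eq_fun do rewrite abs2_sqr /=.
apply: is_derive_eq; rewrite /GRing.scale/= !mul0r !addr0; ring.
Qed.

Lemma vex_partials t z :
  ev (partials (vex_poly t)).1 z = - d1 (ev (F0 P)) z + t * d1 (ev (F1 P)) z
    - ev (partials (cav_poly t)).1 z /\
  ev (partials (vex_poly t)).2 z = - d2 (ev (F0 P)) z + t * d2 (ev (F1 P)) z
    - ev (partials (cav_poly t)).2 z.
Proof.
rewrite !d1_ev !d2_ev; case: z => x y; apply: ev_partialsE => a b.
under eq_fun do rewrite /vex_poly evD (evN (cav_poly t)) !evD (evN (F0 P)) evC evM evC.
have h0 := is_derive_ev (F0 P) x y a b 0.
have h1 := is_derive_ev (F1 P) x y a b 0.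
have h2 := is_derive_ev (cav_poly t) x y a b 0.
by apply: is_derive_eq; rewrite /GRing.scale/= !mul0r !addr0; ring.
Qed.

(** The value of [Grho] at a point, with [z] the old and [z'] the new phase fields and [t] the new
    temperature. *)
Definition split_grad1 z z' t : R :=
  d1 (psi_vex P ^~ t) z' + d1 (psi_cav P ^~ t) z.
Definition split_grad2 z z' t : R :=
  d2 (psi_vex P ^~ t) z' + d2 (psi_cav P ^~ t) z.

Lemma split_grad1E z z' t : split_grad1 z z' t =
  - d1 (ev (F0 P)) z' + t * d1 (ev (F1 P)) z'
  + 4 * split_M P * (1 + t) * ((1 + abs2 z' ^+ 2) * z'.1 - (1 + abs2 z ^+ 2) * z.1).
Proof.
rewrite /split_grad1 psi_vexE psi_cavE d1_ev [X in _ + X]d1_ev.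
by rewrite (vex_partials t z').1 !(cav_partials _ _).1; ring.
Qed.

Lemma split_grad2E z z' t : split_grad2 z z' t =
  - d2 (ev (F0 P)) z' + t * d2 (ev (F1 P)) z'
  + 4 * split_M P * (1 + t) * ((1 + abs2 z' ^+ 2) * z'.2 - (1 + abs2 z ^+ 2) * z.2).
Proof.
rewrite /split_grad2 psi_vexE psi_cavE d2_ev [X in _ + X]d2_ev.
by rewrite (vex_partials t z').2 !(cav_partials _ _).2; ring.
Qed.

(** The convex part lies above its tangent at the new state, the concave part below its tangent at
    the old one: the implicit-explicit choice of the scheme. *)
Lemma splitting_convexity z z' t : 0 < t -> psi P z' t - psi P z t <=
  split_grad1 z z' t * (z'.1 - z.1) + split_grad2 z z' t * (z'.2 - z.2).
Proof.
move=> t0; have [_ _ _ _ [_ /(_ t t0) [cv cc]]] := P_adm.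
rewrite psi_vexE in cv.
have e : (fun z => - psi_cav P z t) = ev (- cav_poly t).
  by apply/funext => w; rewrite evN -psi_cavE.
rewrite e in cc.
have h1 := convex_tangent z' z cv.
have h2 := convex_tangent z z' cc.
rewrite /split_grad1 /split_grad2 psi_vexE psi_cavE.
have n : ev (partials (- cav_poly t)).1 z = - d1 (ev (cav_poly t)) z /\
         ev (partials (- cav_poly t)).2 z = - d2 (ev (cav_poly t)) z.
  rewrite d1_ev d2_ev; case: (z) => x y; apply: ev_partialsE => a b.
  under eq_fun do rewrite evN.
  have h3 := is_derive_ev (cav_poly t) x y a b 0.
  by apply: is_derive_eq; rewrite !mul0r !addr0; ring.
rewrite d1_ev d2_ev in h1.
rewrite d1_ev d2_ev n.1 n.2 !(evN (cav_poly t)) d1_ev d2_ev in h2.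
rewrite d1_ev d2_ev [d1 _ z]d1_ev [d2 _ z]d2_ev.
have v w : psi P w t = ev (vex_poly t) w + ev (cav_poly t) w.
  by rewrite -psi_vexE -psi_cavE /psi_vex /psi_cav addrK.
rewrite !v; lra.
Qed.

(** The passage goes through [(z, t')]: concavity in the temperature at fixed [z], then the
    splitting at fixed [t'], which is why the discrete potentials use the new temperature. *)
Lemma availability_step z z' t t' : 0 < t -> 0 < t' ->
  s_bulk P z t - s_bulk P z' t' <=
  - ((internal_energy P z' t' - internal_energy P z t) * t')
  + (split_grad1 z z' t' * (z'.1 - z.1) + split_grad2 z z' t' * (z'.2 - z.2)).
Proof.
move=> t0 t'0; have h1 := splitting_convexity z z' t'0.
have h2 := psi_concave_theta q1 z e1 eq0 t0 t'0.
rewrite /s_bulk; lra.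
Qed.

Lemma split_grad_bound : exists2 C, 0 <= C & forall z z' t, 0 < t ->
  `|split_grad1 z z' t| <= C * ((1 + t) * (1 + norm_sum z' ^+ 3 + norm_sum z ^+ 3)) /\
  `|split_grad2 z z' t| <= C * ((1 + t) * (1 + norm_sum z' ^+ 3 + norm_sum z ^+ 3)).
Proof.
have [_ _ [[_ _ [CF0 hF0]] [_ _ [CF1 hF1]]] _ _] := P_adm.
pose m := split_M P.
(* [CF0] and [CF1] come without a sign. The gradient of the quartic splitting term has the factor
   [4 * m], doubled by the sum of the two bounds from [cavb]. *)
exists (`|CF0| + `|CF1| + 8 * m); first by rewrite !addr_ge0// mulr_ge0// ltW.
move=> z z' t t0; rewrite split_grad1E split_grad2E -/m.
have cube w : abs2 w ^+ 3 <= norm_sum w ^+ 3.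
  by rewrite lerXn2r ?nnegrE ?abs2_ge0 ?norm_sum_ge0 ?abs2_le_norm_sum.
have c0 w : 0 <= norm_sum w ^+ 3 by rewrite exprn_ge0// norm_sum_ge0.
have lin (r : R) : 0 <= r -> (1 + r ^+ 2) * r <= 1 + 2 * r ^+ 3.
  move=> r0; have : r <= 1 + r ^+ 3; last by rewrite mulrDl mul1r -exprSr; lra.
  have [r1|/ltW r1] := leP r 1; first by rewrite (le_trans r1)// lerDl exprn_ge0.
  by rewrite (le_trans (ler_eXnr (isT : (0 < 3)%N) r1))// lerDr.
have gr (F : {poly {poly R}}) CF w x :
    grad_abs (ev F) w <= CF * (1 + abs2 w ^+ 3) -> x <= grad_abs (ev F) w ->
    x <= `|CF| * (1 + norm_sum w ^+ 3).
  move=> h1 h2; apply: (le_trans (le_trans h2 h1)).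
  have h3 : 0 <= 1 + abs2 w ^+ 3 by rewrite addr_ge0// exprn_ge0 ?abs2_ge0.
  apply: (@le_trans _ _ (`|CF| * (1 + abs2 w ^+ 3))).
    by rewrite ler_wpM2r// ler_norm.
  by rewrite ler_wpM2l// lerD2l.
have cavb w x : `|x| <= abs2 w ->
    `|(1 + abs2 w ^+ 2) * x| <= 1 + 2 * norm_sum w ^+ 3.
  move=> xw; rewrite normrM ger0_norm ?addr_ge0 ?sqr_ge0//.
  apply: (@le_trans _ _ ((1 + abs2 w ^+ 2) * abs2 w)).
    by rewrite ler_wpM2l// addr_ge0// sqr_ge0.
  apply: (le_trans (lin _ (abs2_ge0 w))).
  by have := cube w; lra.
have main (g0 g1 c c' : R) : `|g0| <= `|CF0| * (1 + norm_sum z' ^+ 3) ->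
    `|g1| <= `|CF1| * (1 + norm_sum z' ^+ 3) ->
    `|c'| <= 1 + 2 * norm_sum z' ^+ 3 -> `|c| <= 1 + 2 * norm_sum z ^+ 3 ->
    `|- g0 + t * g1 + 4 * m * (1 + t) * (c' - c)| <=
    (`|CF0| + `|CF1| + 8 * m) * ((1 + t) * (1 + norm_sum z' ^+ 3 + norm_sum z ^+ 3)).
  move=> h0 h1 h2 h3.
  rewrite (le_trans (ler_normD _ _))// [leRHS]mulrDl lerD//.
    rewrite (le_trans (ler_normD _ _))// [leRHS]mulrDl lerD//.
      rewrite normrN (le_trans h0)// ler_wpM2l//.
      have := c0 z; have := c0 z'; move: (norm_sum z ^+ 3) (norm_sum z' ^+ 3).
      by move=> A B B0 A0; nra.
    rewrite normrM (ger0_norm (ltW t0)).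
    apply: (@le_trans _ _ (t * (`|CF1| * (1 + norm_sum z' ^+ 3)))).
      by rewrite ler_wpM2l// ltW.
    rewrite mulrCA ler_wpM2l//.
    have := c0 z; have := c0 z'; move: (norm_sum z ^+ 3) (norm_sum z' ^+ 3).
    by move=> A B B0 A0; nra.
  have pos : 0 <= 4 * m * (1 + t) by rewrite !mulr_ge0 ?addr_ge0 ?(ltW M0) ?(ltW t0).
  rewrite normrM ger0_norm//.
  rewrite (_ : 8 * m * _ = 4 * m * (1 + t) *
    (2 * (1 + norm_sum z' ^+ 3 + norm_sum z ^+ 3))); last by ring.
  by rewrite ler_wpM2l// (le_trans (ler_normB _ _))//; lra.
split; apply: main.
- by apply: (gr _ _ _ _ (hF0 z').1); exact: (norm1_le_abs2 (_, _)).
- by apply: (gr _ _ _ _ (hF1 z').1); exact: (norm1_le_abs2 (_, _)).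
- by apply: cavb; exact: norm1_le_abs2.
- by apply: cavb; exact: norm1_le_abs2.
- by apply: (gr _ _ _ _ (hF0 z').1); exact: (norm2_le_abs2 (_, _)).
- by apply: (gr _ _ _ _ (hF1 z').1); exact: (norm2_le_abs2 (_, _)).
- by apply: cavb; exact: norm2_le_abs2.
- by apply: cavb; exact: norm2_le_abs2.
Qed.

Definition density z t : R := t + t `^ (- q P) + (z.1 ^+ 4 + z.2 ^+ 4).

Lemma density_ge0 z t : 0 < t -> 0 <= density z t.
Proof.
move=> t0; rewrite !addr_ge0 ?powR_ge0 ?(ltW t0)//; by rewrite (exprM _ 2 2) sqr_ge0.
Qed.

Lemma density_le_avail : exists2 c, 0 < c & exists C, forall z t, 0 < t ->
  c * density z t - C <= avail_a P * internal_energy P z t - s_bulk P z t.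
Proof.
have [_ _ _ [_ [ca [Ca [ca0 Ca0 hF]]]] _] := P_adm.
have [c c0 [C hC]] := avail_coercive q1 e1 eq0 a0 ca0 Ca0 hF.
exists c => //; exists C => z t t0; apply: le_trans (hC z t t0).
by rewrite lerD2r ler_pM2l// lerD2l quartic_le_abs2.
Qed.

Lemma energy_entropy_bound : exists2 C, 0 <= C & forall z t, 0 < t ->
  `|internal_energy P z t| + `|s_bulk P z t| <= C * (1 + density z t).
Proof.
have [_ _ [[dF0 _ _] [dF1 _ _]] _ _] := P_adm.
have [C0 C00 hF0] := degree_le4_bound dF0.
have [C1 C10 hF1] := degree_le4_bound dF1.
have [K hK] := abs_ln_le (lt_trans ltr01 q1) (@ltr01 R).
pose k := epsq P * (q P / (q P - 1)).
have k0 : 0 < k by rewrite mulr_gt0// divr_gt0 ?subr_gt0// (lt_trans ltr01).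
pose L := `|K| + 1.
(* The coefficients of [D] in [b1] and [b2] below, added. *)
exists (2 + L * (eps1 P + 1) + epsq P + eps1 P + 2 * k + C0 + C1).
  by do ?[exact: ltW | apply: addr_ge0 | apply: mulr_ge0].
move=> z t t0; rewrite internal_energyE// s_bulkE// -/k.
have := hK t t0; have := powR_onem_le q1 ltr01 t0; rewrite powR1 !mul1r.
have := inv_le_powR q1 t0; have := hF0 z; have := hF1 z.
set p := t `^ (- q P); set r := t `^ (1 - q P).
have p0 : 0 < p by exact: powR_gt0.
have r0 : 0 < r by exact: powR_gt0.
have Q0 : 0 <= z.1 ^+ 4 + z.2 ^+ 4 by rewrite addr_ge0// (exprM _ 2 2) sqr_ge0.
rewrite /density -/p; move: (z.1 ^+ 4 + z.2 ^+ 4) Q0 => Q Q0 f1 f0 ht hr hl.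
pose D := 1 + (t + p + Q).
have D1 : 1 <= D by rewrite lerDl !addr_ge0 ?(ltW t0) ?(ltW p0).
have tD : t <= D by rewrite /D; lra.
have pD : 1 + p <= D by rewrite /D; lra.
have QD : 1 + Q <= D by rewrite /D; lra.
have lD : `|ln t| <= L * D.
  apply: (le_trans hl); rewrite mulrDl mul1r addrC lerD//; last by rewrite /D; lra.
  by rewrite (le_trans (ler_norm _))// ler_peMr.
have ti : 0 < t^-1 by rewrite invr_gt0.
have b1 : `|t^-1 - eps1 P * ln t + epsq P * p + ev (F1 P) z| <=
   D + eps1 P * (L * D) + epsq P * D + C1 * D.
  rewrite (le_trans (ler_normD _ _))// lerD//; last first.
    by rewrite (le_trans f1)// ler_wpM2l.
  rewrite (le_trans (ler_normD _ _))// lerD//; last first.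
    by rewrite gtr0_norm ?mulr_gt0// ler_pM2l//; lra.
  rewrite (le_trans (ler_normB _ _))// lerD//.
    by rewrite gtr0_norm// (le_trans ht).
  by rewrite normrM gtr0_norm// ler_pM2l.
have b2 : `|1 - ln t - eps1 P * t + k * r + ev (F0 P) z| <=
   D + L * D + eps1 P * D + k * (2 * D) + C0 * D.
  rewrite (le_trans (ler_normD _ _))// lerD//; last first.
    by rewrite (le_trans f0)// ler_wpM2l.
  rewrite (le_trans (ler_normD _ _))// lerD//; last first.
    by rewrite (gtr0_norm (mulr_gt0 k0 r0)); apply: ler_wpM2l; [exact: ltW|lra].
  rewrite (le_trans (ler_normB _ _))// lerD//; last first.
    by rewrite (gtr0_norm (mulr_gt0 e1 t0)); apply: ler_wpM2l; [exact: ltW|lra].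
  by rewrite (le_trans (ler_normB _ _))// lerD// normr1.
rewrite -/D; lra.
Qed.

End Splitting.

(** * The energy inequality *)

Section MobilityForm.
Variables (R : realType) (d : nat).
Implicit Types (a b g : 'cV[R]_d) (A : 'M[R]_(d + (d + 1))).

Lemma dotC n (u v : 'cV[R]_n) : dot u v = dot v u.
Proof. by rewrite !dotE; apply: eq_bigr => i _; rewrite mulrC. Qed.

Lemma dotDl n (u v w : 'cV[R]_n) : dot (u + v) w = dot u w + dot v w.
Proof. by rewrite dotC dotDr !(dotC w). Qed.

Lemma dotZl n (u v : 'cV[R]_n) (c : R) : dot (c *: u) v = c * dot u v.
Proof. by rewrite dotC dotZr dotC. Qed.

Lemma dotN n (u v : 'cV[R]_n) : dot u (- v) = - dot u v.
Proof. by rewrite /dot mulmxN mxE. Qed.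

Lemma dotNl n (u v : 'cV[R]_n) : dot (- u) v = - dot u v.
Proof. by rewrite dotC dotN dotC. Qed.

Lemma dot_col n m (u u' : 'cV[R]_n) (v v' : 'cV[R]_m) :
  dot (col_mx u v) (col_mx u' v') = dot u u' + dot v v'.
Proof. by rewrite /dot tr_col_mx mul_row_col mxE. Qed.

Lemma enorm_dot n (u : 'cV[R]_n) : enorm u ^+ 2 = dot u u.
Proof.
by rewrite enorm_sqr dotE; apply: eq_bigr => i _; rewrite expr2.
Qed.

(** With the temperature gradient negated, the two fluxes and the rate of [eta] are the block rows
    of the mobility applied to this vector. *)
Definition thermo_force a g (m : R) : 'cV[R]_(d + (d + 1)) :=
  col_mx a (col_mx (- g) m%:M).

Lemma thermo_force_norm a g m : enorm (thermo_force a g m) ^+ 2 =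
  enorm a ^+ 2 + enorm g ^+ 2 + m ^+ 2.
Proof.
rewrite !enorm_dot !dot_col dotN dotC dotN opprK addrA; congr (_ + _).
by rewrite dotE big_ord1 !mxE eqxx mulr1n expr2.
Qed.

Lemma mobility_form A a g m : A^T = A ->
  dot (L11 A *m a - L12 A *m g + m *: L13 A) a
  - dot ((L12 A)^T *m a - L22 A *m g + m *: L23 A) g
  + (dot (L13 A) a - dot (L23 A) g + L33 A * m) * m
  = dot (thermo_force a g m) (A *m thermo_force a g m).
Proof.
move=> sA.
have e1 : ursubmx A = row_mx (L12 A) (L13 A) by rewrite hsubmxK.
have e2 : dlsubmx A = col_mx (L12 A)^T (L13 A)^T.
  by rewrite -tr_row_mx -e1 trmx_ursub sA.
have e3 : drsubmx A = block_mx (L22 A) (L23 A) (L23 A)^T (drsubmx (drsubmx A)).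
  rewrite -[LHS]submxK; congr block_mx.
  by rewrite /L23 trmx_ursub trmx_drsub sA.
rewrite /thermo_force -[in RHS](submxK A) mul_block_col dot_col.
rewrite e1 e2 e3 mul_row_col mul_block_col mul_col_mx add_col_mx dot_col.
have c1 : drsubmx (drsubmx A) = (L33 A)%:M.
  by apply/matrixP => i j; rewrite !ord1 [RHS]mxE eqxx mulr1n.
rewrite c1 -/(L11 A) !mul_mx_scalar !mulmxN.
have dS (r s : R) : dot (r%:M : 'cV[R]_1) s%:M = r * s.
  by rewrite dotE big_ord1 !mxE eqxx !mulr1n.
have m1 (v w : 'cV[R]_d) : v^T *m w = (dot v w)%:M.
  by apply/matrixP => i j; rewrite !ord1 [RHS]mxE eqxx mulr1n.
have sN (r : R) : - r%:M = (- r)%:M :> 'cV[R]_1 by rewrite -raddfN.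
have sD (r s : R) : r%:M + s%:M = (r + s)%:M :> 'cV[R]_1 by rewrite -raddfD.
rewrite !m1 scale_scalar_mx sN !sD dS.
rewrite !(dotDl, dotDr, dotNl, dotN, dotZl, dotZr).
by rewrite ![dot a _]dotC ![dot g _]dotC; ring.
Qed.

End MobilityForm.

(** * Bounded measurable functions on the torus *)

Section IntT.
Variables (R : realType) (d : nat).
Implicit Types (f g : 'cV[R]_d -> R) (F G : 'cV[R]_d -> 'cV[R]_d).
Local Notation RT := (measurableTypeR R).

Definition bmT f := bm (fun t : d.-tuple RT => f (of_tuple t)).

Lemma bmT_D f g : bmT f -> bmT g -> bmT (fun x => f x + g x).
Proof. exact: bmD. Qed.
Lemma bmT_B f g : bmT f -> bmT g -> bmT (fun x => f x - g x).
Proof. exact: bmB. Qed.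
Lemma bmT_N f : bmT f -> bmT (fun x => - f x).
Proof. exact: bmN. Qed.
Lemma bmT_M f g : bmT f -> bmT g -> bmT (fun x => f x * g x).
Proof. exact: bmM. Qed.
Lemma bmT_X f n : bmT f -> bmT (fun x => f x ^+ n).
Proof. exact: bmX. Qed.
Lemma bmT_cst (c : R) : bmT (fun=> c).
Proof. exact: bm_cst. Qed.
Lemma bmT_norm f : bmT f -> bmT (fun x => `|f x|).
Proof. exact: bm_norm. Qed.
Lemma bmT_sum (I : finType) (F : I -> 'cV[R]_d -> R) :
  (forall i, bmT (F i)) -> bmT (fun x => \sum_i F i x).
Proof. by move=> h; exact: bm_sum. Qed.

Lemma intT_le f g : bmT f -> bmT g -> (forall x, f x <= g x) -> intT f <= intT g.
Proof. by move=> bf bg fg; exact: E_le. Qed.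

Lemma intT_ge0 f : (forall x, 0 <= f x) -> 0 <= intT f.
Proof. by move=> f0; exact: E_ge0. Qed.

Lemma intT_ext f g : f =1 g -> intT f = intT g.
Proof. by move=> fg; exact: E_ext. Qed.

Lemma intT_D f g : bmT f -> bmT g -> intT (fun x => f x + g x) = intT f + intT g.
Proof. exact: E_D. Qed.

Lemma intT_B f g : bmT f -> bmT g -> intT (fun x => f x - g x) = intT f - intT g.
Proof. exact: E_B. Qed.

Lemma intT_Z (c : R) f : bmT f -> intT (fun x => c * f x) = c * intT f.
Proof. exact: E_Z. Qed.

Lemma intT_cst (c : R) : intT (fun _ : 'cV[R]_d => c) = c.
Proof. exact: E_cst. Qed.

Lemma intT_cauchy_schwarz f g : bmT f -> bmT g ->
  intT (fun x => f x * g x) ^+ 2 <=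
  intT (fun x => f x ^+ 2) * intT (fun x => g x ^+ 2).
Proof. exact: E_cauchy_schwarz. Qed.

Definition bmv F := forall j, bmT (fun x => F x j 0).

Lemma bmT_dot F G : bmv F -> bmv G -> bmT (fun x => dot (F x) (G x)).
Proof.
move=> bF bG; rewrite (_ : (fun x => _) = fun x => \sum_i F x i 0 * G x i 0).
  by apply: bmT_sum => i; apply: bmT_M.
by apply/funext => x; rewrite dotE.
Qed.

Lemma bmv_D F G : bmv F -> bmv G -> bmv (fun x => F x + G x).
Proof.
move=> bF bG j; rewrite (_ : (fun x => _) = fun x => F x j 0 + G x j 0).
  exact: bmT_D.
by apply/funext => x; rewrite mxE.
Qed.

Lemma bmv_N F : bmv F -> bmv (fun x => - F x).
Proof.
move=> bF j; rewrite (_ : (fun x => _) = fun x => - F x j 0).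
  exact: bmT_N.
by apply/funext => x; rewrite mxE.
Qed.

Lemma bmv_Z f F : bmT f -> bmv F -> bmv (fun x => f x *: F x).
Proof.
move=> bf bF j; rewrite (_ : (fun x => _) = fun x => f x * F x j 0).
  exact: bmT_M.
by apply/funext => x; rewrite mxE.
Qed.

Lemma bmv_mulmx (M : 'cV[R]_d -> 'M[R]_d) F :
  (forall i j, bmT (fun x => M x i j)) -> bmv F -> bmv (fun x => M x *m F x).
Proof.
move=> bM bF j; rewrite (_ : (fun x => _) = fun x => \sum_k M x j k * F x k 0).
  by apply: bmT_sum => k; exact: bmT_M.
by apply/funext => x; rewrite mxE.
Qed.

Lemma bmT_ln f (m : R) : 0 < m -> bmT f -> (forall x, m <= f x) ->
  bmT (fun x => ln (f x)).
Proof.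
move=> m0 [mf [M fM]] fm.
have f0 x : 0 < f x by exact: lt_le_trans (fm x).
apply: (@bm_between _ _ _ _ (ln m) (ln M)); first exact: measurableT_comp.
move=> t; have fMt : f (of_tuple t) <= M by rewrite (le_trans (ler_norm _)).
rewrite ler_ln ?posrE ?f0// fm/= ler_ln ?posrE ?f0//.
exact: lt_le_trans fMt.
Qed.

Lemma bmT_powRN f (m p : R) : 0 < m -> 0 <= p -> bmT f -> (forall x, m <= f x) ->
  bmT (fun x => f x `^ (- p)).
Proof.
move=> m0 p0 [mf [M fM]] fm.
have f0 x : 0 < f x by exact: lt_le_trans (fm x).
apply: (@bm_between _ _ _ _ 0 (m `^ (- p))).
  by apply: (measurableT_comp (f := fun r : R => r `^ (- p))).
move=> t; rewrite powR_ge0/= !powRN lef_pV2 ?posrE ?powR_gt0//.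
by apply: ge0_ler_powR; rewrite ?nnegrE ?(ltW m0) ?(ltW (f0 _)).
Qed.

Lemma bmT_ev (F : {poly {poly R}}) (z1 z2 : 'cV[R]_d -> R) : bmT z1 -> bmT z2 ->
  bmT (fun x => ev F (z1 x, z2 x)).
Proof.
move=> b1 b2; elim/poly_ind: F => [|F c IH].
  by rewrite (_ : (fun x => _) = fun=> 0); [exact: bmT_cst|apply/funext => x; rewrite ev0].
rewrite (_ : (fun x => _) = fun x => ev F (z1 x, z2 x) * z1 x + c.[z2 x]).
  by apply: bmT_D; [exact: bmT_M|exact: (bm_poly c b2)].
by apply/funext => x; rewrite ev_MXaddC.
Qed.

Variable K : periodic_mesh R d.

Lemma bmv_grad v : Vh K v -> bmv (grad v).
Proof.
move=> Kv j; rewrite (_ : (fun x => _) = fun x => 'D_(delta_mx j 0) v x).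
  exact: (Vh_derive_bm (delta_mx j 0) Kv).
by apply/funext => x; rewrite mxE.
Qed.

End IntT.

Section EnergyStep.
Variables (R : realType) (d : nat) (P : params R).
Variable L : R * R -> R -> 'M[R]_(d + (d + 1)).
Variables (K : periodic_mesh R d) (tau : R) (u : discrete R d) (N : nat).
Hypothesis P_adm : admissible_params P d.
Hypothesis L_adm : admissible_mobility L.
Hypothesis tau_gt0 : 0 < tau.
Hypothesis sol : discrete_solution P L K tau u N.

Let q1 : 1 < q P. Proof. by case: P_adm => -[]. Qed.

Lemma sol_state n : (n <= N)%N ->
  [/\ Vh K (rho u n), Vh K (theta u n), Vh K (eta u n) & forall x, 0 < theta u n x].
Proof. by case: sol => h _ _; exact: h. Qed.

Lemma sol_potentials n : (n < N)%N -> Vh K (mu_rho u n.+1) /\ Vh K (mu_eta u n.+1).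
Proof. by case: sol => _ h _; exact: h. Qed.

Lemma state_bm n : (n <= N)%N ->
  [/\ bmT (rho u n), bmT (theta u n) & bmT (eta u n)].
Proof.
move=> /sol_state[r t e _].
by split; [exact: (Vh_bm r)|exact: (Vh_bm t)|exact: (Vh_bm e)].
Qed.

Lemma theta_bm n : (n <= N)%N ->
  bmT (fun x => ln (theta u n x)) /\
  (forall p, 0 <= p -> bmT (fun x => theta u n x `^ (- p))).
Proof.
move=> nN; have [_ tV _ t0] := sol_state nN; have [_ bt _] := state_bm nN.
have [m m0 hm] := Vh_lower_bound tV t0.
by split=> [|p p0]; [exact: bmT_ln m0 bt hm|exact: bmT_powRN m0 p0 bt hm].
Qed.

Lemma ev_zh_bm F n : (n <= N)%N -> bmT (fun x => ev F (zh u n x)).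
Proof. by move=> /state_bm[br _ be]; exact: bmT_ev. Qed.

Lemma eh_bm n : (n <= N)%N -> bmT (eh P u n).
Proof.
move=> nN; have [_ _ _ t0] := sol_state nN; have [_ bt _] := state_bm nN.
have [bln bpow] := theta_bm nN.
rewrite (_ : eh P u n = fun x => theta u n x `^ (- 1) - eps1 P * ln (theta u n x)
    + epsq P * theta u n x `^ (- q P) + ev (F1 P) (zh u n x)).
  apply: bmT_D; last exact: ev_zh_bm.
  apply: bmT_D; last by apply: bmT_M; [exact: bmT_cst|apply: bpow; have := q1; lra].
  by apply: bmT_B; [exact: bpow|apply: bmT_M => //; exact: bmT_cst].
apply/funext => x; rewrite /eh internal_energyE// powR_inv1//.
exact: ltW.
Qed.

Lemma sh_bm n : (n <= N)%N -> bmT (sh P u n).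
Proof.
move=> nN; have [_ _ _ t0] := sol_state nN; have [_ bt _] := state_bm nN.
have [bln bpow] := theta_bm nN.
rewrite (_ : sh P u n = fun x => 1 - ln (theta u n x) - eps1 P * theta u n x
    + epsq P * (q P / (q P - 1)) * theta u n x `^ (- (q P - 1))
    + ev (F0 P) (zh u n x)).
  apply: bmT_D; last exact: ev_zh_bm.
  apply: bmT_D; last by apply: bmT_M; [exact: bmT_cst|apply: bpow; have := q1; lra].
  apply: bmT_B; last by apply: bmT_M => //; exact: bmT_cst.
  by apply: bmT_B => //; exact: bmT_cst.
by apply/funext => x; rewrite /sh s_bulkE// opprB.
Qed.

Lemma abs2_zh_bm n : (n <= N)%N -> bmT (fun x => abs2 (zh u n x) ^+ 2).
Proof.
move=> /state_bm[br _ be]; rewrite (_ : (fun x => _) =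
    fun x => rho u n x ^+ 2 + eta u n x ^+ 2).
  by apply: bmT_D; exact: bmT_X.
by apply/funext => x; rewrite abs2_sqr.
Qed.

Lemma Grho_bm n : (n < N)%N -> bmT (Grho P u n).
Proof.
move=> nN; have nN' := ltnW nN.
have [br bt be] := state_bm nN; have [br0 _ be0] := state_bm nN'.
have := abs2_zh_bm nN; have := abs2_zh_bm nN' => b2 b1.
rewrite (_ : Grho P u n = fun x => - ev (partials (F0 P)).1 (zh u n.+1 x)
  + theta u n.+1 x * ev (partials (F1 P)).1 (zh u n.+1 x)
  + 4 * split_M P * (1 + theta u n.+1 x) * ((1 + abs2 (zh u n.+1 x) ^+ 2) * rho u n.+1 x
     - (1 + abs2 (zh u n x) ^+ 2) * rho u n x)).
  have c (r : R) := @bmT_cst R d r.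
  have bF0 := ev_zh_bm (partials (F0 P)).1 nN.
  have bF1 := ev_zh_bm (partials (F1 P)).1 nN.
  exact: (bmT_D (bmT_D (bmT_N bF0) (bmT_M bt bF1))
    (bmT_M (bmT_M (c (4 * split_M P)) (bmT_D (c 1) bt))
      (bmT_B (bmT_M (bmT_D (c 1) b1) br) (bmT_M (bmT_D (c 1) b2) br0)))).
by apply/funext => x; rewrite -!d1_ev -split_grad1E.
Qed.

Lemma Geta_bm n : (n < N)%N -> bmT (Geta P u n).
Proof.
move=> nN; have nN' := ltnW nN.
have [br bt be] := state_bm nN; have [br0 _ be0] := state_bm nN'.
have := abs2_zh_bm nN; have := abs2_zh_bm nN' => b2 b1.
rewrite (_ : Geta P u n = fun x => - ev (partials (F0 P)).2 (zh u n.+1 x)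
  + theta u n.+1 x * ev (partials (F1 P)).2 (zh u n.+1 x)
  + 4 * split_M P * (1 + theta u n.+1 x) * ((1 + abs2 (zh u n.+1 x) ^+ 2) * eta u n.+1 x
     - (1 + abs2 (zh u n x) ^+ 2) * eta u n x)).
  have c (r : R) := @bmT_cst R d r.
  have bF0 := ev_zh_bm (partials (F0 P)).2 nN.
  have bF1 := ev_zh_bm (partials (F1 P)).2 nN.
  exact: (bmT_D (bmT_D (bmT_N bF0) (bmT_M bt bF1))
    (bmT_M (bmT_M (c (4 * split_M P)) (bmT_D (c 1) bt))
      (bmT_B (bmT_M (bmT_D (c 1) b1) be) (bmT_M (bmT_D (c 1) b2) be0)))).
by apply/funext => x; rewrite -!d2_ev -split_grad2E.
Qed.

(** Continuity of [L] is given at positive temperatures, and [theta] takes only such values. *)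
Lemma Lh_bm n i j : (n <= N)%N -> bmT (fun x => Lh L u n x i j).
Proof.
move=> nN; have [[cr _ _] [ct _ _] [ce _ _] t0] := sol_state nN.
have [cL [B hB] _ _] := L_adm.
split.
  apply: (@continuous_of_tuple_measurable R d (fun x => Lh L u n x i j)) => x.
  have cz : {for x, continuous (fun x => (zh u n x, theta u n x))}.
    exact: (cvg_pair (cvg_pair (cr x) (ce x)) (ct x)).
  have := cL (zh u n x, theta u n x) (t0 x) => cLx.
  have := continuous_comp cz cLx => cLh.
  exact: (continuous_comp cLh (@coord_continuous _ _ _ i j _)).
by exists B => t; rewrite (le_trans (mx_norm_coord _ _ _))// hB.
Qed.

Lemma flux_bm n : (n < N)%N ->
  [/\ bmv (flux_rho L u n), bmv (flux_e L u n) & bmT (rate_eta L u n)].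
Proof.
move=> nN; have nN' := ltnW nN.
have [_ tV _ _] := sol_state nN; have [mr me] := sol_potentials nN.
have gt := bmv_grad tV; have gm := bmv_grad mr; have bme : bmT (mu_eta u n.+1) := Vh_bm me.
have b i j := Lh_bm i j nN'.
have b11 i j : bmT (fun x => L11 (Lh L u n x) i j).
  by under eq_fun do rewrite !mxE; exact: b.
have b12 i j : bmT (fun x => L12 (Lh L u n x) i j).
  by under eq_fun do rewrite !mxE; exact: b.
have b12T i j : bmT (fun x => (L12 (Lh L u n x))^T i j).
  by under eq_fun do rewrite !mxE; exact: b.
have b22 i j : bmT (fun x => L22 (Lh L u n x) i j).
  by under eq_fun do rewrite !mxE; exact: b.
have b13 : bmv (fun x => L13 (Lh L u n x)).
  by move=> i; under eq_fun do rewrite !mxE; exact: b.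
have b23 : bmv (fun x => L23 (Lh L u n x)).
  by move=> i; under eq_fun do rewrite !mxE; exact: b.
have b33 : bmT (fun x => L33 (Lh L u n x)).
  by under eq_fun do rewrite /L33 !mxE; exact: b.
split.
- exact: (bmv_D (bmv_D (bmv_mulmx b11 gm) (bmv_N (bmv_mulmx b12 gt))) (bmv_Z bme b13)).
- exact: (bmv_D (bmv_D (bmv_mulmx b12T gm) (bmv_N (bmv_mulmx b22 gt))) (bmv_Z bme b23)).
- exact: (bmT_D (bmT_B (bmT_dot b13 gm) (bmT_dot b23 gt)) (bmT_M b33 bme)).
Qed.

End EnergyStep.

Section EnergyInequality.
Variables (R : realType) (d : nat) (P : params R).
Variable L : R * R -> R -> 'M[R]_(d + (d + 1)).
Variables (K : periodic_mesh R d) (tau : R) (u : discrete R d) (N : nat).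
Hypothesis P_adm : admissible_params P d.
Hypothesis L_adm : admissible_mobility L.
Hypothesis tau_gt0 : 0 < tau.
Hypothesis sol : discrete_solution P L K tau u N.
Variable lam : R.
Hypothesis L_coercive : forall z t (zeta : 'cV[R]_(d + (d + 1))), 0 < t ->
  lam * enorm zeta ^+ 2 <= dot zeta (L z t *m zeta).

Lemma Vh_cst (c : R) : Vh K (fun=> c).
Proof.
split=> // [x|i]; first exact: cst_continuous.
by exists 0, c => x _; rewrite /dot trmx0 mul0mx mxE add0r.
Qed.

Lemma grad_cst (c : R) (x : 'cV[R]_d) : grad (fun=> c) x = 0.
Proof. by apply/matrixP => i j; rewrite !mxE; exact: derive_cst. Qed.

Lemma ip_delta (v : nat -> 'cV[R]_d -> R) w n :
  bmT (v n) -> bmT (v n.+1) -> bmT w ->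
  tau * ip (delta tau v n) w = ip (v n.+1) w - ip (v n) w.
Proof.
move=> b0 b1 bw; rewrite /ip -intT_B; [|exact: bmT_M..].
rewrite -intT_Z; last first.
  by apply: bmT_M => //; apply: bmT_M; [exact: bmT_B|exact: bmT_cst].
apply: intT_ext => x; rewrite /delta.
by field; rewrite gt_eqF.
Qed.

(** Expands the square of the difference of the gradients, pointwise; the gradient of the difference
    never appears. *)
Lemma gradL2sq_half (v w : 'cV[R]_d -> R) : Vh K v -> Vh K w ->
  (gradL2sq v - gradL2sq w) / 2 <= ipv (grad v) (grad v) - ipv (grad v) (grad w).
Proof.
move=> /bmv_grad gv /bmv_grad gw.
have e (f : 'cV[R]_d -> R) : gradL2sq f = ipv (grad f) (grad f).
  by apply: intT_ext => x; rewrite enorm_dot.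
rewrite !e; set A := ipv (grad v) (grad v); set B := ipv (grad v) (grad w).
set C := ipv (grad w) (grad w).
suff : 0 <= A - 2 * B + C by lra.
rewrite /A /B /C /ipv -intT_Z; last exact: bmT_dot.
rewrite -intT_B; [|exact: bmT_dot|]; last first.
  by apply: bmT_M; [exact: bmT_cst|exact: bmT_dot].
rewrite -intT_D; [| |exact: bmT_dot]; last first.
  apply: bmT_B; first exact: bmT_dot.
  by apply: bmT_M; [exact: bmT_cst|exact: bmT_dot].
apply: intT_ge0 => x.
have := sqr_ge0 (enorm (grad v x - grad w x)); rewrite enorm_dot.
rewrite !(dotDl, dotDr, dotNl, dotN) (dotC (grad w x) (grad v x)).
by congr (_ <= _); ring.
Qed.

(* The relations for the potentials are tested with the two time levels separately:
   on the mesh skeleton [grad] takes junk values and is not additive. *)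
Lemma energy_step n : (n < N)%N ->
  availability P u n.+1 + tau * (lam * (gradL2sq (mu_rho u n.+1)
    + gradL2sq (theta u n.+1) + normL2sq (mu_eta u n.+1))) <= availability P u n.
Proof.
move=> nN; have nN' := ltnW nN.
have [rV tV eV t0] := sol_state sol nN; have [rV0 tV0 eV0 t00] := sol_state sol nN'.
have [mrV meV] := sol_potentials sol nN.
have [br bt be] := state_bm sol nN; have [br0 _ be0] := state_bm sol nN'.
have bmr : bmT (mu_rho u n.+1) := Vh_bm mrV.
have bme : bmT (mu_eta u n.+1) := Vh_bm meV.
have beh := eh_bm P_adm sol nN; have beh0 := eh_bm P_adm sol nN'.
have bsh := sh_bm P_adm sol nN; have bsh0 := sh_bm P_adm sol nN'.
have bGr := Grho_bm sol nN; have bGe := Geta_bm sol nN.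
have [bfr bfe bra] := flux_bm L_adm sol nN.
have [_ _ /(_ n nN) sch] := sol.
(* [E1] and [E4] test the balances with the potentials, [E2] and [E5] the potential relations with
   the new phase fields, [E3] the energy balance with 1 for conservation. The next line supplies the
   old phase fields and, in [E3'], the temperature. *)
have [E1 E2 E3 E4 E5] := sch _ _ _ _ _ mrV rV (Vh_cst 1) meV eV.
have [_ E2' E3' _ E5'] := sch _ _ _ _ _ mrV rV0 tV meV eV0.
have dr := ip_delta br0 br bmr; have de := ip_delta be0 be bme.
have d3 := ip_delta beh0 beh bt; have d3' := ip_delta beh0 beh (@bmT_cst R d 1).
set X1 := ipv (flux_rho L u n) _ in E1.
set X3 := ipv (flux_e L u n) (grad (theta u n.+1)) in E3'.
set X4 := ip (rate_eta L u n) _ in E4.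
have z3 : ipv (flux_e L u n) (grad (fun=> 1)) = 0.
  rewrite -[RHS](intT_cst d); apply: intT_ext => x.
  by rewrite grad_cst /dot mulmx0 mxE.
rewrite z3 addr0 in E3.
have energy_conserved : intT (eh P u n.+1) = intT (eh P u n).
  move: d3'; rewrite E3 mulr0 /ip => /esym/eqP; rewrite subr_eq0 => /eqP.
  under eq_fun do rewrite mulr1.
  by under [X in _ = intT X -> _]eq_fun do rewrite mulr1.
have hX1 : ip (rho u n.+1) (mu_rho u n.+1) - ip (rho u n) (mu_rho u n.+1) = - (tau * X1).
  by rewrite -dr -mulrN; congr (_ * _); apply/eqP; rewrite -addr_eq0 E1.
have hX3 : ip (eh P u n.+1) (theta u n.+1) - ip (eh P u n) (theta u n.+1) = - (tau * X3).
  by rewrite -d3 -mulrN; congr (_ * _); apply/eqP; rewrite -addr_eq0 E3'.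
have hX4 : ip (eta u n.+1) (mu_eta u n.+1) - ip (eta u n) (mu_eta u n.+1) = - (tau * X4).
  by rewrite -de -mulrN; congr (_ * _); apply/eqP; rewrite -addr_eq0 E4.
have ipC (f g : 'cV[R]_d -> R) : ip f g = ip g f.
  by apply: intT_ext => x; rewrite mulrC.
rewrite ![ip (rho _ _) _]ipC in hX1; rewrite ![ip (eta _ _) _]ipC in hX4.
rewrite E2 E2' in hX1; rewrite E5 E5' in hX4.
have sL z t : 0 < t -> (L z t)^T = L z t by case: L_adm => _ _ + _; apply.
have dissip : lam * (gradL2sq (mu_rho u n.+1) + gradL2sq (theta u n.+1)
    + normL2sq (mu_eta u n.+1)) <= X1 - X3 + X4.
  have bg (v : 'cV[R]_d -> R) : Vh K v -> bmT (fun x => enorm (grad v x) ^+ 2).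
    move=> /bmv_grad g; under eq_fun do rewrite enorm_dot; exact: bmT_dot.
  have gmr := bmv_grad mrV; have gt := bmv_grad tV.
  rewrite /gradL2sq /normL2sq -intT_D; [|exact: bg..].
  rewrite -intT_D; [|by apply: bmT_D; exact: bg|exact: bmT_X].
  have b3 := bmT_D (bmT_D (bg _ mrV) (bg _ tV)) (bmT_X 2 bme).
  rewrite -(intT_Z lam b3).
  rewrite /X1 /X3 /X4 /ip /ipv -intT_B; [|exact: bmT_dot..].
  rewrite -intT_D; [|by apply: bmT_B; exact: bmT_dot|exact: bmT_M].
  apply: intT_le.
  - exact: (bmT_M (@bmT_cst R d lam) b3).
  - exact: (bmT_D (bmT_B (bmT_dot bfr gmr) (bmT_dot bfe gt)) (bmT_M bra bme)).
  move=> x; rewrite /flux_rho /flux_e /rate_eta mobility_form; last exact: sL.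
  by rewrite -thermo_force_norm; exact: L_coercive.
have entropy : intT (sh P u n) - intT (sh P u n.+1) <=
    - (ip (eh P u n.+1) (theta u n.+1) - ip (eh P u n) (theta u n.+1))
    + (ip (Grho P u n) (rho u n.+1) - ip (Grho P u n) (rho u n))
    + (ip (Geta P u n) (eta u n.+1) - ip (Geta P u n) (eta u n)).
  have m1 := bmT_M beh bt; have m2 := bmT_M beh0 bt.
  have m3 := bmT_M bGr br; have m4 := bmT_M bGr br0.
  have m5 := bmT_M bGe be; have m6 := bmT_M bGe be0.
  rewrite /ip -(intT_B m1 m2) -(intT_B m3 m4) -(intT_B m5 m6) -(intT_B bsh0 bsh).
  rewrite -[- intT _]mulN1r -(intT_Z (-1) (bmT_B m1 m2)).
  have m12 := bmT_M (@bmT_cst R d (-1)) (bmT_B m1 m2).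
  have m34 := bmT_B m3 m4; have m56 := bmT_B m5 m6.
  rewrite -(intT_D m12 m34) -(intT_D (bmT_D m12 m34) m56).
  apply: intT_le.
  - exact: bmT_B.
  - exact: (bmT_D (bmT_D m12 m34) m56).
  move=> x; have h : sh P u n x - sh P u n.+1 x <=
      - ((eh P u n.+1 x - eh P u n x) * theta u n.+1 x)
      + (Grho P u n x * (rho u n.+1 x - rho u n x)
         + Geta P u n x * (eta u n.+1 x - eta u n x)).
    exact: (availability_step P_adm (zh u n x) (zh u n.+1 x) (t00 x) (t0 x)).
  by apply: (le_trans h); rewrite le_eqVlt; apply/orP; left; apply/eqP; ring.
have [_ [_ _ gr0 ge0] _ _ _] := P_adm.
have hr := gradL2sq_half rV rV0; have he := gradL2sq_half eV eV0.
have hr' := ler_wpM2l (ltW gr0) hr; have he' := ler_wpM2l (ltW ge0) he.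
have hd := ler_wpM2l (ltW tau_gt0) dissip.
rewrite /availability energy_conserved.
rewrite hX3 in entropy.
move: hX1 hX4 entropy hr' he' hd.
move: (ipv (grad (rho u n.+1)) (grad (rho u n.+1))) (ipv _ (grad (rho u n))).
move: (ipv (grad (eta u n.+1)) (grad (eta u n.+1))) (ipv _ (grad (eta u n))).
move: (ip (Grho P u n) _) (ip (Grho P u n) _) (ip (Geta P u n) _) (ip (Geta P u n) _).
move: (intT (sh _ _ _)) (intT (sh _ _ _)) (intT (eh _ _ _)) (X1) (X3) (X4).
move: (gradL2sq (rho _ _)) (gradL2sq (rho _ _)) (gradL2sq (eta _ _)) (gradL2sq (eta _ _)).
move: (lam * _) (gamma_rho P) (gamma_eta P) (avail_a P) => D g1 g2 a.
clear; move=> *; lra.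
Qed.

End EnergyInequality.

(** * A priori bounds *)

Section WeightedCube.
Variables (R : realType) (d : nat).
Implicit Types (f w : 'cV[R]_d -> R).

(** Hoelder's inequality with exponents 4 and 4/3, by Cauchy-Schwarz twice: first for [f * w] and
    [w ^ 2], then for [f ^ 2] and [w ^ 2]. *)
Lemma intT_mul_cube f w : bmT f -> bmT w ->
  intT (fun x => f x * w x ^+ 3) ^+ 4 <=
  intT (fun x => f x ^+ 4) * intT (fun x => w x ^+ 4) ^+ 3.
Proof.
move=> bf bw.
have cs1 := intT_cauchy_schwarz (bmT_M bf bw) (bmT_X 2 bw).
have cs2 := intT_cauchy_schwarz (bmT_X 2 bf) (bmT_X 2 bw).
have e1 : (fun x => f x * w x * w x ^+ 2) = (fun x => f x * w x ^+ 3).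
  by apply/funext => x; rewrite [w x ^+ 3]exprS mulrA.
have e2 : (fun x => (f x * w x) ^+ 2) = (fun x => f x ^+ 2 * w x ^+ 2).
  by apply/funext => x; rewrite exprMn.
have e3 (g : 'cV[R]_d -> R) : (fun x => (g x ^+ 2) ^+ 2) = (fun x => g x ^+ 4).
  by apply/funext => x; rewrite -exprM.
rewrite e1 e2 e3 in cs1; rewrite !e3 in cs2.
move: cs1 cs2; set I := intT _; set J := intT _; set W := intT _; set F := intT _.
have J0 : 0 <= J by apply: intT_ge0 => x; rewrite mulr_ge0 ?sqr_ge0.
have W0 : 0 <= W by apply: intT_ge0 => x; rewrite (exprM _ 2 2) sqr_ge0.
move=> cs1 cs2; rewrite (exprM I 2 2).
apply: (@le_trans _ _ ((J * W) ^+ 2)).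
  by rewrite lerXn2r// nnegrE ?sqr_ge0// mulr_ge0.
by rewrite exprMn [W ^+ 3]exprS mulrA ler_wpM2r ?sqr_ge0.
Qed.

End WeightedCube.

(** Here [nm], [nt], [ne] are the squared L2 norms of [mu_rho], [theta], [mu_eta]; [gm], [gt] those
    of the gradients; [m], [s] the squared means. The bound on [m] involves only [theta], so
    Poincare's inequality for [theta] breaks the circle. *)
Lemma dissipation_arith (R : realFieldType) (gm gt nm nt ne k D m s : R) :
  m <= k * (1 + (nt + gt)) -> nm <= m + gm -> nt <= s + gt -> s <= D ->
  0 <= gm -> 0 <= gt -> 0 <= ne -> 0 <= k -> 0 <= D ->
  nm + gm + (nt + gt) + ne <= (2 * k * (1 + D) + 2 + D) * (1 + (gm + gt + ne)).
Proof.
move=> mm pm pt ts g1 g2 g3 k0 D0.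
have h2 : m <= k * (1 + D + 2 * gt).
  by apply: (le_trans mm); rewrite ler_wpM2l//; lra.
have h3 : 0 <= k * D * (gm + gt + ne) by rewrite !mulr_ge0 ?addr_ge0.
have h4 : 0 <= k * gm by rewrite mulr_ge0.
have h5 : 0 <= k * ne by rewrite mulr_ge0.
have h6 : 0 <= k * D by rewrite mulr_ge0.
have h7 : 0 <= D * (gm + gt + ne) by rewrite mulr_ge0 ?addr_ge0.
lra.
Qed.

Section APriori.
Variables (R : realType) (d : nat) (P : params R).
Variable L : R * R -> R -> 'M[R]_(d + (d + 1)).
Variables (K : periodic_mesh R d) (tau : R) (u : discrete R d) (N : nat).
Hypothesis d_range : (1 <= d <= 3)%N.
Hypothesis P_adm : admissible_params P d.
Hypothesis L_adm : admissible_mobility L.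
Hypothesis tau_gt0 : 0 < tau.
Hypothesis sol : discrete_solution P L K tau u N.
Variables (lam c C C0 : R).
Hypothesis lam_gt0 : 0 < lam.
Hypothesis L_coercive : forall z t (zeta : 'cV[R]_(d + (d + 1))), 0 < t ->
  lam * enorm zeta ^+ 2 <= dot zeta (L z t *m zeta).
Hypothesis c_gt0 : 0 < c.
Hypothesis density_le : forall z t, 0 < t ->
  c * density P z t - C <= avail_a P * internal_energy P z t - s_bulk P z t.
Hypothesis init : availability P u 0 <= C0.

Let gr0 : 0 < gamma_rho P. Proof. by case: P_adm => _ []. Qed.
Let ge0 : 0 < gamma_eta P. Proof. by case: P_adm => _ []. Qed.
Let q1 : 1 < q P. Proof. by case: P_adm => -[]. Qed.

Definition total_density n : R := intT (fun x => density P (zh u n x) (theta u n x)).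

Definition dissipated n : R :=
  gradL2sq (mu_rho u n.+1) + gradL2sq (theta u n.+1) + normL2sq (mu_eta u n.+1).

Lemma gradL2sq_ge0 (v : 'cV[R]_d -> R) : 0 <= gradL2sq v.
Proof. by apply: intT_ge0 => x; exact: sqr_ge0. Qed.

Lemma normL2sq_ge0 (v : 'cV[R]_d -> R) : 0 <= normL2sq v.
Proof. by apply: intT_ge0 => x; exact: sqr_ge0. Qed.

Lemma dissipated_ge0 n : 0 <= dissipated n.
Proof. by rewrite !addr_ge0 ?gradL2sq_ge0 ?normL2sq_ge0. Qed.

Lemma density_bm n : (n <= N)%N ->
  bmT (fun x => density P (zh u n x) (theta u n x)).
Proof.
move=> nN; have [br bt be] := state_bm sol nN; have [_ bp] := theta_bm sol nN.
have q0 : 0 <= q P by rewrite ltW// (lt_trans ltr01).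
exact: (bmT_D (bmT_D bt (bp _ q0)) (bmT_D (bmT_X 4 br) (bmT_X 4 be))).
Qed.

Lemma total_density_ge0 n : (n <= N)%N -> 0 <= total_density n.
Proof.
move=> nN; have [_ _ _ t0] := sol_state sol nN.
by apply: intT_ge0 => x; exact: density_ge0.
Qed.

Lemma availability_ge n : (n <= N)%N ->
  c * total_density n + gamma_rho P / 2 * gradL2sq (rho u n)
  + gamma_eta P / 2 * gradL2sq (eta u n) - C <= availability P u n.
Proof.
move=> nN; have [_ _ _ t0] := sol_state sol nN.
have bD := density_bm nN; have be := eh_bm P_adm sol nN; have bs := sh_bm P_adm sol nN.
have bcD := bmT_M (@bmT_cst R d c) bD.
have bae := bmT_M (@bmT_cst R d (avail_a P)) be.
have h : c * total_density n - C <= avail_a P * intT (eh P u n) - intT (sh P u n).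
  rewrite -[C in _ - C](intT_cst d) -(intT_Z c bD) -(intT_Z _ be).
  rewrite -(intT_B bcD (@bmT_cst R d C)) -(intT_B bae bs).
  apply: intT_le; [exact: (bmT_B bcD (@bmT_cst R d C))|exact: (bmT_B bae bs)|].
  by move=> x; exact: density_le.
rewrite /availability; move: h.
move: (total_density _) (gradL2sq _) (gradL2sq _) (intT _) (intT _) => *; lra.
Qed.

Lemma availability_decay n : (n <= N)%N ->
  availability P u n + tau * (lam * \sum_(0 <= k < n) dissipated k) <= C0.
Proof.
elim: n => [|n IH] nN; first by rewrite big_geq// !mulr0 addr0.
rewrite big_nat_recr//= mulrDr mulrDr addrCA.
have := energy_step P_adm L_adm tau_gt0 sol L_coercive nN; rewrite -/(dissipated n).
have := IH (ltnW nN).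
move: (availability _ _ _) (availability _ _ _) (tau * _) (tau * _) => *; lra.
Qed.

Lemma sum_dissipated_ge0 n : 0 <= tau * (lam * \sum_(0 <= k < n) dissipated k).
Proof.
apply: mulr_ge0; first exact: ltW.
apply: mulr_ge0; first exact: ltW.
by apply: sumr_ge0 => k _; exact: dissipated_ge0.
Qed.

Lemma coercive_bound n : (n <= N)%N ->
  c * total_density n + gamma_rho P / 2 * gradL2sq (rho u n)
  + gamma_eta P / 2 * gradL2sq (eta u n)
  + tau * (lam * \sum_(0 <= k < n) dissipated k) <= C0 + C.
Proof.
move=> nN; have := availability_ge nN; have := availability_decay nN.
move: (c * _) (_ * gradL2sq _) (_ * gradL2sq _) (tau * _) (availability _ _ _).
by move=> *; lra.
Qed.

(** Built from the section constants alone, like [quartic_const] and [dissipation_const] below;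
    hence independent of the mesh, the time step and the solution. The absolute value covers an
    unknown sign. *)
Definition density_const : R := `|C0 + C| / c.

Lemma density_const_ge0 : 0 <= density_const.
Proof. by rewrite divr_ge0// ltW. Qed.

Let grad_terms_ge0 n : 0 <= gamma_rho P / 2 * gradL2sq (rho u n) /\
  0 <= gamma_eta P / 2 * gradL2sq (eta u n).
Proof.
by split; apply: mulr_ge0; rewrite ?gradL2sq_ge0// divr_ge0// ltW.
Qed.

Lemma total_density_le n : (n <= N)%N -> total_density n <= density_const.
Proof.
move=> nN; rewrite ler_pdivlMr// mulrC; have := coercive_bound nN.
have [g1 g2] := grad_terms_ge0 n; have := sum_dissipated_ge0 n.
have := ler_norm (C0 + C).
move: (c * _) (_ * gradL2sq _) (_ * gradL2sq _) (tau * _) `|_| g1 g2.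
by move=> *; lra.
Qed.

Lemma grad_bounds n : (n <= N)%N ->
  gradL2sq (rho u n) <= `|C0 + C| / (gamma_rho P / 2) /\
  gradL2sq (eta u n) <= `|C0 + C| / (gamma_eta P / 2).
Proof.
move=> nN; have := coercive_bound nN.
have [g1 g2] := grad_terms_ge0 n; have := sum_dissipated_ge0 n.
have := ler_norm (C0 + C).
have : 0 <= c * total_density n by rewrite mulr_ge0 ?total_density_ge0// ltW.
move=> h1 h2 h3 h4; split; rewrite ler_pdivlMr ?divr_gt0// mulrC; move: h1 h2 h3 h4 g1 g2;
  move: (c * _) (_ * gradL2sq _) (_ * gradL2sq _) (tau * _) `|_|; move=> *; lra.
Qed.

Lemma sum_dissipated_le n : (n <= N)%N ->
  tau * \sum_(0 <= k < n) dissipated k <= `|C0 + C| / lam.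
Proof.
move=> nN; rewrite ler_pdivlMr// mulrAC -mulrA; have := coercive_bound nN.
have [g1 g2] := grad_terms_ge0 n; have := ler_norm (C0 + C).
have : 0 <= c * total_density n by rewrite mulr_ge0 ?total_density_ge0// ltW.
move: g1 g2.
move: (c * _) (_ * gradL2sq _) (_ * gradL2sq _) (tau * _) `|_|; move=> *; lra.
Qed.

Lemma total_densityE n : (n <= N)%N -> total_density n =
  intT (theta u n) + intT (fun x => theta u n x `^ (- q P))
  + (intT (fun x => rho u n x ^+ 4) + intT (fun x => eta u n x ^+ 4)).
Proof.
move=> nN; have [br bt be] := state_bm sol nN; have [_ bp] := theta_bm sol nN.
have q0 : 0 <= q P by rewrite ltW// (lt_trans ltr01).
have bq := bp _ q0; have b4r := bmT_X 4 br; have b4e := bmT_X 4 be.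
rewrite -(intT_D b4r b4e) -(intT_D bt bq).
by rewrite -(intT_D (bmT_D bt bq) (bmT_D b4r b4e)).
Qed.

Lemma quartic_ge0 (x : R) : 0 <= x ^+ 4.
Proof. by rewrite (exprM x 2 2) sqr_ge0. Qed.

Lemma total_density_terms n : (n <= N)%N ->
  [/\ 0 <= intT (theta u n), 0 <= intT (fun x => theta u n x `^ (- q P)),
      0 <= intT (fun x => rho u n x ^+ 4) & 0 <= intT (fun x => eta u n x ^+ 4)].
Proof.
move=> nN; have [_ _ _ t0] := sol_state sol nN.
split; apply: intT_ge0 => x; [exact: ltW|exact: powR_ge0|exact: quartic_ge0..].
Qed.

Lemma normL2sq_le_quartic (v : 'cV[R]_d -> R) : bmT v ->
  normL2sq v <= 1 + intT (fun x => v x ^+ 4).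
Proof.
move=> bv; rewrite -[1](intT_cst d) -(intT_D (@bmT_cst R d 1) (bmT_X 4 bv)).
apply: intT_le; [exact: bmT_X|exact: (bmT_D (@bmT_cst R d 1) (bmT_X 4 bv))|].
move=> x; have := sqr_ge0 (v x ^+ 2 - 1); rewrite (exprM _ 2 2) => h.
by have := sqr_ge0 (v x); lra.
Qed.

(** The quartic terms count twice, once for themselves and once as bounds for the L2 norms; hence
    the factor 2 and the additive 2. *)
Lemma state_norms_le n : (n <= N)%N -> state_norms P u n <=
  2 + 2 * density_const + `|C0 + C| / (gamma_rho P / 2) + `|C0 + C| / (gamma_eta P / 2).
Proof.
move=> nN; have [br bt be] := state_bm sol nN; have [_ _ _ t0] := sol_state sol nN.
have [g1 g2] := grad_bounds nN; have := total_density_le nN.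
have [p1 p2 p3 p4] := total_density_terms nN.
rewrite total_densityE// /state_norms /normH1sq.
have := normL2sq_le_quartic br; have := normL2sq_le_quartic be.
have -> : normL1 (theta u n) = intT (theta u n).
  by apply: intT_ext => x; rewrite gtr0_norm.
have e (v : 'cV[R]_d -> R) : normL4pow4 v = intT (fun x => v x ^+ 4).
  by apply: intT_ext => x; rewrite -normrX ger0_norm// quartic_ge0.
rewrite !e; move: g1 g2 p1 p2 p3 p4.
move: (_ / (gamma_rho P / 2)) (_ / (gamma_eta P / 2)) density_const.
move: (gradL2sq _) (gradL2sq _) (normL2sq _) (normL2sq _).
by move: (intT _) (intT _) (intT _) (intT _) => *; lra.
Qed.

Lemma energy_entropy_le Ce n : (n <= N)%N -> 0 <= Ce ->
  (forall z t, 0 < t ->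
    `|internal_energy P z t| + `|s_bulk P z t| <= Ce * (1 + density P z t)) ->
  normL1 (eh P u n) + normL1 (sh P u n) <= Ce * (1 + density_const).
Proof.
move=> nN Ce0 hCe; have [_ _ _ t0] := sol_state sol nN.
have be := bmT_norm (eh_bm P_adm sol nN); have bs := bmT_norm (sh_bm P_adm sol nN).
have bD := density_bm nN; have b1D := bmT_D (@bmT_cst R d 1) bD.
rewrite /normL1 -(intT_D be bs).
apply: (@le_trans _ _ (Ce * (1 + total_density n))).
  rewrite -[1](intT_cst d) -(intT_D (@bmT_cst R d 1) bD) -(intT_Z Ce b1D).
  apply: intT_le; [exact: bmT_D|exact: (bmT_M (@bmT_cst R d Ce) b1D)|].
  by move=> x; exact: hCe.
by rewrite ler_wpM2l// lerD2l total_density_le.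
Qed.

Lemma mean_mu_rho n : (n < N)%N -> intT (mu_rho u n.+1) = intT (Grho P u n).
Proof.
move=> nN; have [_ _ /(_ n nN) sch] := sol; have k1 := Vh_cst K 1.
have [_ + _ _ _] := sch _ _ _ _ _ k1 k1 k1 k1 k1.
have -> : ipv (grad (rho u n.+1)) (grad (fun=> 1)) = 0.
  rewrite -[RHS](intT_cst d); apply: intT_ext => x.
  by rewrite grad_cst /dot mulmx0 mxE.
rewrite mulr0 add0r /ip.
under eq_fun do rewrite mulr1.
by under [X in _ = intT X -> _]eq_fun do rewrite mulr1.
Qed.

Lemma intT_theta_le n : (n <= N)%N -> intT (theta u n) <= density_const.
Proof.
move=> nN; have [_ p2 p3 p4] := total_density_terms nN.
have := total_density_le nN; rewrite total_densityE//; move: p2 p3 p4.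
by move: (intT _) (intT _) (intT _) (intT _) density_const => *; lra.
Qed.

(** The factor 8 is that of [norm_sum_quartic]. The summand 1 makes the constant at least 1, so that
    it also serves the weight [w = 1] and allows a cube to be raised to a fourth power. *)
Definition quartic_const : R := 1 + 8 * density_const.

(** Taking the square root of Hoelder's bound on [I ^+ 4] leaves linear growth in the squared H1
    norm of [theta], the most that the dissipation can absorb. *)
Lemma weighted_cube_le n (w : 'cV[R]_d -> R) : (n <= N)%N -> bmT w ->
  intT (fun x => w x ^+ 4) <= quartic_const ->
  intT (fun x => (1 + theta u n x) * w x ^+ 3) ^+ 2 <=
  8 * quartic_const ^+ 2 * (1 + normH1sq (theta u n)).
Proof.
move=> nN bw hw; have [_ bt _] := state_bm sol nN; have [_ tV _ _] := sol_state sol nN.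
have b1t := bmT_D (@bmT_cst R d 1) bt.
have := intT_mul_cube b1t bw; set I := intT (fun x => _ * w x ^+ 3).
set W := intT (fun x => w x ^+ 4) in hw *; set F := intT (fun x => _ ^+ 4).
set H := normH1sq _.
have H0 : 0 <= H by rewrite addr_ge0 ?normL2sq_ge0 ?gradL2sq_ge0.
have W0 : 0 <= W by apply: intT_ge0 => x; exact: quartic_ge0.
have B1 : 1 <= quartic_const by rewrite lerDl mulr_ge0// density_const_ge0.
(* The factor 64 is 8 from the fourth power of [1 + theta] times 8 from [Vh_ladyzhenskaya]. *)
have hF : F <= 64 * (1 + H) ^+ 2.
  apply: (@le_trans _ _ (8 * (1 + intT (fun x => theta u n x ^+ 4)))).
    have b4 := bmT_X 4 bt; have b14 := bmT_D (@bmT_cst R d 1) b4.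
    have -> : 8 * (1 + intT (fun x => theta u n x ^+ 4)) =
        intT (fun x => 8 * (1 + theta u n x ^+ 4)).
      by rewrite (intT_Z 8 b14) (intT_D (@bmT_cst R d 1) b4) intT_cst.
    apply: intT_le; [exact: bmT_X|exact: (bmT_M (@bmT_cst R d 8) b14)|].
    move=> x; have h (a b : R) : (a + b) ^+ 2 <= 2 * (a ^+ 2 + b ^+ 2).
      by have := sqr_ge0 (a - b); lra.
    have h1 := h 1 (theta u n x); have h2 := h 1 (theta u n x ^+ 2).
    rewrite !expr1n in h1 h2; rewrite !(exprM _ 2 2).
    apply: (@le_trans _ _ ((2 * (1 + theta u n x ^+ 2)) ^+ 2)).
      by rewrite lerXn2r// nnegrE ?sqr_ge0// mulr_ge0// addr_ge0// sqr_ge0.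
    by rewrite exprMn; lra.
  have := Vh_ladyzhenskaya d_range tV; rewrite -/H.
  by move: (intT _) => J hJ; have := sqr_ge0 H; nra.
move=> hI.
have I4 : I ^+ 4 <= (8 * quartic_const ^+ 2 * (1 + H)) ^+ 2.
  apply: (le_trans hI).
  apply: (@le_trans _ _ (64 * (1 + H) ^+ 2 * quartic_const ^+ 3)).
    apply: ler_pM => //; first by apply: intT_ge0 => x; exact: quartic_ge0.
      by rewrite exprn_ge0.
    by rewrite lerXn2r// nnegrE// (le_trans W0).
  have -> : (8 * quartic_const ^+ 2 * (1 + H)) ^+ 2 =
    64 * (1 + H) ^+ 2 * quartic_const ^+ 4 by ring.
  by rewrite ler_wpM2l ?ler_weXn2l// mulr_ge0 ?sqr_ge0.
rewrite -(@ler_pXn2r _ 2)// ?nnegrE ?sqr_ge0//; first by rewrite -exprM.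
by apply: mulr_ge0; [rewrite mulr_ge0 ?sqr_ge0|exact: addr_ge0].
Qed.

Lemma norm_sum_bm n : (n <= N)%N -> bmT (fun x => norm_sum (zh u n x)).
Proof.
by move=> nN; have [br _ be] := state_bm sol nN; exact: (bmT_D (bmT_norm br) (bmT_norm be)).
Qed.

Lemma norm_sum_quartic_le n : (n <= N)%N ->
  intT (fun x => norm_sum (zh u n x) ^+ 4) <= quartic_const.
Proof.
move=> nN; have [br _ be] := state_bm sol nN.
have bD := bmT_D (bmT_X 4 br) (bmT_X 4 be).
apply: (@le_trans _ _ (8 * (intT (fun x => rho u n x ^+ 4) + intT (fun x => eta u n x ^+ 4)))).
  rewrite -(intT_D (bmT_X 4 br) (bmT_X 4 be)) -(intT_Z 8 bD).
  apply: intT_le; [exact/bmT_X/norm_sum_bm|exact: (bmT_M (@bmT_cst R d 8) bD)|].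
  by move=> x; exact: norm_sum_quartic.
have := total_density_le nN; rewrite total_densityE// /quartic_const.
have [p1 p2 _ _] := total_density_terms nN; move: p1 p2.
by move: (intT _) (intT _) (intT _) (intT _) density_const => *; lra.
Qed.

Variable Cg : R.
Hypothesis Cg_ge0 : 0 <= Cg.
Hypothesis grad_bound : forall z z' t, 0 < t -> `|split_grad1 P z z' t| <=
  Cg * ((1 + t) * (1 + norm_sum z' ^+ 3 + norm_sum z ^+ 3)).

(** The growth bound for the potential gradient splits into weighted cubes with the weights 1, new
    [norm_sum] and old [norm_sum]. For [mu_eta] no such step arises: the dissipation contains its L2
    norm. *)
Lemma mean_mu_rho_le n : (n < N)%N -> intT (mu_rho u n.+1) ^+ 2 <=
  72 * Cg ^+ 2 * quartic_const ^+ 2 * (1 + normH1sq (theta u n.+1)).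
Proof.
move=> nN; have nN' := ltnW nN; have [_ _ _ t0] := sol_state sol nN.
rewrite mean_mu_rho//; have bG := Grho_bm sol nN; have [_ bt _] := state_bm sol nN.
have b1t := bmT_D (@bmT_cst R d 1) bt.
have c1 : bmT (fun _ : 'cV[R]_d => 1 : R) := @bmT_cst R d 1.
have w1 := norm_sum_bm nN; have w0 := norm_sum_bm nN'.
have k1 := bmT_M b1t (bmT_X 3 c1).
have k2 := bmT_M b1t (bmT_X 3 w1); have k3 := bmT_M b1t (bmT_X 3 w0).
pose I1 := intT (fun x => (1 + theta u n.+1 x) * 1 ^+ 3).
pose I2 := intT (fun x => (1 + theta u n.+1 x) * norm_sum (zh u n.+1 x) ^+ 3).
pose I3 := intT (fun x => (1 + theta u n.+1 x) * norm_sum (zh u n x) ^+ 3).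
have hI : `|intT (Grho P u n)| <= Cg * (I1 + I2 + I3).
  have k123 := bmT_D (bmT_D k1 k2) k3.
  rewrite /I1 /I2 /I3 -(intT_D k1 k2) -(intT_D (bmT_D k1 k2) k3) -(intT_Z Cg k123).
  have bR := bmT_M (@bmT_cst R d Cg) k123.
  have pt x : `|Grho P u n x| <= Cg * ((1 + theta u n.+1 x) * 1 ^+ 3 +
      (1 + theta u n.+1 x) * norm_sum (zh u n.+1 x) ^+ 3 +
      (1 + theta u n.+1 x) * norm_sum (zh u n x) ^+ 3).
    by rewrite -!mulrDr expr1n; exact: grad_bound.
  rewrite ler_norml; apply/andP; split.
    rewrite -mulN1r -(intT_Z (-1) bR).
    apply: intT_le => //; first exact: (bmT_M (@bmT_cst R d (-1)) bR).
    by move=> x; rewrite mulN1r; have := pt x; rewrite ler_norml => /andP[].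
  apply: intT_le => // x; have := pt x; rewrite ler_norml => /andP[_].
  exact.
have B1 : 1 <= quartic_const by rewrite lerDl mulr_ge0// density_const_ge0.
have h1 : I1 ^+ 2 <= 8 * quartic_const ^+ 2 * (1 + normH1sq (theta u n.+1)).
  apply: weighted_cube_le => //; rewrite (_ : (fun _ => _) = fun=> 1).
    by rewrite intT_cst.
  by apply/funext => x; rewrite expr1n.
have h2 := weighted_cube_le nN w1 (norm_sum_quartic_le nN).
have h3 := weighted_cube_le nN w0 (norm_sum_quartic_le nN').
rewrite -/I2 in h2; rewrite -/I3 in h3.
rewrite -real_normK ?num_real//.
apply: (@le_trans _ _ ((Cg * (I1 + I2 + I3)) ^+ 2)).
  by rewrite lerXn2r// nnegrE// (le_trans _ hI).
rewrite exprMn.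
(* 72 is 9, from squaring a sum of three terms, times the 8 of [weighted_cube_le]. *)
have -> : 72 * Cg ^+ 2 * quartic_const ^+ 2 * (1 + normH1sq (theta u n.+1)) =
  Cg ^+ 2 * (9 * (8 * quartic_const ^+ 2 * (1 + normH1sq (theta u n.+1)))) by ring.
rewrite ler_wpM2l ?sqr_ge0//.
move: h1 h2 h3; move: (8 * _ * _) (I1) (I2) (I3) => S J1 J2 J3 h1 h2 h3.
have := sqr_ge0 (J1 - J2); have := sqr_ge0 (J1 - J3); have := sqr_ge0 (J2 - J3); lra.
Qed.

(** The constant of [dissipation_arith] for [k = 72 * Cg ^+ 2 * quartic_const ^+ 2] and
    [D = density_const ^+ 2]. *)
Definition dissipation_const : R :=
  144 * Cg ^+ 2 * quartic_const ^+ 2 * (1 + density_const ^+ 2) + 2 + density_const ^+ 2.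

Lemma dissipation_norms_le n : (n < N)%N ->
  dissipation_norms u n <= dissipation_const * (1 + dissipated n).
Proof.
move=> nN; have [_ tV _ _] := sol_state sol nN; have [mV _] := sol_potentials sol nN.
have pm := Vh_poincare d_range mV; have pt := Vh_poincare d_range tV.
have mm := mean_mu_rho_le nN.
have [t1 _ _ _] := total_density_terms nN; have td := intT_theta_le nN.
have ts : intT (theta u n.+1) ^+ 2 <= density_const ^+ 2.
  by rewrite lerXn2r// nnegrE// (le_trans t1).
have g1 := gradL2sq_ge0 (mu_rho u n.+1); have g2 := gradL2sq_ge0 (theta u n.+1).
have g3 := normL2sq_ge0 (mu_eta u n.+1).
rewrite /dissipation_norms /dissipation_const /dissipated /normH1sq in mm *.
have k0 : 0 <= 72 * Cg ^+ 2 * quartic_const ^+ 2.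
  by apply: mulr_ge0; [apply: mulr_ge0 => //|]; exact: sqr_ge0.
have D0 := sqr_ge0 density_const.
have -> : 144 * Cg ^+ 2 * quartic_const ^+ 2 * (1 + density_const ^+ 2) =
  2 * (72 * Cg ^+ 2 * quartic_const ^+ 2) * (1 + density_const ^+ 2) by ring.
move: mm pm pt ts g1 g2 g3 k0 D0.
move: (72 * _ * _) (density_const ^+ 2) (intT (mu_rho _ _) ^+ 2) (intT (theta _ _) ^+ 2).
move: (gradL2sq (mu_rho _ _)) (gradL2sq (theta _ _)) (normL2sq (mu_rho _ _))
  (normL2sq (theta _ _)) (normL2sq (mu_eta _ _)).
exact: dissipation_arith.
Qed.

Lemma dissipation_const_ge0 : 0 <= dissipation_const.
Proof.
rewrite /dissipation_const; have D0 := sqr_ge0 density_const.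
apply: addr_ge0 => //; apply: addr_ge0 => //; apply: mulr_ge0; last exact: addr_ge0.
by apply: mulr_ge0; [apply: mulr_ge0 => //|]; exact: sqr_ge0.
Qed.

Lemma sum_dissipation_norms_le : tau * \sum_(0 <= n < N) dissipation_norms u n <=
  dissipation_const * (tau * N%:R + `|C0 + C| / lam).
Proof.
apply: (@le_trans _ _ (tau * \sum_(0 <= n < N) dissipation_const * (1 + dissipated n))).
  rewrite ler_wpM2l ?(ltW tau_gt0)// big_nat_cond [leRHS]big_nat_cond.
  apply: ler_sum => n /andP[/andP[_ nN] _]; exact: dissipation_norms_le.
rewrite -mulr_sumr mulrCA ler_wpM2l ?dissipation_const_ge0//.
rewrite big_split/= sumr_const_nat subn0 mulrDr lerD//.
exact: sum_dissipated_le.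
Qed.

End APriori.

Theorem theorem3p5 (R : realType) (d : nat) (T : R) (P : params R)
    (L : R * R -> R -> 'M[R]_(d + (d + 1)))
    (I : Type) (mesh : I -> periodic_mesh R d)
    (d_range : (1 <= d <= 3)%N) (T_gt0 : 0 < T)
    (P_adm : admissible_params P d) (L_adm : admissible_mobility L)
    (mesh_sr : shape_regular mesh) (mesh_qu : quasi_uniform mesh) (C0 : R) :
  exists C : R, forall (h : I) (N : nat) (u : discrete R d),
    (0 < N)%N ->
    let tau := T / N%:R in
    discrete_solution P L (mesh h) tau u N ->
    availability P u 0 <= C0 ->
    sup [set state_norms P u n | n in [set n | (n <= N)%N]]
      + tau * \sum_(0 <= n < N) dissipation_norms u n <= C
    /\
    sup [set normL1 (eh P u n) + normL1 (sh P u n) | n in [set n | (n <= N)%N]]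
      <= C.
Proof.
have [_ _ _ [lam [lam1 [lam0 _ hL]]]] := L_adm.
have hL' z t (zeta : 'cV[R]_(d + (d + 1))) : 0 < t ->
    lam * enorm zeta ^+ 2 <= dot zeta (L z t *m zeta).
  by move=> t0; have /andP[] := hL z t zeta t0.
have [c c0 [Cd hd]] := density_le_avail P_adm.
have [Ce Ce0 hCe] := energy_entropy_bound P_adm.
have [Cg Cg0 hCg] := split_grad_bound P_adm.
have hCg' z z' t (t0 : 0 < t) := (hCg z z' t t0).1.
pose S1 := 2 + 2 * density_const c Cd C0 + `|C0 + Cd| / (gamma_rho P / 2)
  + `|C0 + Cd| / (gamma_eta P / 2).
pose S2 := dissipation_const c Cd C0 Cg * (T + `|C0 + Cd| / lam).
pose S3 := Ce * (1 + density_const c Cd C0).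
(* Chosen before the mesh, the number of steps and the solution. The final time enters [S2] as
   [tau * N], the sum over the steps of the constant term in [dissipation_norms_le]. *)
exists (Num.max (S1 + S2) S3) => h N u N0 tau sol init.
have N0' : (0 : R) < N%:R by rewrite ltr0n.
have tau0 : 0 < tau by exact: divr_gt0.
have tauN : tau * N%:R = T by rewrite /tau divfK// gt_eqF.
split; rewrite le_max; apply/orP; [left|right].
  apply: lerD.
    apply: ge_sup; first by exists (state_norms P u 0); exists 0%N.
    move=> _ [n nN <-].
    exact: (state_norms_le P_adm L_adm tau0 sol lam0 hL' c0 hd init).
  rewrite /S2 -tauN.
  exact: (sum_dissipation_norms_le d_range P_adm L_adm tau0 sol lam0 hL' c0 hd init).
apply: ge_sup; first by exists (normL1 (eh P u 0) + normL1 (sh P u 0)); exists 0%N.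
move=> _ [n nN <-].
exact: (energy_entropy_le P_adm L_adm tau0 sol lam0 hL' c0 hd init).
Qed.
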